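(* Let $k,j\in\mathbb{N}$ satisfy $2\le j\le k-1$, and let $a\in\mathbb{N}$ be the unique integer satisfying $1\le a\le k-j$ and $a\equiv k\bmod(k-j)$. Let $\varepsilon=\varepsilon(n)>0$ satisfy $\varepsilon\ll 1$ and $\varepsilon^3n\to\infty$ as $n\to\infty$, let $$p_0:=\frac{1}{\binom{k-j}{a}\binom{n-j}{k-j}},\qquad p=(1+\varepsilon)p_0,$$ and let $\delta=\delta(n)$ satisfy $\varepsilon\ll\delta\le 1$. Let $L$ be the length of the longest $j$-tight path in $H^k(n,p)$. Suppose the algorithm Pathfinder is run with input $k,j$ and $H=H^k(n,p)$, up to the stopping time $T_{\mathrm{stop}}$. Then with high probability the stopping condition that is applied at time $T_{\mathrm{stop}}$ is the one stating that Pathfinder has found a $j$-tight path of length at least $(1-\delta)\frac{\varepsilon n}{(k-j)^2}$. In particular, with high probability $$L\ge \ell_{T_{\mathrm{stop}}}=(1-\delta)\frac{\varepsilon n}{(k-j)^2}.$$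
   Context: $H^k(n,p)$ is the binomial random $k$-uniform hypergraph on $[n]$. A $j$-tight path of length $\ell$ consists of distinct vertices $v_1,\dots,v_{\ell(k-j)+j}$ and edges $e_i=\{v_{(i-1)(k-j)+1},\dots,v_{(i-1)(k-j)+k}\}$, $1\le i\le\ell$. ''With high probability'' means with probability tending to $1$ as $n\to\infty$. $f\ll g$ means $f\le g/C$ for some sufficiently large constant $C$ (depending on $k,j$). Floors and ceilings are ignored (so the displayed equality is up to rounding). Algorithm Pathfinder. Let $r=\lceil\frac{j}{k-j}\rceil-1$, so $j=a+(k-j)r$. An extendable partition of a $j$-set $J$ is an ordered partition $(C_0,C_1,\dots,C_r)$ of $J$ with $|C_0|=a$ and $|C_i|=k-j$ for $i\in[r]$. Given a $k$-uniform hypergraph $H$, first choose uniformly random orders $\sigma_j,\sigma_k$ of the $j$-subsets and of the $k$-subsets of $V(H)$. The algorithm maintains: a partition of the $j$-sets into neutral, active and explored ones, the active ones being stored in a stack and each being equipped with an extendable partition; a current $j$-tight path $P$ with edges $e_1,\dots,e_\ell$ ($\ell$ is its length); batches $\mathcal{B}_0,\dots,\mathcal{B}_\ell$ of $j$-sets; and a time $t$ counting the queries made. Initially all $j$-sets are neutral and $t=0$. Repeat the following. - If there is no active $j$-set (and some neutral one): make a new start, i.e. let $J$ be the first neutral $j$-set in $\sigma_j$, give it an arbitrary extendable partition, make it active, set $\mathcal{B}_0=\{J\}$, $\ell=0$, and let $P$ be the path with vertex set $J$ and no edges. - Otherwise let $J$ be the last $j$-set in the stack, and let $\mathcal{K}$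 be the set of $k$-sets $K\supset J$ which have not been queried from $J$ before, such that $K\setminus J$ is disjoint from $V(P)$ and $K$ contains no explored $j$-set. If $\mathcal{K}\ne\emptyset$: query the first $K\in\mathcal{K}$ in $\sigma_k$, i.e. increase $t$ by $1$ and reveal whether $K\in E(H)$. If $K\in E(H)$, append $K$ to $P$ as its new last edge, increase $\ell$ by $1$, and, where $(C_0,\dots,C_r)$ is the extendable partition of $J$ and $C_{r+1}:=K\setminus J$, make all the sets $J_Z=Z\cup C_2\cup\dots\cup C_{r+1}$ with $Z\in\binom{C_1}{a}$ active (pushed on the stack in the order given by $\sigma_j$), with extendable partitions $(Z,C_2,\dots,C_{r+1})$; these sets form $\mathcal{B}_\ell$. Then record the snapshot $(A_t,E_t,P_t)$ of the active $j$-sets, the explored $j$-sets and the current path. If $\mathcal{K}=\emptyset$: $J$ becomes explored and leaves the stack; if now all of $\mathcal{B}_\ell$ is explored and $\ell\ge1$, remove the last edge $e_\ell$ from $P$ and decrease $\ell$ by $1$. Further notation: $\ell_t=|E(P_t)|$; $D_t=A_t\cup E_t$ is the set of $j$-sets discovered by time $t$; $R_t\subseteq D_t$ is the set of those discovered as new starts; for a vertex set $I$, $d_t(I)$ is the number of $j$-sets in $D_t$ containing $I$. Stopping time. Let $C_{k,j,j-1}\gg C_{k,j,j-2}\gg\dots\gg C_{k,j,0}\gg1$ be sufficiently large constants, $0<\beta\ll1$ a sufficiently small constant (depending on $k,j$), and $T_0:=n^{k-j+1}/\varepsilon$. $T_{\mathrm{stop}}$ is the smallest time $t$ at which one of the following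 four stopping conditions holds: Pathfinder found a path of length at least $(1-\delta)\frac{\varepsilon n}{(k-j)^2}$; or $t=T_0$; or $|R_t|\ge 2(k-j)!\sqrt{\frac{tn^\beta}{n^{k-j}}}+\frac{n^\beta}{2}$; or for some $0\le i\le j-1$ there is an $i$-set $I$ with $d_t(I)\ge\frac{C_{k,j,i}t}{n^{k-j+i}}+n^\beta$. *)

(* Defs.v *)
From HB Require Import structures.
From mathcomp Require Import all_boot all_order all_fingroup all_algebra.
From mathcomp Require Import all_classical all_reals all_analysis.

Set Implicit Arguments.
Unset Strict Implicit.
Unset Printing Implicit Defensive.

Import Order.TTheory GRing.Theory Num.Theory.
Import numFieldNormedType.Exports.

Local Open Scope ring_scope.

Notation subsets n m := {A : {set 'I_n} | #|A| == m}.

Definition hypergraph (n k : nat) := {set subsets n k}.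

Definition edges (n k : nat) (H : hypergraph n k) : {set {set 'I_n}} :=
  [set val K | K in H].

(* The vertices are v`_0, v`_1, ..., and the edge of index i (starting from 0)
   consists of the k consecutive vertices starting at v`_(i * (k - j)). *)
Definition is_tight_path (n k j : nat) (H : hypergraph n k) (l : nat)
    (v : seq 'I_n) : bool :=
  [&& size v == (l * (k - j) + j)%N,
      uniq v &
      [forall i : 'I_l,
         [set x in take k (drop (i * (k - j))%N v)] \in edges H]].

(* A tight path of length l has at least l vertices since j < k, so the bound
   l < n.+1 excludes nothing. *)
Definition longest_tight_path (n k j : nat) (H : hypergraph n k) : nat :=
  (\max_(l < n.+1 |
     [exists v : (l * (k - j) + j).-tuple 'I_n, is_tight_path j H l v]) l)%N.

(* r = ceil (j / (k - j)) - 1 *)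
Definition part_index (k j : nat) : nat :=
  ((j + (k - j).-1) %/ (k - j)).-1.

Definition extendable_partition (n k j a : nat) (J : {set 'I_n})
    (C : seq {set 'I_n}) : bool :=
  [&& size C == (part_index k j).+1,
      #|nth finset.set0 C 0| == a,
      all (fun B : {set 'I_n} => #|B| == (k - j)%N) (behead C),
      pairwise (fun B1 B2 : {set 'I_n} => [disjoint B1 & B2]) C &
      \bigcup_(B <- C) B == J].

(* A permutation s encodes the linear order in which the m-sets are listed as
   below. *)
Definition listing (n m : nat) (s : {perm subsets n m}) : seq {set 'I_n} :=
  [seq val (s A) | A <- enum (subsets n m : finType)].

Definition first_in (n m : nat) (s : {perm subsets n m})
    (P : pred {set 'I_n}) : option {set 'I_n} :=
  ohead [seq A <- listing s | P A].

(* The lists [stack], [path_edges] and [batches] have their most recent item at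
   the head: these are the last j-set of the stack, e_l and B_l respectively.
   [path_start] is the j-set of the latest new start, and [queries] the list of
   the triples (J, K, answer) of all queries of K from J made so far. *)
Record state (n : nat) := State {
  stack : seq ({set 'I_n} * seq {set 'I_n});
  explored : {set {set 'I_n}};
  new_starts : {set {set 'I_n}};
  path_start : {set 'I_n};
  path_edges : seq {set 'I_n};
  batches : seq {set {set 'I_n}};
  queries : seq ({set 'I_n} * {set 'I_n} * bool)
}.

Section State.
Context {n : nat}.
Implicit Types s : state n.

Definition init : state n :=
  State [::] finset.set0 finset.set0 finset.set0 [::] [::] [::].

Definition time s : nat := size (queries s).

Definition path_length s : nat := size (path_edges s).

Definition path_vertices s : {set 'I_n} :=
  path_start s :|: \bigcup_(e <- path_edges s) e.

Definition active s : {set {set 'I_n}} := [set J in unzip1 (stack s)].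

Definition discovered s : {set {set 'I_n}} := active s :|: explored s.

Definition degree s (I : {set 'I_n}) : nat :=
  #|[set J in discovered s | I \subset J]|.

Definition can_query s (J K : {set 'I_n}) : bool :=
  [&& J \subset K,
      (J, K) \notin unzip1 (queries s),
      [disjoint K :\: J & path_vertices s] &
      [forall J' in explored s, ~~ (J' \subset K)]].

End State.

(* The rule for the arbitrary choice of an extendable partition at a new start.
   It may use everything known to the algorithm at that moment (the two orders
   and the state, including all past queries and answers), but not the part of
   the hypergraph that has not been revealed. *)
Definition choice_rule (n k j : nat) :=
  {perm subsets n j} -> {perm subsets n k} -> state n ->
  {set 'I_n} -> seq {set 'I_n}.

(* The pairs (J_Z, (Z, C_2, ..., C_{r+1})), listed in the order sj, where C is
   the list C_0, ..., C_{r+1}. *)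
Definition new_batch (n j a : nat) (sj : {perm subsets n j})
    (C : seq {set 'I_n}) : seq ({set 'I_n} * seq {set 'I_n}) :=
  let C1 := nth finset.set0 C 1 in
  let tl := drop 2 C in
  sort (fun x y => (index x.1 (listing sj) <= index y.1 (listing sj))%N)
    [seq (Z :|: \bigcup_(B <- tl) B, Z :: tl)
       | Z <- enum [set Z : {set 'I_n} | (Z \subset C1) && (#|Z| == a)]].

(* The state is left unchanged once all j-sets are explored. *)
Definition step (n k j a : nat) (ch : choice_rule n k j) (H : hypergraph n k)
    (sj : {perm subsets n j}) (sk : {perm subsets n k}) (s : state n) :
    state n :=
  match stack s with
  | [::] =>
      if first_in sj (fun J => J \notin discovered s) is Some J then
        State [:: (J, ch sj sk s J)] (explored s) (J |: new_starts s)
              J [::] [:: [set J]] (queries s)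
      else s
  | (J, C) :: st =>
      if first_in sk (can_query s J) is Some K then
        if K \in edges H then
          let B := new_batch a sj (rcons C (K :\: J)) in
          State (rev B ++ stack s) (explored s) (new_starts s)
                (path_start s) (K :: path_edges s)
                ([set x in unzip1 B] :: batches s)
                (rcons (queries s) (J, K, true))
        else
          State (stack s) (explored s) (new_starts s)
                (path_start s) (path_edges s) (batches s)
                (rcons (queries s) (J, K, false))
      else
        let E := J |: explored s in
        if (head finset.set0 (batches s) \subset E)
           && (0 < path_length s)%N then
          State st E (new_starts s) (path_start s)
                (behead (path_edges s)) (behead (batches s)) (queries s)
        else
          State st E (new_starts s) (path_start s)
                (path_edges s) (batches s) (queries s)
  end.

Section Stopping.
Context {R : realType} {n : nat}.
Variables (k j : nat) (C : nat -> R) (beta eps delta : R).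
Implicit Types s : state n.

Definition target_length : R :=
  (1 - delta) * (eps * n%:R / (k - j)%:R ^+ 2).

Definition path_condition s : Prop := target_length <= (path_length s)%:R.

(* t = T_0 with T_0 = n^(k-j+1) / eps rounded up. *)
Definition time_condition s : Prop :=
  (time s)%:Z = Num.ceil (n%:R ^+ (k - j + 1) / eps).

Definition starts_condition s : Prop :=
  2 * ((k - j)`!)%:R
      * Num.sqrt ((time s)%:R * (n%:R `^ beta) / n%:R ^+ (k - j))
    + n%:R `^ beta / 2 <= #|new_starts s|%:R.

Definition degree_condition s : Prop :=
  exists2 I : {set 'I_n}, (#|I| <= j - 1)%N &
    C #|I| * (time s)%:R / n%:R ^+ (k - j + #|I|) + n%:R `^ beta
      <= (degree s I)%:R.

Definition stopping_condition s : Prop :=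
  [\/ path_condition s, time_condition s, starts_condition s
    | degree_condition s].

End Stopping.

(* The outcome (H, sj, sk): the input hypergraph and the two orders. *)
Definition outcome (n k j : nat) : Type :=
  (hypergraph n k * {perm subsets n j} * {perm subsets n k})%type.

(* H^k(n, p); for the finitely many n with p > 1 this is only a signed
   measure. *)
Definition binomial_hypergraph (R : realType) (n k : nat) (p : R)
    (H : hypergraph n k) : R :=
  \prod_(K : subsets n k) (if K \in H then p else 1 - p).

Definition Pr (R : realType) (n k j : nat) (p : R)
    (E : outcome n k j -> Prop) : R :=
  \sum_(w : outcome n k j | `[< E w >])
    binomial_hypergraph p w.1.1
      / (#|{: {perm subsets n j}}| * #|{: {perm subsets n k}}|)%:R.

Definition whp (R : realType) (k j : nat) (p : nat -> R)
    (E : forall n, outcome n k j -> Prop) : Prop :=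
  ((fun n => Pr (p n) (@E n)) @ \oo --> (1 : R))%classic.

Definition run (n k j a : nat) (ch : choice_rule n k j) (w : outcome n k j)
    (m : nat) : state n :=
  iter m (step a ch w.1.1 w.1.2 w.2) init.

(* s is the state immediately after the t-th query (the initial state if
   t = 0). No such s exists if all j-sets get explored with fewer queries. *)
Definition snapshot (n k j a : nat) (ch : choice_rule n k j)
    (w : outcome n k j) (t : nat) (s : state n) : Prop :=
  exists m : nat, [/\ s = run a ch w m, time s = t &
    forall m', (m' < m)%N -> (time (run a ch w m') < t)%N].

(* t = T_stop, with s the snapshot at that time. *)
Definition stops_at (R : realType) (n k j a : nat) (ch : choice_rule n k j)
    (C : nat -> R) (beta eps delta : R)
    (w : outcome n k j) (t : nat) (s : state n) : Prop :=
  [/\ snapshot a ch w t s,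
      stopping_condition k j C beta eps delta s &
      forall t' s', (t' < t)%N -> snapshot a ch w t' s' ->
        ~ stopping_condition k j C beta eps delta s'].

Definition p0 (R : realType) (k j a n : nat) : R :=
  ('C(k - j, a) * 'C(n - j, k - j))%:R^-1.

(* f << g with implied constant M. *)
Definition much_less (R : realType) (M f g : R) : Prop := f <= g / M.

(* Main.v *)
(** No k-set is queried twice, so the answers behave like fresh Bernoulli(p)
    trials, and exponential moments of the answer log give, outside an event of
    probability o(1), Chernoff bounds for the number of positive answers, both
    overall and among the queries of the types that can raise the degree of a
    given i-set; a union bound over the random order controls the degrees inside
    initial segments of it.  On this good event everything is deterministic.
    While no stopping condition holds, few k-sets are blocked by explored j-sets
    and by the short path, so every explored j-set has been queried at least
    (1 + delta * eps / 2) / (c * p) times, where c = 'C(k - j, a).  Hence, after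
    t queries, fewer than t / ((1 + delta * eps / 2) / (c * p)) j-sets are
    explored, whereas about c * p * t are discovered.  With no active j-set left,
    this contradiction bounds the number of new starts; at time T_0 it leaves
    more active j-sets than a short path can carry.  The degrees are bounded by
    induction on the size of the i-set. *)
Require Import Defs.
From HB Require Import structures.
From mathcomp Require Import all_boot all_order all_fingroup all_algebra.
From mathcomp Require Import all_classical all_reals all_analysis.
From mathcomp Require Import zify ring lra.
From mathcomp Require Import seq fintype bigop finset.

Set Implicit Arguments.
Unset Strict Implicit.
Unset Printing Implicit Defensive.

Import Order.TTheory GRing.Theory Num.Theory.
Import numFieldNormedType.Exports.

(** The estimates depend on each other in a circle: explored j-sets have many queries only while
    degrees are small, degrees are small only if new starts are few, and new starts are few because
    explored j-sets have many queries. Time breaks the circle: a j-set that becomes explored between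
    two queries was discovered by the last snapshot, where no stopping condition held. A path below
    the target blocks a fraction of about (1 - delta) eps of the k-sets containing a j-set, and (1 +
    eps) (1 - (1 - delta) eps) is about 1 + delta eps. Half of the gain delta eps pays for errors of
    order eps^2, which eps << delta allows. The condition eps^3 n -> oo enters twice: explored
    j-sets block a fraction of order 1 / (eps n) + n^(beta - 1), which must stay below eps^2, and at
    time T_0 the fluctuation sqrt(n / eps) of the number of edges must stay below a margin of order
    delta n. *)

Local Open Scope nat_scope.

(** * Counting the k-sets above a given set *)

Section Supersets.
Variable n : nat.
Implicit Types (U I J K : {set 'I_n}) (D : {set {set 'I_n}}).

Definition supersets (k : nat) U : {set {set 'I_n}} :=
  [set K : {set 'I_n} | (U \subset K) && (#|K| == k)].

Lemma card_supersets k U : #|U| <= k ->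
  #|supersets k U| = 'C(n - #|U|, k - #|U|).
Proof.
move=> leUk; have -> : n - #|U| = #|~: U| by rewrite [in RHS]cardsCs setCK card_ord.
rewrite -cards_draws -[LHS](card_in_imset (f := fun K => K :\: U)); last first.
  move=> K L; rewrite !inE => /andP[UK _] /andP[UL _] eqKL.
  by rewrite -[LHS](setID _ U) -[RHS](setID _ U) (setIidPr UK) (setIidPr UL) eqKL.
apply: eq_card => Z; rewrite inE; apply/imsetP/andP.
  case=> K; rewrite inE => /andP[UK /eqP cK] ->; split.
    by apply/subsetP => x; rewrite !inE => /andP[].
  by rewrite cardsD (setIidPr UK) cK.
case=> sZ /eqP cZ.
have dZU : Z :&: U = set0.
  by apply/eqP; rewrite setI_eq0 disjoints_subset.
exists (Z :|: U).
  by rewrite inE subsetUr cardsU dZU cards0 subn0 cZ subnK // eqxx.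
by rewrite setDUl setDv setU0; apply/esym/setDidPl; rewrite disjoints_subset.
Qed.

Lemma supersets_eq0 k U : k < #|U| -> supersets k U = set0.
Proof.
move=> ltkU; apply/setP => K; rewrite !inE; apply/negbTE/negP => /andP[UK /eqP cK].
by move: ltkU; rewrite ltnNge -cK subset_leq_card.
Qed.

Lemma bin_leq_exp m p : 'C(m, p) <= m ^ p.
Proof.
elim: p m => [|p IHp] [|m]; rewrite ?bin0 ?expn0 ?bin0n //.
rewrite -(leq_pmul2l (ltn0Sn p)) -mul_bin_diag expnS mulnCA.
rewrite leq_pmul2l //= (leq_trans (IHp m)) //.
apply: leq_trans (leq_pmull _ _) => //.
by case: p {IHp} => // p; rewrite leq_exp2r.
Qed.

Lemma card_supersets_leq k U :
  #|supersets k U| <= (#|U| <= k) * n ^ (k - #|U|).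
Proof.
case: (leqP #|U| k) => [leUk|/supersets_eq0 ->]; last by rewrite cards0.
rewrite mul1n card_supersets // (leq_trans (bin_leq_exp _ _)) //.
by case: (k - #|U|) => // m; rewrite leq_exp2r // leq_subr.
Qed.

(** Sort the [J] by [S = J :&: I]. Then [J :|: I] has j + |I| - |S| elements, hence at most
    n^(k-j-(|I|-|S|)) supersets of size k, and none once |I| - |S| > k - j; the Boolean factor
    covers that case, where truncated subtraction would leave n^0. Relaxing [J :&: I == S] to
    [S \subset J] leaves degrees in [D], the quantities that the stopping conditions control. *)
Lemma sum_card_supersets_leq j k D I : j <= k ->
  (forall J, J \in D -> #|J| = j /\ ~~ (I \subset J)) ->
  \sum_(J in D) #|supersets k (J :|: I)| <=
  \sum_(S : {set 'I_n} | S \proper I)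
     #|[set J in D | S \subset J]| *
     ((#|I| - #|S| <= k - j) * n ^ (k - j - (#|I| - #|S|))).
Proof.
move=> lejk hD.
rewrite (partition_big (fun J => J :&: I) (fun S => S \proper I)); last first.
  move=> J /hD[_ nIJ]; rewrite properE subsetIr /=.
  by apply: contra nIJ => /subset_trans; apply; apply: subsetIl.
apply: leq_sum => S prS.
set c := _ * (n ^ _).
have -> : #|[set J in D | S \subset J]| * c = \sum_(J in D | S \subset J) c.
  by rewrite sum_nat_const; congr (_ * _); apply: eq_card => J; rewrite !inE.
rewrite [X in _ <= X](bigID (fun J => J :&: I == S)) /=.
apply: leq_trans (leq_addr _ _).
rewrite [X in _ <= X](eq_bigl (fun J => (J \in D) && (J :&: I == S))); last first.
  move=> J; case: eqP => [<-|]; rewrite ?andbF // subsetIl !andbT //.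
apply: leq_sum => J /andP[JD /eqP eS].
have [cJ _] := hD J JD.
have leS : #|S| <= #|I| by apply/subset_leq_card/proper_sub.
have cU : #|J :|: I| = j + (#|I| - #|S|) by rewrite cardsU eS cJ addnBA.
apply: leq_trans (card_supersets_leq _ _) _; rewrite cU /c.
by rewrite -subnDA -leq_subRL.
Qed.

End Supersets.

(** Since a is congruent to j and 1 <= a <= k - j, the difference j - a is a multiple m (k - j) with
    m >= 0, and rounding j / (k - j) up gives m + 1. *)
Lemma part_indexE k j a : 0 < j < k -> 0 < a <= k - j -> a = k %[mod k - j] ->
  j = a + (k - j) * part_index k j.
Proof.
move=> /andP[j0 ltjk] /andP[a0 leaq] eqa.
have eqj : a = j %[mod k - j].
  by rewrite eqa -{1}(subnK (ltnW ltjk)) modnDl.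
have q0 : 0 < k - j by rewrite subn_gt0.
rewrite /part_index; move: (k - j) q0 leaq eqj => q q0 leaq eqj.
have leaj : a <= j.
  rewrite leqNgt; apply/negP => ltja.
  move: eqj; rewrite (modn_small (leq_trans ltja leaq)).
  case: (ltngtP a q) leaq => // [ltaq|->] _.
    by rewrite modn_small // => eqaj; rewrite eqaj ltnn in ltja.
  by rewrite modnn => eqaj; rewrite -eqaj in j0.
have /dvdnP[m em] : q %| j - a by rewrite -eqn_mod_dvd //; apply/eqP.
have -> : j = a + m * q by rewrite -em subnKC.
rewrite [a + _]addnC -addnA divnMDl //.
have -> : (a + q.-1) %/ q = 1.
  apply/eqP; rewrite eqn_leq -ltnS ltn_divLR // leq_divRL //.
  by apply/andP; split; clear -q0 leaq a0; lia.
by rewrite addn1 /= mulnC addnC.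
Qed.

(** * Extendable partitions and the batch of a new edge *)

Section Batch.
Variable n : nat.
Implicit Types (I J K N Z A B C : {set 'I_n}) (Cs : seq {set 'I_n}).

Lemma disjoint_setUl (T : finType) (A B C : {set T}) :
  [disjoint A :|: B & C] = [disjoint A & C] && [disjoint B & C].
Proof. by rewrite -!setI_eq0 setIUl setU_eq0. Qed.

Lemma disjoint_setUr (T : finType) (A B C : {set T}) :
  [disjoint A & B :|: C] = [disjoint A & B] && [disjoint A & C].
Proof. by rewrite -!setI_eq0 setIUr setU_eq0. Qed.

Definition seq_cover Cs : {set 'I_n} := \bigcup_(B <- Cs) B.

Definition seq_disjoint Cs : bool :=
  pairwise (fun B1 B2 : {set 'I_n} => [disjoint B1 & B2]) Cs.

Lemma mem_seq_cover x Cs : (x \in seq_cover Cs) = has (fun B : {set 'I_n} => x \in B) Cs.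
Proof.
rewrite /seq_cover; elim: Cs => [|B Cs IH]; first by rewrite big_nil inE.
by rewrite big_cons inE IH.
Qed.

Lemma seq_cover_cons B Cs : seq_cover (B :: Cs) = B :|: seq_cover Cs.
Proof. by rewrite /seq_cover big_cons. Qed.

Lemma seq_cover_rcons Cs B : seq_cover (rcons Cs B) = B :|: seq_cover Cs.
Proof. by apply/setP => x; rewrite !(inE, mem_seq_cover) has_rcons. Qed.

Lemma disjoint_seq_cover B Cs :
  [disjoint B & seq_cover Cs] = all (fun B' : {set 'I_n} => [disjoint B & B']) Cs.
Proof.
elim: Cs => [|B' Cs IH] /=; first by rewrite /seq_cover big_nil disjoints_subset setC0 subsetT.
by rewrite seq_cover_cons -IH disjoint_setUr.
Qed.

Lemma seq_disjoint_cons B Cs :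
  seq_disjoint (B :: Cs) = [disjoint B & seq_cover Cs] && seq_disjoint Cs.
Proof. by rewrite disjoint_seq_cover. Qed.

Lemma seq_disjoint_rcons Cs B :
  seq_disjoint (rcons Cs B) = [disjoint B & seq_cover Cs] && seq_disjoint Cs.
Proof.
rewrite /seq_disjoint pairwise_rcons disjoint_seq_cover; congr (_ && _).
by apply: eq_all => B'; rewrite disjoint_sym.
Qed.

Lemma card_seq_cover q Cs : seq_disjoint Cs ->
  all (fun B : {set 'I_n} => #|B| == q) Cs -> #|seq_cover Cs| = q * size Cs.
Proof.
elim: Cs => [|B Cs IH]; first by rewrite /seq_cover big_nil cards0 muln0.
rewrite seq_disjoint_cons seq_cover_cons => /andP[dB dC] /= /andP[/eqP cB cC].
by rewrite cardsU disjoint_setI0 // cards0 subn0 IH // cB mulnS.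
Qed.

Variables (k j a : nat).
Hypothesis jE : j = a + (k - j) * part_index k j.
Hypothesis a0 : 0 < a.
Hypothesis ltjk : j < k.

Local Notation q := (k - j).
Local Notation r := (part_index k j).

Variant ext_spec J Cs : Prop := ExtSpec C0 tl of
  Cs = C0 :: tl & #|C0| = a & size tl = r & all (fun B : {set 'I_n} => #|B| == q) tl
  & [disjoint C0 & seq_cover tl] & seq_disjoint tl & J = C0 :|: seq_cover tl.

Lemma extP J Cs : extendable_partition k j a J Cs -> ext_spec J Cs.
Proof.
case: Cs => [|C0 tl] //; rewrite /extendable_partition /=.
case/and5P => /eqP[sz] /eqP cC0 call; rewrite -disjoint_seq_cover => /andP[d1 d2].
by rewrite -/(seq_cover _) seq_cover_cons => /eqP<-; exists C0 tl.
Qed.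

Lemma ext_card J Cs : extendable_partition k j a J Cs -> #|J| = j.
Proof.
case/extP => C0 tl _ cC0 sz call d1 d2 ->.
by rewrite cardsU disjoint_setI0 // cards0 subn0 (@card_seq_cover q) // cC0 sz -jE.
Qed.

Lemma ext_intro Z tl : #|Z| = a -> size tl = r ->
  all (fun B : {set 'I_n} => #|B| == q) tl -> [disjoint Z & seq_cover tl] ->
  seq_disjoint tl -> extendable_partition k j a (Z :|: seq_cover tl) (Z :: tl).
Proof.
move=> cZ sz call d1 d2; rewrite /extendable_partition /= sz cZ call !eqxx /=.
by rewrite -/(seq_disjoint tl) -disjoint_seq_cover d1 d2 -/(seq_cover _) seq_cover_cons eqxx.
Qed.

(** [C1 :: tl2] is C_1, ..., C_{r+1}. Appending [K :\: J] to [tl] before splitting off the head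
    treats r = 0, where C_1 is [K :\: J] itself, together with r > 0. *)
Variant batch_spec J Cs K (sj : {perm subsets n j}) : Prop := BatchSpec C0 tl C1 tl2 of
  Cs = C0 :: tl & rcons tl (K :\: J) = C1 :: tl2 & #|C0| = a
  & size tl = r & size tl2 = r
  & all (fun B : {set 'I_n} => #|B| == q) tl & #|C1| = q
  & all (fun B : {set 'I_n} => #|B| == q) tl2
  & [disjoint C0 & seq_cover (C1 :: tl2)]
  & [disjoint C1 & seq_cover tl2] & seq_disjoint tl2
  & J = C0 :|: seq_cover tl
  & (forall x, x \in new_batch a sj (rcons Cs (K :\: J)) <->
       exists2 Z : {set 'I_n}, (Z \subset C1) && (#|Z| == a) & x = (Z :|: seq_cover tl2, Z :: tl2))
  & size (new_batch a sj (rcons Cs (K :\: J))) = 'C(q, a)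
  & uniq (unzip1 (new_batch a sj (rcons Cs (K :\: J)))).

Lemma batchP J Cs K sj : extendable_partition k j a J Cs -> J \subset K ->
  #|K| = k -> batch_spec J Cs K sj.
Proof.
move=> eJC sJK cK; have cJ := ext_card eJC.
have [C0 tl eC cC0 sz call d1 d2 eJ] := extP eJC.
have cN : #|K :\: J| = q by rewrite cardsD (setIidPr sJK) cK cJ.
have dN : [disjoint K :\: J & J] by rewrite disjoints_subset setDE subsetIr.
case eD: (rcons tl (K :\: J)) => [|C1 tl2]; first by case: (tl) eD.
have dC0 : [disjoint C0 & seq_cover (rcons tl (K :\: J))].
  rewrite seq_cover_rcons disjoint_setUr d1 andbT disjoint_sym.
  by apply: disjointWr dN; rewrite eJ subsetUl.
have : seq_disjoint (rcons tl (K :\: J)).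
  by rewrite seq_disjoint_rcons d2 andbT; apply: disjointWr dN; rewrite eJ subsetUr.
have : all (fun B : {set 'I_n} => #|B| == q) (rcons tl (K :\: J)).
  by rewrite all_rcons call cN eqxx.
rewrite eD in dC0 *; rewrite seq_disjoint_cons => /= /andP[/eqP cC1 ctl2] /andP[d3 d4].
have dZ Z : Z \subset C1 -> Z :&: seq_cover tl2 = set0.
  by move=> sZ; apply: disjoint_setI0; apply: disjointWl d3.
have eB : new_batch a sj (rcons Cs (K :\: J)) =
    sort (fun x y => (index x.1 (listing sj) <= index y.1 (listing sj))%N)
    [seq (Z :|: seq_cover tl2, Z :: tl2)
       | Z <- enum [set Z : {set 'I_n} | (Z \subset C1) && (#|Z| == a)]].
  by rewrite /new_batch eC rcons_cons eD /= drop0.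
apply: (BatchSpec eC eD) => //.
- by move: (congr1 size eD); rewrite size_rcons sz => -[].
- move=> x; rewrite eB mem_sort; split.
    by case/mapP => Z; rewrite mem_enum inE => hZ ->; exists Z.
  by case=> Z hZ ->; apply/mapP; exists Z; rewrite // mem_enum inE.
- by rewrite eB size_sort size_map -cardE cards_draws cC1.
- rewrite eB; set s := map _ _.
  rewrite (perm_uniq (perm_map _ (permEl (perm_sort _ s)))) /s /unzip1 -map_comp.
  rewrite map_inj_in_uniq ?enum_uniq // => Z1 Z2; rewrite !mem_enum !inE /=.
  move=> /andP[s1 _] /andP[s2 _] eqU.
  (* [Z] is the trace of its j-set on C_1, so distinct [Z] give distinct j-sets. *)
  have := congr1 (fun X => X :&: C1) eqU; rewrite !setIUl (setIidPl s1) (setIidPl s2).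
  by rewrite [_ :&: C1]setIC (disjoint_setI0 d3) !setU0.
Qed.

Lemma batch_ext J Cs K (sj : {perm subsets n j}) x : extendable_partition k j a J Cs -> J \subset K ->
  #|K| = k -> x \in new_batch a sj (rcons Cs (K :\: J)) ->
  extendable_partition k j a x.1 x.2.
Proof.
move=> eJC sJK cK.
case: (batchP sj eJC sJK cK) => C0 tl C1 tl2 _ _ _ _ sz2 _ _ ctl2 _ d3 d4 _ memB _ _.
case/memB => Z /andP[sZ /eqP cZ] ->; apply: ext_intro => //.
exact: disjointWl d3.
Qed.

(** Meeting [K :\: J] is what makes the j-sets of a batch new. For r > 0 they contain C_{r+1} =
    [K :\: J], nonempty since j < k; for r = 0 they are the subsets [Z] of C_1 = [K :\: J], nonempty
    since a > 0. *)
Lemma batch_sub J Cs K (sj : {perm subsets n j}) x : extendable_partition k j a J Cs -> J \subset K ->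
  #|K| = k -> x \in new_batch a sj (rcons Cs (K :\: J)) ->
  (x.1 \subset K) && ~~ [disjoint x.1 & K :\: J].
Proof.
move=> eJC sJK cK; have cJ := ext_card eJC.
have cN : #|K :\: J| = q by rewrite cardsD (setIidPr sJK) cK cJ.
case: (batchP sj eJC sJK cK) => C0 tl C1 tl2 eC eD _ _ sz2 _ _ ctl2 _ d3 d4 eJ memB _ _.
case/memB => Z /andP[sZ /eqP cZ] -> /=.
have sD : seq_cover (C1 :: tl2) \subset K.
  rewrite -eD seq_cover_rcons subUset subsetDl (subset_trans _ sJK) //.
  by rewrite eJ subsetUr.
move: (sD); rewrite seq_cover_cons subUset => /andP[sC1 stl2].
rewrite subUset stl2 (subset_trans sZ) //=.
case/lastP: tl2 eD {memB sz2 ctl2 d3 d4 sD stl2} => [|tl2 B].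
  rewrite -[[:: C1]]/(rcons [::] C1) => /rcons_inj[_ ->].
  rewrite disjoint_setUl; apply/negP => /andP[/disjoint_setI0 + _].
  by rewrite (setIidPl sZ) => Z0; move: a0; rewrite -cZ Z0 cards0.
rewrite -rcons_cons => /rcons_inj[_ <-].
rewrite seq_cover_rcons !disjoint_setUl; apply/negP.
case/and3P => _ /disjoint_setI0 + _; rewrite setIid => N0.
by move: cN ltjk; rewrite N0 cards0 => /esym/eqP; rewrite subn_eq0 leqNgt => /negbTE->.
Qed.

(** The step from J to J_Z drops C_0 and cuts C_1 down to Z. As [I] lies in J_Z, it avoids C_0 and
    C_1 \ Z, so what lay in C_0, ..., C_g lies in the [g] blocks Z, C_2, ..., C_g. *)
Lemma batch_level J Cs K (sj : {perm subsets n j}) x I g : extendable_partition k j a J Cs -> J \subset K ->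
  #|K| = k -> x \in new_batch a sj (rcons Cs (K :\: J)) -> I \subset x.1 ->
  I \subset seq_cover (take g.+1 Cs) -> I \subset seq_cover (take g x.2).
Proof.
move=> eJC sJK cK.
case: (batchP sj eJC sJK cK) => C0 tl C1 tl2 eC eD _ _ sz2 _ _ ctl2 d0 d3 d4 eJ memB _ _.
case/memB => Z /andP[sZ /eqP cZ] -> /= /subsetP sI /subsetP sI2.
apply/subsetP => y yI; move: (sI y yI) (sI2 y yI).
rewrite {}eC /= seq_cover_cons !inE => yx.
have yD : y \in seq_cover (C1 :: tl2).
  rewrite seq_cover_cons inE; case/orP: yx => [/(subsetP sZ) -> //|->].
  by rewrite orbT.
case yC0: (y \in C0) => /=; first by rewrite (disjointFr d0 yC0) in yD.
move=> ytl; have {}ytl : y \in seq_cover (take g (C1 :: tl2)).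
  move: ytl; rewrite -eD -cats1 !mem_seq_cover take_cat; case: ltnP => // hg.
  by rewrite take_oversize // has_cat => ->.
case: g ytl {sI2} => [|g]; first by rewrite /seq_cover big_nil inE.
rewrite /= !seq_cover_cons !inE; case/orP: yx => [->//|ytl2].
by rewrite (disjointFl d3 ytl2) /= => ->; rewrite orbT.
Qed.

Lemma batch_disjoint_level J Cs I : extendable_partition k j a J Cs ->
  I \subset J -> I \subset seq_cover (take r.+1 Cs).
Proof.
move=> /extP[C0 tl -> _ sz _ _ _ eJ]; rewrite take_oversize /= ?sz //.
by rewrite seq_cover_cons -eJ.
Qed.

End Batch.

(** * The random orders as lists *)

Section Listing.
Variables (n m : nat) (s : {perm subsets n m}).

Lemma mem_listing (J : {set 'I_n}) : (J \in listing s) = (#|J| == m).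
Proof.
apply/mapP/idP => [[A _ ->]|cJ]; first exact: (valP (s A)).
by exists ((s^-1)%g (Sub J cJ)); rewrite ?mem_enum // permKV SubK.
Qed.

Lemma listing_uniq : uniq (listing s).
Proof. by rewrite map_inj_uniq ?enum_uniq // => A B /val_inj/perm_inj. Qed.

Lemma first_inP (P : pred {set 'I_n}) (J : {set 'I_n}) : first_in s P = Some J ->
  [/\ P J, #|J| = m &
      {in take (index J (listing s)) (listing s), forall J', ~~ P J'}].
Proof.
rewrite /first_in => h.
suff [h1 h2 h3] : [/\ P J, J \in listing s &
   {in take (index J (listing s)) (listing s), forall J', ~~ P J'}].
  by split=> //; apply/eqP; rewrite -mem_listing.
elim: (listing s) h => [|A l IH] //=; case PA: (P A) => /=.
  by move=> [<-]; split=> //; rewrite ?inE eqxx // => J'; rewrite take0.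
move=> /IH[PJ Jl hl]; split=> //; first by rewrite inE Jl orbT.
case: eqP => [eAJ|_]; first by rewrite eAJ PJ in PA.
by move=> J'; rewrite inE => /predU1P[->|/hl//]; rewrite PA.
Qed.

Lemma first_in_None (P : pred {set 'I_n}) (J : {set 'I_n}) :
  first_in s P = None -> #|J| = m -> ~~ P J.
Proof.
rewrite /first_in => h cJ; have : J \in listing s by rewrite mem_listing cJ.
elim: (listing s) h => [|A l IH] //=; case PA: (P A) => //= h.
by rewrite inE => /predU1P[->|/(IH h)//]; rewrite PA.
Qed.

End Listing.

(** * The algorithm with its history, and its invariants *)

Notation entry n := ({set 'I_n} * seq {set 'I_n})%type.
Notation answer n := (entry n * {set 'I_n} * bool)%type.

(* [ghist] remembers every j-set discovered so far with its extendable
   partition, and [glog] every query with the partition of the queried j-set. *)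
Record gstate (n : nat) := GState {
  gst : state n;
  ghist : seq (entry n);
  glog : seq (answer n)
}.

Section Ghost.
Variables (n k j a : nat) (ch : choice_rule n k j).
Variables (sj : {perm subsets n j}) (sk : {perm subsets n k}).
Implicit Types (s : state n) (g : gstate n) (I J K : {set 'I_n}) (b : bool).
Implicit Types (e : entry n) (x : answer n).

(** [None] stands for a new start, an exploration or the idle final state: these are the steps that
    leave the log unchanged. *)
Definition next_query s : option {set 'I_n} :=
  if stack s is (J, Cs) :: _ then first_in sk (can_query s J) else None.

(** The answer is an argument [b], so that both outcomes of a query can be compared in the
    martingale argument; only [reply] looks at the hypergraph. *)
Definition gupd b g : gstate n :=
  let s := gst g in
  match stack s with
  | [::] =>
      if first_in sj (fun J => J \notin discovered s) is Some J then
        GState (State [:: (J, ch sj sk s J)] (explored s) (J |: new_starts s)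
                 J [::] [:: [set J]] (queries s))
               ((J, ch sj sk s J) :: ghist g) (glog g)
      else g
  | (J, Cs) :: st =>
      if first_in sk (can_query s J) is Some K then
        if b then
          let B := new_batch a sj (rcons Cs (K :\: J)) in
          GState (State (rev B ++ stack s) (explored s) (new_starts s)
                (path_start s) (K :: path_edges s)
                ([set J' in unzip1 B] :: batches s)
                (rcons (queries s) (J, K, true)))
             (B ++ ghist g) (rcons (glog g) ((J, Cs), K, true))
        else
          GState (State (stack s) (explored s) (new_starts s)
                (path_start s) (path_edges s) (batches s)
                (rcons (queries s) (J, K, false)))
             (ghist g) (rcons (glog g) ((J, Cs), K, false))
      else
        let E := J |: explored s in
        GState (if (head set0 (batches s) \subset E)
           && (0 < path_length s)%N then
          State st E (new_starts s) (path_start s)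
                (behead (path_edges s)) (behead (batches s)) (queries s)
        else
          State st E (new_starts s) (path_start s)
                (path_edges s) (batches s) (queries s)) (ghist g) (glog g)
  end.

Definition reply (H : hypergraph n k) g : bool :=
  if next_query (gst g) is Some K then K \in edges H else false.

Definition gstep (H : hypergraph n k) g : gstate n := gupd (reply H g) g.

Definition ginit : gstate n := GState init [::] [::].

Lemma gst_gstep (H : hypergraph n k) g :
  gst (gstep H g) = step a ch H sj sk (gst g).
Proof.
rewrite /gstep /gupd /reply /step /next_query.
case: (stack (gst g)) => [|[J Cs] st]; first by case: first_in.
by case: first_in => [K|] //; case: ifP.
Qed.

Lemma gst_iter (H : hypergraph n k) m :
  gst (iter m (gstep H) ginit) = iter m (step a ch H sj sk) init.
Proof. by elim: m => //= m <-; rewrite gst_gstep. Qed.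

(* Above the j-set [J] from which a path edge [K] was found, the stack holds the
   not yet explored part of the batch of [K]. *)
Inductive layers (E : {set {set 'I_n}}) (P0 : {set 'I_n}) :
    seq (entry n) -> seq {set 'I_n} -> seq {set {set 'I_n}} -> Prop :=
| Layers0 st bs : (forall e, e \in st -> e.1 = P0) -> size st <= 1 ->
    layers E P0 st [::] bs
| LayersS J Cs st es bs K pre seg of layers E P0 ((J, Cs) :: st) es bs
    & J \subset K & #|K| = k & [disjoint K :\: J & P0 :|: seq_cover es]
    & rev (new_batch a sj (rcons Cs (K :\: J))) = pre ++ seg & seg <> [::]
    & (forall e, e \in pre -> e.1 \in E) :
    layers E P0 (seg ++ (J, Cs) :: st) (K :: es)
      ([set J' in unzip1 (new_batch a sj (rcons Cs (K :\: J)))] :: bs).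

Lemma layers_mono (E E' : {set {set 'I_n}}) P0 st es bs : E \subset E' ->
  layers E P0 st es bs -> layers E' P0 st es bs.
Proof.
move=> /subsetP sE; elim=> [|J Cs st' es' bs' K pre seg _ IH sJK cK d eB nseg hpre].
  by constructor.
by apply: (LayersS IH sJK cK d eB) => // e /hpre /sE.
Qed.

(* If a set [J_Z] of the batch arising from [J] and [K] contains [I] and is deeper
   than its first [l] blocks, then either [K] is a jump to [I], or [J] contains
   [I] deeper than its first [l + 1] blocks, because [(Z, C_2, ..., C_{r+1})]
   replaces two blocks of [J] by one.  At most [r + 1] iterations thus bound the
   degree of [I]. *)
Definition jump I x : bool := (I \subset x.1.2) && ~~ (I \subset x.1.1.1).

Definition deeper I l e : bool :=
  (I \subset e.1) && ~~ (I \subset seq_cover (take l e.2)).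

Definition pivot I l x : bool := deeper I l x.1.1.

(** [inv_ulog] says that no k-set is queried twice. [inv_starts] records how the order [sj]
    constrains new starts: only discovered j-sets precede a new start, so its position is below
    their number. [inv_level] is one round of the degree recursion. *)
Record invariant g : Prop := Invariant {
  inv_ext : forall e, e \in ghist g -> extendable_partition k j a e.1 e.2;
  inv_uniq : uniq (unzip1 (ghist g));
  inv_disc : discovered (gst g) = [set J in unzip1 (ghist g)];
  inv_stack : {subset stack (gst g) <= ghist g};
  inv_ustack : uniq (unzip1 (stack (gst g)));
  inv_disj : [disjoint active (gst g) & explored (gst g)];
  inv_queries : queries (gst g) = [seq (x.1.1.1, x.1.2, x.2) | x <- glog g];
  inv_log : forall x, x \in glog g ->
    [/\ x.1.1 \in ghist g, x.1.1.1 \subset x.1.2 & #|x.1.2| = k];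
  inv_ulog : uniq [seq x.1.2 | x <- glog g];
  inv_layers : layers (explored (gst g)) (path_start (gst g)) (stack (gst g))
    (path_edges (gst g)) (batches (gst g));
  inv_edges : forall K, K \in path_edges (gst g) ->
    exists2 x, x \in glog g & x.1.2 = K /\ x.2;
  inv_size : size (ghist g) =
    #|new_starts (gst g)| + 'C(k - j, a) * count (fun x => x.2) (glog g);
  inv_starts : forall J, J \in new_starts (gst g) ->
    J \in unzip1 (ghist g) /\ index J (listing sj) < size (ghist g);
  inv_level : forall I l,
    count (deeper I l) (ghist g) <= #|[set J in new_starts (gst g) | I \subset J]|
      + 'C(k - j, a) * (count (fun x => x.2 && jump I x) (glog g)
                        + count (fun x => x.2 && pivot I l.+1 x) (glog g))
}.

Hypothesis jE : j = a + (k - j) * part_index k j.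
Hypothesis a0 : 0 < a.
Hypothesis leaq : a <= k - j.
Hypothesis ltjk : j < k.
Hypothesis chP : forall s J, #|J| = j -> extendable_partition k j a J (ch sj sk s J).

Let batchP' := @batchP n k j a jE.

Lemma invariant_init : invariant ginit.
Proof.
split=> //=.
- by rewrite /discovered /active; apply/setP => J; rewrite !inE.
- by rewrite -setI_eq0 setI0.
- by constructor.
- by rewrite cards0 muln0.
- by move=> J; rewrite inE.
Qed.

Lemma layers_vertices E P0 st es bs :
  (forall e, e \in st -> extendable_partition k j a e.1 e.2) ->
  layers E P0 st es bs ->
  forall e, e \in st -> e.1 \subset P0 :|: seq_cover es.
Proof.
move=> hst hl; elim: hl hst => {st es bs} [st bs h0 _ _ e /h0 -> |].
  by rewrite /seq_cover big_nil setU0.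
move=> J Cs st es bs K pre seg _ IH sJK cK d eB _ _ hst e.
rewrite mem_cat seq_cover_cons => /orP[eseg|est].
  have eB' : e \in new_batch a sj (rcons Cs (K :\: J)).
    by rewrite -mem_rev eB mem_cat eseg orbT.
  have exJ := hst (J, Cs); rewrite mem_cat inE eqxx orbT in exJ.
  have /andP[sK _] := batch_sub jE a0 ltjk (exJ isT) sJK cK eB'.
  by rewrite setUCA (subset_trans sK) ?subsetUl.
rewrite setUCA; apply: subset_trans (subsetUr _ _); apply: IH => // e' e'st.
by apply: hst; rewrite mem_cat e'st orbT.
Qed.

Lemma layers_size E P0 st es bs :
  (forall e, e \in st -> extendable_partition k j a e.1 e.2) ->
  layers E P0 st es bs -> size st <= 'C(k - j, a) * size es + 1.
Proof.
move=> hst hl; elim: hl hst => {st es bs} [st bs _ h1 _ |]; first by rewrite muln0.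
move=> J Cs st es bs K pre seg _ IH sJK cK d eB _ _ hst.
have exJ : extendable_partition k j a J Cs.
  by apply: (hst (J, Cs)); rewrite mem_cat inE eqxx orbT.
case: (batchP' sj exJ sJK cK) => C0 tl C1 tl2 _ _ _ _ _ _ _ _ _ _ _ _ _ szB _.
have hseg : size seg <= 'C(k - j, a).
  by move: szB => /= <-; rewrite -[X in _ <= X]size_rev eB size_cat leq_addl.
rewrite size_cat [size (K :: es)]/= mulnS -addnA leq_add // IH // => e' e'st.
by apply: hst; rewrite mem_cat e'st orbT.
Qed.

Lemma path_verticesE s : path_vertices s = path_start s :|: seq_cover (path_edges s).
Proof. by []. Qed.

Lemma active_vertices g J : invariant g -> J \in active (gst g) ->
  J \subset path_vertices (gst g).
Proof.
move=> Ig; rewrite inE => /mapP[e est ->]; rewrite path_verticesE.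
apply: layers_vertices (inv_layers Ig) _ est => e' e'st.
exact/(inv_ext Ig)/(inv_stack Ig).
Qed.

Lemma stack_ext g J Cs st : invariant g -> stack (gst g) = (J, Cs) :: st ->
  extendable_partition k j a J Cs.
Proof.
move=> Ig eS; apply: (inv_ext Ig (e := (J, Cs))); apply: (inv_stack Ig).
by rewrite eS inE eqxx.
Qed.

Lemma mem_active s e : e \in stack s -> e.1 \in active s.
Proof. by move=> est; rewrite inE map_f. Qed.

(** Suppose [K] was queried before, from J'. If J' is explored, [K] contains an explored j-set and
    is barred. If J' is active, it lies in V(P), hence avoids [K :\: J]; so J' is contained in [J],
    equals it by cardinality, and the pair is barred as already queried. *)
Lemma query_fresh g J Cs st K : invariant g -> stack (gst g) = (J, Cs) :: st ->
  can_query (gst g) J K -> K \notin [seq x.1.2 | x <- glog g].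
Proof.
move=> Ig eS /and4P[sJK nq d /forall_inP hE]; apply/negP => /mapP[x xl eK].
have [xh sx cx] := inv_log Ig xl.
have cJ : #|J| = j by apply: (ext_card jE); apply: stack_ext eS.
have cJ' : #|x.1.1.1| = j := ext_card jE (inv_ext Ig xh).
have : x.1.1.1 \in discovered (gst g) by rewrite (inv_disc Ig) inE map_f.
rewrite inE => /orP[xa|xE]; last by move/negP: (hE _ xE); apply; rewrite eK.
have xV := active_vertices Ig xa.
have sJ : x.1.1.1 \subset J.
  apply/subsetP => y yx; apply/negPn/negP => yJ.
  have yK : y \in K :\: J by rewrite inE yJ eK (subsetP sx).
  by move: (disjointFr d yK); rewrite (subsetP xV).
have eJ : x.1.1.1 = J by apply/eqP; rewrite eqEcard sJ cJ cJ' leqnn.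
move/negP: nq; apply; rewrite (inv_queries Ig) /unzip1 -map_comp.
by apply/mapP; exists x => //=; rewrite eJ eK.
Qed.

(** The test of the algorithm detects exactly the end of a layer: if [J] was the last set of its
    segment, the whole batch is now explored and the edge goes; otherwise the next set of the
    segment is still on the stack, hence not explored, and the test fails. *)
Lemma layers_pop E P0 J Cs st es bs :
  layers E P0 ((J, Cs) :: st) es bs -> uniq (unzip1 ((J, Cs) :: st)) ->
  [disjoint [set J' in unzip1 st] & E] ->
  if (head set0 bs \subset J |: E) && (0 < size es) then
    layers (J |: E) P0 st (behead es) (behead bs)
  else layers (J |: E) P0 st es bs.
Proof.
move eS: ((J, Cs) :: st) => stk hl; case: hl eS => {stk es bs}
  [stk bs h0 sz eS _ _|J1 Cs1 st1 es bs K pre [|e seg] hl sJK cK d eB] //.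
  rewrite andbF; constructor; last by rewrite (leq_trans _ sz) // -eS /=.
  by move=> e est; apply: h0; rewrite -eS inE est orbT.
move=> _ hpre [eJ eseg]; rewrite cat_cons -eseg -eJ => /= /andP[hu _] hd; rewrite andbT.
have memB e' : (e' \in new_batch a sj (rcons Cs1 (K :\: J1))) = (e' \in pre ++ e :: seg).
  by rewrite -eB mem_rev.
have sE := subsetUr [set J] E.
have hpre' : forall e', e' \in rcons pre e -> e'.1 \in J |: E.
  move=> e'; rewrite mem_rcons inE => /predU1P[->|/hpre]; first by rewrite -eJ !inE eqxx.
  by rewrite !inE => ->; rewrite orbT.
case: seg eseg eB memB => [|e1 seg] /= eseg eB memB.
  rewrite (_ : _ \subset _) ?eseg; first exact: layers_mono hl.
  apply/subsetP => J'; rewrite inE => /mapP[e' +  ->]; rewrite memB cats1.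
  exact: hpre'.
rewrite ifF; last first.
  apply/negP => /subsetP/(_ e1.1); rewrite inE map_f; last first.
    by rewrite memB mem_cat !inE eqxx !orbT.
  move/(_ isT); have e1st : e1 \in st by rewrite eseg inE eqxx.
  rewrite !inE => /predU1P[e1J|e1E].
    by move/negP: hu; apply; rewrite -e1J map_f.
  by rewrite (disjointFr hd) // inE map_f in e1E.
rewrite eseg -cat_cons; apply: (LayersS (layers_mono sE hl) sJK cK d _ _ hpre') => //.
by rewrite eB cat_rcons.
Qed.

Lemma invariant_start g J : invariant g -> stack (gst g) = [::] ->
  first_in sj (fun J => J \notin discovered (gst g)) = Some J ->
  invariant (GState (State [:: (J, ch sj sk (gst g) J)] (explored (gst g))
      (J |: new_starts (gst g)) J [::] [:: [set J]] (queries (gst g)))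
    ((J, ch sj sk (gst g) J) :: ghist g) (glog g)).
Proof.
move=> Ig eS /first_inP[nJ cJ hJ].
have nJh : J \notin unzip1 (ghist g) by move: nJ; rewrite (inv_disc Ig) inE.
have nJs : J \notin new_starts (gst g).
  by apply: contra nJh => /(inv_starts Ig)[].
have dE : discovered (gst g) = explored (gst g).
  by rewrite /discovered; apply/setP => X; rewrite !inE eS.
split=> //=.
- by move=> e; rewrite inE => /predU1P[->|/(inv_ext Ig)//]; apply: chP.
- by rewrite nJh (inv_uniq Ig).
- apply/setP => X; rewrite /discovered /active !inE -dE (inv_disc Ig) inE.
  by [].
- by move=> e; rewrite !inE => ->.
- rewrite /active -setI_eq0; apply/eqP/setP => X; rewrite !inE /=.
  by apply/negP => /andP[/eqP-> JE]; move: nJ; rewrite dE JE.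
- exact: (inv_queries Ig).
- by move=> x /(inv_log Ig)[h1 h2 h3]; split=> //; rewrite inE h1 orbT.
- exact: (inv_ulog Ig).
- by constructor=> // e; rewrite inE => /eqP->.
- by rewrite cardsU1 nJs (inv_size Ig) add1n addSn.
- have szJ : index J (listing sj) <= size (ghist g).
    rewrite -[X in _ <= X](size_map fst).
    rewrite -[X in X <= _](size_takel (index_size J (listing sj))).
    apply: uniq_leq_size; first by rewrite take_uniq // listing_uniq.
    by move=> X /hJ; rewrite negbK (inv_disc Ig) inE.
  move=> X; rewrite !inE => /predU1P[->|/(inv_starts Ig)[h1 h2]].
    by rewrite eqxx.
  by rewrite h1 orbT ltnS ltnW.
- move=> I l; have := inv_level Ig I l.
  have -> : [set J' in J |: new_starts (gst g) | I \subset J'] =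
      (if I \subset J then [set J] else set0) :|: [set J' in new_starts (gst g) | I \subset J'].
    apply/setP => X; rewrite !inE; case: eqP => [->|/eqP nXJ] /=.
      by case: ifP; rewrite !inE ?eqxx // andbF.
    by case: ifP; rewrite ?inE // (negbTE nXJ).
  rewrite cardsU disjoint_setI0; last first.
    rewrite -setI_eq0; apply/eqP/setP => X; rewrite !inE; case: ifP; rewrite ?inE //.
    by case: eqP => // ->; rewrite (negbTE nJs).
  rewrite cards0 subn0 -addnA => h; apply: leq_add => //.
  by rewrite /deeper /=; case: (I \subset J); rewrite ?cards1 ?cards0 // leq_b1.
Qed.

Lemma invariant_miss g J Cs st K : invariant g -> stack (gst g) = (J, Cs) :: st ->
  first_in sk (can_query (gst g) J) = Some K ->
  invariant (GState (State (stack (gst g)) (explored (gst g)) (new_starts (gst g))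
      (path_start (gst g)) (path_edges (gst g)) (batches (gst g))
      (rcons (queries (gst g)) (J, K, false)))
    (ghist g) (rcons (glog g) ((J, Cs), K, false))).
Proof.
move=> Ig eS /first_inP[cq cK _]; have fr := query_fresh Ig eS cq.
have /and4P[sJK _ _ _] := cq.
split=> //=.
- exact: (inv_ext Ig).
- exact: (inv_uniq Ig).
- exact: (inv_disc Ig).
- exact: (inv_stack Ig).
- exact: (inv_ustack Ig).
- exact: (inv_disj Ig).
- by rewrite map_rcons (inv_queries Ig).
- move=> x; rewrite mem_rcons inE => /predU1P[->|/(inv_log Ig)//]; split=> //=.
  by apply: (inv_stack Ig); rewrite eS inE eqxx.
- by rewrite map_rcons rcons_uniq fr (inv_ulog Ig).
- exact: (inv_layers Ig).
- by move=> K' /(inv_edges Ig)[x xl ex]; exists x; rewrite // mem_rcons inE xl orbT.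
- by rewrite -cats1 count_cat /= !addn0 (inv_size Ig).
- exact: (inv_starts Ig).
- by move=> I l; rewrite -cats1 !count_cat /= !addn0; apply: (inv_level Ig).
Qed.

Lemma invariant_explore g J Cs st : invariant g -> stack (gst g) = (J, Cs) :: st ->
  invariant (GState (if (head set0 (batches (gst g)) \subset J |: explored (gst g))
           && (0 < path_length (gst g)) then
          State st (J |: explored (gst g)) (new_starts (gst g)) (path_start (gst g))
                (behead (path_edges (gst g))) (behead (batches (gst g))) (queries (gst g))
        else
          State st (J |: explored (gst g)) (new_starts (gst g)) (path_start (gst g))
                (path_edges (gst g)) (batches (gst g)) (queries (gst g)))
     (ghist g) (glog g)).
Proof.
move=> Ig eS; have hl := inv_layers Ig; have us := inv_ustack Ig.
rewrite eS in hl us; have dj := inv_disj Ig.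
have sst : [set J' in unzip1 st] \subset active (gst g).
  by apply/subsetP => X; rewrite !inE eS inE => ->; rewrite orbT.
have {hl} := layers_pop hl us (disjointWl sst dj).
have eact : active (gst g) = J |: [set J' in unzip1 st].
  by apply/setP => X; rewrite !inE eS inE.
have disc : [set J' in unzip1 st] :|: (J |: explored (gst g)) =
    [set J' in unzip1 (ghist g)].
  by rewrite -(inv_disc Ig) /discovered eact setUCA setUA.
have dj' : [disjoint [set J' in unzip1 st] & J |: explored (gst g)].
  rewrite disjoint_setUr (disjointWl sst dj) andbT disjoint_sym.
  by rewrite disjoints_subset sub1set !inE; case/andP: us.
have sub : {subset st <= ghist g}.
  by move=> e est; apply: (inv_stack Ig); rewrite eS inE est orbT.
have [_ us'] := andP us.
rewrite -/(path_length _); case: ifP => _ hl; split=> //=;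
  try exact: (inv_ext Ig); try exact: (inv_uniq Ig); try exact: (inv_queries Ig);
  try exact: (inv_log Ig); try exact: (inv_ulog Ig); try exact: (inv_size Ig);
  try exact: (inv_starts Ig); try exact: (inv_level Ig); try exact: (inv_edges Ig).
by move=> K /mem_behead /(inv_edges Ig).
Qed.

(** The batch consists of undiscovered j-sets: [K] contains no explored j-set, and active j-sets lie
    in V(P), whereas each new one meets [K :\: J], which is disjoint from V(P). *)
Lemma invariant_hit g J Cs st K (B := new_batch a sj (rcons Cs (K :\: J))) :
  invariant g -> stack (gst g) = (J, Cs) :: st ->
  first_in sk (can_query (gst g) J) = Some K ->
  invariant (GState (State (rev B ++ stack (gst g)) (explored (gst g)) (new_starts (gst g))
        (path_start (gst g)) (K :: path_edges (gst g))
        ([set J' in unzip1 B] :: batches (gst g))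
        (rcons (queries (gst g)) (J, K, true)))
     (B ++ ghist g) (rcons (glog g) ((J, Cs), K, true))).
Proof.
move=> Ig eS /first_inP[cq cK _]; have fr := query_fresh Ig eS cq.
have /and4P[sJK nq dK /forall_inP hE] := cq.
have eJC := stack_ext Ig eS.
have hB e : e \in B -> (e.1 \subset K) && ~~ [disjoint e.1 & K :\: J].
  exact: (batch_sub jE a0 ltjk eJC sJK cK).
have hBE e : e \in B -> e.1 \notin explored (gst g).
  by move=> /hB/andP[sK _]; apply/negP => /hE; rewrite sK.
have hBA e : e \in B -> e.1 \notin active (gst g).
  move=> /hB/andP[_ nd]; apply/negP => /(active_vertices Ig) sV; move/negP: nd; apply.
  by apply: disjointWl sV _; rewrite disjoint_sym.
have hBh e : e \in B -> e.1 \notin unzip1 (ghist g).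
  move=> eB; suff : e.1 \notin discovered (gst g) by rewrite (inv_disc Ig) inE.
  by rewrite inE negb_or hBE // hBA.
have hJh : (J, Cs) \in ghist g by apply: (inv_stack Ig); rewrite eS inE eqxx.
case: (batchP' sj eJC sJK cK) => C0 tl C1 tl2 _ _ _ _ _ _ _ _ _ _ _ _ _ szB uB.
have actE : [set J' in unzip1 (rev B ++ stack (gst g))] =
    [set J' in unzip1 B] :|: active (gst g).
  by apply/setP => X; rewrite !inE /unzip1 map_cat map_rev mem_cat mem_rev.
split=> //=.
- move=> e; rewrite mem_cat => /orP[eB|/(inv_ext Ig)//].
  exact: (batch_ext jE eJC sJK cK eB).
- rewrite /unzip1 map_cat cat_uniq uB (inv_uniq Ig) andbT /=.
  apply/hasPn => X Xh; apply/negP => /mapP[e eB eX].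
  by move/negP: (hBh _ eB); rewrite -eX.
- rewrite /discovered /active /= actE -setUA -/(discovered (gst g)) (inv_disc Ig).
  by apply/setP => X; rewrite !inE /unzip1 map_cat mem_cat.
- move=> e; rewrite !mem_cat mem_rev => /orP[->//|/(inv_stack Ig)->].
  by rewrite orbT.
- rewrite /unzip1 map_cat map_rev cat_uniq rev_uniq uB (inv_ustack Ig) andbT /=.
  apply/hasPn => X Xh; apply/negP; rewrite mem_rev => /mapP[e eB eX].
  by move/negP: (hBA _ eB); apply; rewrite inE -eX.
- rewrite /active /= actE disjoint_setUl (inv_disj Ig) andbT -setI_eq0.
  apply/eqP/setP => X; rewrite !inE; apply/negP => /andP[/mapP[e eB ->]].
  by apply/negP; apply: hBE.
- by rewrite map_rcons (inv_queries Ig).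
- move=> x; rewrite mem_rcons inE => /predU1P[->|/(inv_log Ig)[h1 h2 h3]].
    by split=> //=; rewrite mem_cat hJh orbT.
  by split=> //; rewrite mem_cat h1 orbT.
- by rewrite map_rcons rcons_uniq fr (inv_ulog Ig).
- have hl := inv_layers Ig; rewrite eS in hl *.
  apply: (LayersS (pre := [::]) hl sJK cK) => //.
  move=> B0; move: szB; rewrite -/B -size_rev B0 => /esym/eqP.
  by rewrite -leqn0 leqNgt bin_gt0 leaq.
- move=> K'; rewrite inE => /predU1P[->|/(inv_edges Ig)[x xl ex]].
    by exists ((J, Cs), K, true); rewrite // mem_rcons inE eqxx.
  by exists x; rewrite // mem_rcons inE xl orbT.
- rewrite size_cat (inv_size Ig) -cats1 count_cat /= addn0 mulnDr muln1.
  by rewrite -/B in szB; rewrite szB addnCA addnA addnAC addnA.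
- move=> X /(inv_starts Ig)[h1 h2]; rewrite /unzip1 map_cat mem_cat h1 orbT.
  by split=> //; rewrite size_cat (leq_trans h2) // leq_addl.
- move=> I l; rewrite count_cat -cats1 !count_cat /= !addn0.
  have := inv_level Ig I l.
  set S := #|_|; set c := 'C(_, _); set c1 := count _ (glog g); set c2 := count _ (glog g).
  move=> h; set d1 := nat_of_bool _; set d2 := nat_of_bool _.
  suff hc : count (deeper I l) B <= c * (d1 + d2).
    have -> : S + c * (c1 + d1 + (c2 + d2)) = c * (d1 + d2) + (S + c * (c1 + c2)) by ring.
    exact: leq_add.
  (* If no set of the batch counts, nothing is added; otherwise [K] is a jump or a pivot at level
     [l + 1], and the whole batch is charged to it. *)
  case hh : (has (deeper I l) B); last by rewrite has_count in hh; case: count hh.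
  have d12 : 0 < d1 + d2.
    case/hasP: hh => e eB /andP[sI ndeep]; have /andP[sK _] := hB _ eB.
    rewrite /d1 /d2 /jump /pivot /deeper /= (subset_trans sI sK).
    case sIJ : (I \subset J) => //=; rewrite lt0b.
    by apply: contra ndeep => /(batch_level jE eJC sJK cK eB sI).
  apply: leq_trans (count_size _ _) _; rewrite szB -/c.
  by rewrite leq_pmulr.
Qed.

Lemma invariant_gupd b g : invariant g -> invariant (gupd b g).
Proof.
move=> Ig; rewrite /gupd; case eS: (stack (gst g)) => [|[J Cs] st].
  by case ef: first_in => [J|] //; apply: invariant_start.
case ef: first_in => [K|]; last exact: invariant_explore eS.
case: b; first by rewrite -eS; apply: invariant_hit eS ef.
by rewrite -eS; apply: invariant_miss eS ef.
Qed.

Lemma invariant_iter (H : hypergraph n k) m : invariant (iter m (gstep H) ginit).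
Proof. by elim: m => [|m IH]; [apply: invariant_init|apply: invariant_gupd]. Qed.

End Ghost.

Lemma leq_card_bigcup (I T : finType) (P : pred I) (F : I -> {set T}) :
  #|\bigcup_(i | P i) F i| <= \sum_(i | P i) #|F i|.
Proof.
elim/big_ind2: _ => [|A x B y lAx lBy|//]; first by rewrite cards0.
exact: leq_trans (leq_card_setU _ _) (leq_add lAx lBy).
Qed.

(** * Counting queries, degrees and blocked k-sets *)

Section Counting.
Variables (n k j a : nat) (ch : choice_rule n k j).
Variables (sj : {perm subsets n j}) (sk : {perm subsets n k}).
Hypothesis jE : j = a + (k - j) * part_index k j.
Hypothesis a0 : 0 < a.
Hypothesis leaq : a <= k - j.
Hypothesis ltjk : j < k.
Hypothesis chP : forall s (J : {set 'I_n}), #|J| = j -> extendable_partition k j a J (ch sj sk s J).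
Implicit Types (s : state n) (g : gstate n) (I J K S : {set 'I_n}) (b : bool).
Implicit Types (e : entry n) (x : answer n).

Local Notation inv := (invariant k a sj).

Lemma timeE g : inv g -> time (gst g) = size (glog g).
Proof. by move=> Ig; rewrite /time (inv_queries Ig) size_map. Qed.

Lemma query_card g K : next_query sk (gst g) = Some K -> #|K| = k.
Proof. by rewrite /next_query; case: stack => // -[J Cs] st /first_inP[]. Qed.

Lemma glog_gupd_None b g : next_query sk (gst g) = None ->
  glog (gupd a ch sj sk b g) = glog g.
Proof.
rewrite /next_query /gupd; case: stack => [|[J Cs] st]; first by case: first_in.
by move=> ->.
Qed.

Lemma glog_gupd_Some g K : next_query sk (gst g) = Some K ->
  exists e, forall b, glog (gupd a ch sj sk b g) = rcons (glog g) (e, K, b).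
Proof.
rewrite /next_query /gupd; case: stack => [//|[J Cs] st] ->.
by exists (J, Cs) => -[].
Qed.

Lemma next_query_fresh g K : inv g -> next_query sk (gst g) = Some K ->
  K \notin [seq x.1.2 | x <- glog g].
Proof.
move=> Ig; rewrite /next_query; case eS: stack => [//|[J Cs] st] /first_inP[cq _ _].
exact: (query_fresh jE a0 ltjk Ig eS cq).
Qed.

Definition consistent (H : hypergraph n k) (l : seq (answer n)) : bool :=
  all (fun x => x.2 == (x.1.2 \in edges H)) l.

Lemma consistent_iter (H : hypergraph n k) m :
  consistent H (glog (iter m (gstep a ch sj sk H) (ginit n))).
Proof.
elim: m => //= m IH; rewrite /gstep /reply; set g := iter _ _ _ in IH *.
case eq: next_query => [K|]; last by rewrite glog_gupd_None.
have [e ->] := glog_gupd_Some eq.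
by rewrite /consistent all_rcons /= eqxx.
Qed.

Lemma size_glog_gupd b g : size (glog g) <= size (glog (gupd a ch sj sk b g)) <= (size (glog g)).+1.
Proof.
case eq: (next_query sk (gst g)) => [K|]; last by rewrite glog_gupd_None // leqnn leqnSn.
by have [e ->] := glog_gupd_Some eq; rewrite size_rcons leqnn leqnSn.
Qed.

(** This lets the good event speak of the prefixes of a single log only. *)
Lemma glog_prefix (H : hypergraph n k) m m' (run := fun m => iter m (gstep a ch sj sk H) (ginit n)) :
  m <= m' -> glog (run m) = take (size (glog (run m))) (glog (run m')).
Proof.
move=> /subnK <-; elim: (m' - m) => [|d IH]; first by rewrite add0n take_size.
rewrite addSn [run _.+1]/= /gstep -/(run _).
case eq: (next_query sk (gst (run (d + m)))) => [K|]; last by rewrite glog_gupd_None.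
have [e ->] := glog_gupd_Some eq; rewrite -cats1 takel_cat //.
by rewrite IH size_take_min geq_minr.
Qed.

Lemma inv_entry_card g e : inv g -> e \in ghist g -> #|e.1| = j.
Proof. by move=> Ig /(inv_ext Ig)/(ext_card jE). Qed.

Lemma degreeE g I : inv g -> degree (gst g) I = count (fun e => I \subset e.1) (ghist g).
Proof.
move=> Ig; rewrite /degree (inv_disc Ig) -(count_map fst (fun J : {set 'I_n} => I \subset J)).
rewrite -size_filter -(card_uniqP (filter_uniq _ (inv_uniq Ig))).
by apply: eq_card => J; rewrite mem_filter !inE andbC.
Qed.

Lemma degree0 g : inv g -> degree (gst g) set0 = size (ghist g).
Proof. by move=> Ig; rewrite degreeE // (eq_count (a2 := predT)) ?count_predT // => e /=; rewrite sub0set. Qed.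

(** The two ends of the recursion over levels are this lemma and the next: at level 0 no block is
    excluded and the count is the degree, while at level r + 1 all blocks are excluded and the count
    vanishes. *)
Lemma deeper0 g I : inv g -> I != set0 -> count (deeper I 0) (ghist g) = degree (gst g) I.
Proof.
move=> Ig I0; rewrite degreeE //; apply: eq_count => e.
by rewrite /deeper take0 /seq_cover big_nil subset0 I0 andbT.
Qed.

Lemma deeper_end g I : inv g -> count (deeper I (part_index k j).+1) (ghist g) = 0.
Proof.
move=> Ig; apply/eqP; rewrite eqn0Ngt -has_count; apply/hasPn => e eh.
rewrite negb_and negbK -implybE; apply/implyP.
exact: batch_disjoint_level (inv_ext Ig eh).
Qed.

Lemma count_entry_leq g (Q : pred (answer n)) e (A : {set {set 'I_n}}) : inv g ->
  (forall x, x \in glog g -> x.1.1 = e -> Q x -> x.1.2 \in A) ->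
  count (fun x => (x.1.1 == e) && Q x) (glog g) <= #|A|.
Proof.
move=> Ig hA; rewrite -size_filter -(size_map (fun x => x.1.2)) cardE.
apply: uniq_leq_size; last first.
  by move=> K /mapP[x]; rewrite mem_filter mem_enum => /andP[/andP[/eqP ex Qx] xl] ->; apply: hA.
exact: subseq_uniq (map_subseq _ (filter_subseq _ _)) (inv_ulog Ig).
Qed.

(** Sort the queries by the entry they were made from. As no k-set occurs twice in the log, the
    entry [e] accounts for at most |A e| of them. *)
Lemma count_log_leq g (Q : pred (answer n)) (P : pred (entry n))
  (A : entry n -> {set {set 'I_n}}) : inv g ->
  (forall x, x \in glog g -> Q x -> P x.1.1 /\ x.1.2 \in A x.1.1) ->
  count Q (glog g) <= \sum_(e <- ghist g | P e) #|A e|.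
Proof.
move=> Ig hA.
have -> : count Q (glog g) =
    \sum_(e <- ghist g) count (fun x => (x.1.1 == e) && Q x) (glog g).
  rewrite -sum1_count.
  under [RHS]eq_bigr do rewrite -sum1_count.
  rewrite [RHS](exchange_big_dep Q) /=; last by move=> e x _ /andP[].
  rewrite big_seq_cond [RHS]big_seq_cond; apply: eq_bigr => x /andP[xl Qx].
  have [xh _ _] := inv_log Ig xl.
  rewrite (eq_bigl (fun e => e == x.1.1)); last by move=> e; rewrite Qx andbT eq_sym.
  rewrite -big_filter filter_pred1_uniq ?big_seq1 //.
  exact: map_uniq (inv_uniq Ig).
rewrite [X in _ <= X]big_mkcond; apply: leq_sum => e _; case: ifP => Pe.
  by apply: count_entry_leq => // x xl <- /(hA _ xl)[].
rewrite leqn0 eqn0Ngt -has_count; apply/hasPn => x xl.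
by apply/negP => /andP[/eqP ex /(hA _ xl)[]]; rewrite ex Pe.
Qed.

Lemma count_pivot_leq g I l : inv g ->
  count (pivot I l) (glog g) <= count (deeper I l) (ghist g) * 'C(n - j, k - j).
Proof.
move=> Ig; apply: leq_trans (count_log_leq (P := deeper I l) (A := fun e => supersets k e.1) Ig _) _.
  move=> x xl px; split=> //; rewrite inE.
  by have [_ -> ->] := inv_log Ig xl; rewrite eqxx.
rewrite -sum1_count big_distrl /= big_seq_cond [X in _ <= X]big_seq_cond leq_sum // => e /andP[eh _].
have ce := inv_entry_card Ig eh.
by rewrite card_supersets ce ?mul1n // ltnW.
Qed.

(** A jump to [I] queried from [J] is a k-set above [J :|: I]. Only degrees of proper subsets of [I]
    appear, which makes an induction on |I| possible. *)
Lemma count_jump_leq g I : inv g -> count (jump I) (glog g) <=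
  \sum_(S : {set 'I_n} | S \proper I) degree (gst g) S *
     ((#|I| - #|S| <= k - j) * n ^ (k - j - (#|I| - #|S|))).
Proof.
move=> Ig; apply: leq_trans (count_log_leq (P := fun e => ~~ (I \subset e.1))
   (A := fun e => supersets k (e.1 :|: I)) Ig _) _.
  move=> x xl /andP[sI ->]; split=> //; rewrite inE.
  by have [_ sx ->] := inv_log Ig xl; rewrite eqxx subUset sx sI.
have -> : \sum_(e <- ghist g | ~~ (I \subset e.1)) #|supersets k (e.1 :|: I)| =
    \sum_(J in [set J in discovered (gst g) | ~~ (I \subset J)]) #|supersets k (J :|: I)|.
  rewrite -(big_map fst (fun J : {set 'I_n} => ~~ (I \subset J))
     (fun J : {set 'I_n} => #|supersets k (J :|: I)|)) /=.
  rewrite -big_filter -[RHS]big_enum /=; apply: perm_big.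
  apply: uniq_perm; rewrite ?enum_uniq ?filter_uniq ?(inv_uniq Ig) // => J.
  by rewrite mem_filter mem_enum (inv_disc Ig) !inE andbC.
apply: leq_trans (sum_card_supersets_leq (j := j) (ltnW ltjk) _) _.
  move=> J; rewrite (inv_disc Ig) !inE => /andP[/mapP[e eh ->] ->].
  by split=> //; apply: inv_entry_card eh.
apply: leq_sum => S _; rewrite leq_mul2r; apply/orP; right.
by apply: subset_leq_card; apply/subsetP => J; rewrite !inE => /andP[/andP[-> _] ->].
Qed.

Lemma layers_vertices_card E P0 st es bs :
  (forall e, e \in st -> extendable_partition k j a e.1 e.2) ->
  layers k a sj E P0 st es bs -> st <> [::] ->
  #|P0 :|: seq_cover es| <= j + (k - j) * size es.
Proof.
move=> hst hl; elim: hl hst => {st es bs} [[//|e st] bs h0 _ hst _ |].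
  rewrite /seq_cover big_nil setU0 muln0 addn0 -(h0 e) ?inE ?eqxx //.
  by rewrite (ext_card jE (hst e _)) // inE eqxx.
move=> J Cs st es bs K pre seg hl IH sJK cK d _ _ _ hst _.
have hst' e : e \in (J, Cs) :: st -> extendable_partition k j a e.1 e.2.
  by move=> est; apply: hst; rewrite mem_cat est orbT.
have sJ := layers_vertices jE a0 ltjk hst' hl (mem_head (J, Cs) _).
have -> : P0 :|: seq_cover (K :: es) = (K :\: J) :|: (P0 :|: seq_cover es).
  rewrite seq_cover_cons; apply/setP => y; rewrite !inE.
  case yJ: (y \in J) => //=; last by rewrite orbCA.
  by move: (subsetP sJ y yJ); rewrite inE orbCA => ->; rewrite orbT.
rewrite cardsU disjoint_setI0 // cards0 subn0 mulnS addnCA leq_add ?IH //.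
rewrite cardsD (setIidPr sJK) cK.
by rewrite (ext_card jE (hst' (J, Cs) (mem_head _ _))).
Qed.

(** When [J] has nothing left to query, each k-set above [J] was queried from [J], or contains a
    path vertex outside [J], or contains an explored j-set. The three summands bound these classes;
    the path has at most (k - j) times its length many vertices outside [J]. *)
Lemma explore_count g J Cs st : inv g -> stack (gst g) = (J, Cs) :: st ->
  next_query sk (gst g) = None ->
  'C(n - j, k - j) <= count (fun x => x.1.1.1 == J) (glog g)
    + (k - j) * path_length (gst g) * 'C(n - j.+1, k - j.+1)
    + \sum_(S : {set 'I_n} | S \proper J)
        #|[set J' in explored (gst g) | S \subset J']| *
         ((#|J| - #|S| <= k - j) * n ^ (k - j - (#|J| - #|S|))).
Proof.
move=> Ig eS; rewrite /next_query eS => hN.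
have eJC := stack_ext Ig eS; have cJ := ext_card jE eJC.
have Ja : J \in active (gst g) by rewrite -[J]/((J, Cs).1) mem_active // eS mem_head.
have sJV := active_vertices jE a0 ltjk Ig Ja.
have nJE : J \notin explored (gst g) by rewrite (disjointFr (inv_disj Ig)).
rewrite -{1 2}cJ -card_supersets ?cJ ?(ltnW ltjk) //.
pose A1 := [set K in [seq x.1.2 | x <- [seq x <- glog g | x.1.1.1 == J]]].
pose A2 := \bigcup_(v in path_vertices (gst g) :\: J) supersets k (v |: J).
pose A3 := \bigcup_(J' in explored (gst g)) supersets k (J' :|: J).
have sA : supersets k J \subset A1 :|: A2 :|: A3.
  apply/subsetP => K; rewrite inE => /andP[sJK /eqP cK].
  have := first_in_None hN cK; rewrite /can_query sJK /=.
  rewrite !negb_and negbK !inE => /or3P[hq|hd|].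
  - apply/orP; left; apply/orP; left; move: hq; rewrite (inv_queries Ig) /unzip1 -map_comp.
    case/mapP => x xl /= [eJ eK]; apply/mapP; exists x => //.
    by rewrite mem_filter -eJ eqxx.
  - apply/orP; left; apply/orP; right; move: hd; rewrite -setI_eq0 => /set0Pn[v].
    rewrite !inE => /andP[/andP[vJ vK] vV]; apply/bigcupP; exists v.
      by rewrite !inE vJ.
    by rewrite inE cK eqxx andbT subUset sub1set vK.
  - case/forall_inPn => J' J'E; rewrite negbK => sJ'K.
    apply/orP; right; apply/bigcupP; exists J' => //.
    by rewrite inE cK eqxx andbT subUset sJ'K.
apply: leq_trans (subset_leq_card sA) _.
apply: leq_trans (leq_card_setU _ _) _; apply: leq_add; last first.
  apply: leq_trans (_ : _ <= \sum_(J' in explored (gst g)) #|supersets k (J' :|: J)|) _.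
    exact: leq_card_bigcup.
  have := @sum_card_supersets_leq _ j k (explored (gst g)) J (ltnW ltjk).
  rewrite cJ; apply => J' J'E.
  have : J' \in discovered (gst g) by rewrite inE J'E orbT.
  rewrite (inv_disc Ig) inE => /mapP[e eh eJ'].
  have cJ' : #|J'| = j by rewrite eJ' (inv_entry_card Ig eh).
  split=> //; apply/negP => sJ; move/negP: nJE; apply.
  by have /eqP-> : J == J'; rewrite // eqEcard sJ cJ cJ' leqnn.
apply: leq_trans (leq_card_setU _ _) _; apply: leq_add.
  rewrite -size_filter -(size_map (fun x => x.1.2)); apply: leq_trans (card_size _).
  by apply: subset_leq_card; apply/subsetP => K; rewrite inE.
apply: leq_trans (leq_card_bigcup _ _) _.
apply: leq_trans (_ : _ <= \sum_(v in path_vertices (gst g) :\: J) 'C(n - j.+1, k - j.+1)) _.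
  apply: leq_sum => v; rewrite inE => /andP[vJ _].
  have cv : #|v |: J| = j.+1 by rewrite cardsU1 vJ cJ.
  by rewrite card_supersets cv.
rewrite sum_nat_const leq_mul2r cardsD (setIidPr sJV) cJ leq_subLR.
rewrite (layers_vertices_card _ (inv_layers Ig)) ?orbT //; last by rewrite eS.
by move=> e /(inv_stack Ig)/(inv_ext Ig).
Qed.

Lemma card_active_leq g : inv g ->
  #|active (gst g)| <= 'C(k - j, a) * path_length (gst g) + 1.
Proof.
move=> Ig; have h := layers_size jE _ (inv_layers Ig); apply: leq_trans (h _).
  rewrite /active -(size_map fst); apply: leq_trans (card_size _).
  by apply: subset_leq_card; apply/subsetP => J; rewrite inE.
by move=> e /(inv_stack Ig)/(inv_ext Ig).
Qed.

Lemma card_discovered g : inv g ->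
  size (ghist g) = #|active (gst g)| + #|explored (gst g)|.
Proof.
move=> Ig; rewrite -degree0 // /degree.
rewrite (_ : [set J in _ | _] = discovered (gst g)); last first.
  by apply/setP => J; rewrite inE sub0set andbT.
by rewrite /discovered cardsU (disjoint_setI0 (inv_disj Ig)) cards0 subn0.
Qed.

Lemma sum_count_leq g (D : {set {set 'I_n}}) :
  \sum_(J in D) count (fun x => x.1.1.1 == J) (glog g) <= size (glog g).
Proof.
under eq_bigr do rewrite -sum1_count.
rewrite (exchange_big_dep predT) //= -(sum1_size (glog g)); apply: leq_sum => x _.
rewrite sum1_card; apply: leq_trans (_ : #|pred1 x.1.1.1| <= 1); last by rewrite card1.
by apply: subset_leq_card; apply/subsetP => J; rewrite !inE => /andP[_ /eqP->].
Qed.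

End Counting.

(** * The edges of the current path form a tight path *)

Section TightPath.
Variables (n k j a : nat) (sj : {perm subsets n j}).
Hypothesis jE : j = a + (k - j) * part_index k j.
Hypothesis a0 : 0 < a.
Hypothesis leaq : a <= k - j.
Hypothesis ltjk : j < k.
Implicit Types (I J K S Z : {set 'I_n}) (u v w : seq 'I_n).

Local Notation q := (k - j).
Local Notation r := (part_index k j).

(* The vertex list [u ++ c0 ++ flatten cs] traverses the edges [es] (latest
   first), and its last [j] vertices are the blocks of the partition [Cs]. *)
Variant ordering (P0 : {set 'I_n}) (es : seq {set 'I_n}) (Cs : seq {set 'I_n}) : Prop :=
  Ordering u c0 cs of
    Cs = [seq [set x in c] | c <- c0 :: cs] & size u = size es * q &
    uniq (u ++ c0 ++ flatten cs) &
    [set x in u ++ c0 ++ flatten cs] = P0 :|: seq_cover es &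
    (forall i, i < size es -> [set x in take k (drop (i * q) (u ++ c0 ++ flatten cs))]
        = nth set0 (rev es) i).

Lemma seq_disjoint_flatten_uniq (Cs : seq {set 'I_n}) : seq_disjoint Cs ->
  uniq (flatten [seq enum C | C : {set 'I_n} <- Cs]) /\
  [set x in flatten [seq enum C | C : {set 'I_n} <- Cs]] = seq_cover Cs.
Proof.
have mem_fl Ds : [set x in flatten [seq enum C | C : {set 'I_n} <- Ds]] = seq_cover Ds.
  elim: Ds => [|C Ds IH] /=; first by rewrite /seq_cover big_nil; apply/setP => x; rewrite !inE.
  rewrite seq_cover_cons -IH; apply/setP => x; rewrite !inE mem_cat mem_enum //.
move=> H; split=> //; elim: Cs H => [|C Cs IH] //; rewrite seq_disjoint_cons /= => /andP[d1 d2].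
rewrite cat_uniq enum_uniq IH // andbT; apply/hasPn => x.
have -> : (x \in flatten [seq enum C | C : {set 'I_n} <- Cs]) = (x \in seq_cover Cs) by rewrite -mem_fl inE.
by rewrite mem_enum => xC; rewrite (disjointFl d1).
Qed.

Lemma ordering_start J Cs : extendable_partition k j a J Cs -> ordering J [::] Cs.
Proof.
move=> /(extP)[C0 tl -> cC0 sz call d1 d2 eJ].
have /seq_disjoint_flatten_uniq[un me] : seq_disjoint (C0 :: tl).
  by rewrite seq_disjoint_cons d1 d2.
exists [::] (enum C0) [seq enum C | C : {set 'I_n} <- tl] => //=.
  by rewrite set_enum; congr (_ :: _); rewrite -map_comp map_id_in // => C _ /=; rewrite set_enum.
by rewrite me seq_cover_cons -eJ /seq_cover big_nil setU0.
Qed.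

Lemma window_perm m (y x x' w : seq 'I_n) : perm_eq x x' ->
  m <= size y \/ size y + size x <= m ->
  [set z in take m (y ++ x ++ w)] = [set z in take m (y ++ x' ++ w)].
Proof.
move=> pxx' [hm|hm]; first by rewrite !takel_cat.
have sxx := perm_size pxx'; have hy : size y <= m := leq_trans (leq_addr _ _) hm.
have tk t : size t = size x -> take m (y ++ t ++ w) = y ++ t ++ take (m - size y - size x) w.
  by move=> st; rewrite take_cat ltnNge hy /= take_cat ltnNge st leq_subRL // hm.
rewrite !tk //; apply/setP => z; rewrite !inE !mem_cat (perm_mem pxx') //.
Qed.

(** The order inside C_1 is settled only now: for Z to be the first block of J_Z, the vertices of
    C_1 are rearranged as C_1 \ Z followed by Z, and C_0 and C_1 \ Z join the settled part [u]. The
    edges survive this: their windows start at multiples of k - j and have length k = a + (k - j)(r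
    + 1), so they end at block boundaries and contain all or nothing of C_1. *)
Lemma ordering_step P0 es J Cs K e : extendable_partition k j a J Cs ->
  J \subset K -> #|K| = k -> [disjoint K :\: J & P0 :|: seq_cover es] ->
  e \in new_batch a sj (rcons Cs (K :\: J)) ->
  ordering P0 es Cs -> ordering P0 (K :: es) e.2.
Proof.
move=> eJC sJK cK dK eB [u c0 cs eCs su un ev hw].
have cJ := ext_card jE eJC.
case: (batchP jE sj eJC sJK cK) => C0 tl C1 tl2 eC eD cC0 sz sz2 call cC1 _ _ _ _ eJ memB _ _.
case/memB: eB => Z /andP[sZ /eqP cZ] -> /=.
have [eC0 etl] : C0 = [set x in c0] /\ tl = [seq [set x in c] | c <- cs].
  by move: eCs; rewrite eC => -[-> ->].
have szq (A : {set 'I_n}) c : uniq c -> A = [set x in c] -> size c = #|A|.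
  by move=> uc ->; rewrite -(card_uniqP uc); apply: eq_card => x; rewrite inE.
have [c1 [cs2 ecs]] : exists c1 cs2, rcons cs (enum (K :\: J)) = c1 :: cs2.
  by case: (cs) => [|c1 cs'] /=; eexists; eexists.
have := congr1 (map (fun c : seq 'I_n => [set x in c])) ecs.
rewrite map_rcons -etl set_enum eD => -[eC1 etl2].
have efl : flatten cs ++ enum (K :\: J) = c1 ++ flatten cs2.
  by have := congr1 flatten ecs; rewrite -cats1 flatten_cat /= cats0.
pose v := u ++ c0 ++ flatten cs; pose N := K :\: J.
have evp : v ++ enum N = (u ++ c0) ++ c1 ++ flatten cs2 by rewrite /v -!catA efl.
have unp : uniq (v ++ enum N).
  rewrite cat_uniq un enum_uniq andbT; apply/hasPn => x; rewrite mem_enum => xN.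
  by rewrite -[_ \in _]in_set ev (disjointFr dK xN).
have uc1 : uniq c1 by move: unp; rewrite evp !cat_uniq; case/and3P => _ _ /and3P[].
have uc0 : uniq c0 by move: unp; rewrite evp !cat_uniq; case/and3P => /and3P[].
pose z := enum Z; pose zb := enum (C1 :\: Z).
have pz : perm_eq c1 (zb ++ z).
  apply: uniq_perm => //.
    rewrite cat_uniq !enum_uniq andbT; apply/hasPn => x.
    by rewrite !mem_enum !inE => ->.
  move=> x; rewrite mem_cat !mem_enum inE.
  case xZ: (x \in Z) => /=; first by move/subsetP: sZ => /(_ x xZ); rewrite eC1 inE.
  by rewrite orbF eC1 inE.
have ev' : (u ++ c0 ++ zb) ++ z ++ flatten cs2 = (u ++ c0) ++ (zb ++ z) ++ flatten cs2.
  by rewrite -!catA.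
have pv : perm_eq (v ++ enum N) ((u ++ c0) ++ (zb ++ z) ++ flatten cs2).
  by rewrite evp perm_cat2l perm_cat2r.
have szc1 : size c1 = q by rewrite (szq C1) // cC1.
have szc0 : size c0 = a by rewrite (szq C0) // cC0.
have szv : size v = size es * q + j.
  rewrite /v !size_cat su szc0; congr (_ + _).
  have := congr1 size efl; rewrite !size_cat -cardE szc1 => efs.
  have scs2 : size (flatten cs2) = q * size cs2.
    have : all (fun B : {set 'I_n} => #|B| == q) tl2.
      have : all (fun B : {set 'I_n} => #|B| == q) (C1 :: tl2).
        rewrite -eD all_rcons call andbT cardsD (setIidPr sJK) cK cJ //.
      by case/andP.
    have : uniq (flatten cs2) by move: unp; rewrite evp !cat_uniq; case/and3P => _ _ /and3P[].
    rewrite etl2; elim: (cs2) => [|c l IH] /=; rewrite ?muln0 //.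
    rewrite cat_uniq size_cat mulnS => /and3P[uc _ ul] /andP[/eqP cc cl].
    by rewrite IH // (szq _ c uc erefl) cc.
  have szcs2 : size cs2 = r by rewrite -sz2 etl2 size_map.
  rewrite cardsD (setIidPr sJK) cK cJ scs2 szcs2 in efs.
  by rewrite [X in _ = X]jE; congr (_ + _); apply/eqP; rewrite -(eqn_add2r q) efs addnC.
have eJv : J = [set x in c0 ++ flatten cs].
  rewrite eJ eC0 etl; apply/setP => x; rewrite !inE mem_cat; congr (_ || _).
  rewrite mem_seq_cover has_map; apply/hasP/flattenP => -[c ccs]; rewrite /= ?inE => xc; exists c; rewrite ?inE //.
have eK : [set x in c0 ++ flatten cs ++ enum N] = K.
  apply/setP => x; rewrite inE catA mem_cat mem_enum inE.
  have -> : (x \in c0 ++ flatten cs) = (x \in J) by rewrite eJv inE.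
  by case xJ: (x \in J) => //=; rewrite (subsetP sJK).
exists (u ++ c0 ++ zb) z cs2 => /=.
- by rewrite set_enum etl2.
- rewrite !size_cat su szc0 -cardE cardsD (setIidPr sZ) cC1 cZ subnKC // mulSn addnC //.
- by rewrite ev' -(perm_uniq pv).
- rewrite ev' seq_cover_cons setUCA -ev; apply/setP => x.
  rewrite !inE -(perm_mem pv) mem_cat mem_enum inE orbC.
  case xv: (x \in v); rewrite ?orbT // !orbF.
  case xJ: (x \in J) => //=.
  by move: xv; rewrite /v mem_cat -[x \in c0 ++ _]in_set -eJv xJ orbT.
- move=> i; rewrite ltnS => hi; rewrite ev'.
  have hiu : i * q <= size u by rewrite su leq_mul2r hi orbT.
  have dr w : drop (i * q) ((u ++ c0) ++ w) = (drop (i * q) u ++ c0) ++ w.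
    rewrite -!catA drop_cat; case: ltnP => // hu.
    have -> : i * q = size u by apply/eqP; rewrite eqn_leq hu hiu.
    by rewrite subnn drop0 drop_size.
  have kE : k = a + q * r.+1 by rewrite mulnS addnCA -jE subnK // ltnW.
  rewrite dr -(window_perm (x := c1)) //; last first.
    rewrite size_cat size_drop su szc0 szc1 -mulnBl.
    case: (ltnP r (size es - i)) => h; [left|right].
      by rewrite [X in X <= _]kE addnC leq_add2r [_ * q]mulnC leq_mul2l h orbT.
    rewrite [X in _ <= X]kE -addnA [a + q]addnC addnA addnC leq_add2l -mulSnr mulnC.
    by rewrite leq_mul2l ltnS h orbT.
  rewrite -dr -evp rev_cons nth_rcons size_rev.
  case: ltnP => hie.
    rewrite -hw // drop_cat /v -/v.
    have hv : i * q + k <= size v.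
      by rewrite szv -[X in _ + X <= _](subnK (ltnW ltjk)) addnA leq_add2r -mulSnr leq_mul2r hie orbT.
    case: ltnP => hv2; last first.
      by have := leq_trans hv hv2; rewrite -[X in _ <= X]addn0 leq_add2l leqn0 => /eqP k0; move: ltjk; rewrite k0.
    by rewrite takel_cat // size_drop leq_subRL // ltnW.
  have -> : i = size es by apply/eqP; rewrite eqn_leq hi hie.
  rewrite eqxx -su /v -catA drop_size_cat // take_oversize; first by rewrite -catA.
  rewrite size_cat -cardE cardsD (setIidPr sJK) cK cJ.
  have := szv; rewrite /v size_cat su => /eqP; rewrite eqn_add2l => /eqP->.
  by rewrite subnKC // ltnW.
Qed.

Lemma layers_ordering E P0 st es bs :
  (forall e, e \in st -> extendable_partition k j a e.1 e.2) ->
  layers k a sj E P0 st es bs ->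
  forall e st', st = e :: st' -> ordering P0 es e.2.
Proof.
move=> hst hl; elim: hl hst => {st es bs} [st bs h0 _ hst e st' est|].
  have ein : e \in st by rewrite est mem_head.
  by rewrite -(h0 e ein); apply: ordering_start (hst e ein).
move=> J Cs st es bs K pre [//|e seg] hl IH sJK cK d eB _ _ hst _ _ [<- _].
have hst' e' : e' \in (J, Cs) :: st -> extendable_partition k j a e'.1 e'.2.
  by move=> est; apply: hst; rewrite mem_cat est orbT.
apply: (ordering_step (hst' (J, Cs) (mem_head _ _)) sJK cK d); last exact: IH hst' _ _ erefl.
by rewrite -mem_rev eB mem_cat mem_head orbT.
Qed.

Lemma path_length_leq (H : hypergraph n k) g : invariant k a sj g ->
  consistent H (glog g) -> path_length (gst g) <= longest_tight_path j H.
Proof.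
move=> Ig cH; rewrite /path_length; set es := path_edges (gst g).
have esH K : K \in es -> K \in edges H.
  by case/(inv_edges Ig) => x /(allP cH)/eqP ex [<- xt]; rewrite -ex.
have [es0|es0] := posnP (size es); first by rewrite es0.
have hl := inv_layers Ig.
(* Each layer keeps a nonempty segment on the stack, so a path with an edge comes with a top j-set
   whose partition orders it. *)
have [e [st eS]] : exists e st, stack (gst g) = e :: st.
  move: hl es0; rewrite /es; case=> // J Cs st es' bs K pre [//|e seg] *.
  by exists e; eexists.
have [] := layers_ordering _ hl eS; first by move=> e' /(inv_stack Ig)/(inv_ext Ig).
rewrite -/es => u c0 cs eCs su un ev hw.
have hext := inv_ext Ig (inv_stack Ig (_ : e \in _)).
have {}hext : extendable_partition k j a e.1 e.2 by apply: hext; rewrite eS mem_head.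
set v := u ++ c0 ++ flatten cs in un ev hw.
have szv : size v = size es * (k - j) + j.
  rewrite /v size_cat su; congr (_ + _).
  have uv : uniq (c0 ++ flatten cs) by exact: (subseq_uniq (suffix_subseq u _) un).
  rewrite -(ext_card jE hext).
  have -> : e.1 = [set x in c0 ++ flatten cs].
    case/extP: hext => C0 tl; rewrite eCs => -[<- <-] _ _ _ _ _ ->.
    apply/setP => x; rewrite !inE mem_cat; congr (_ || _).
    rewrite mem_seq_cover has_map; apply/hasP/flattenP => -[c ccs]; rewrite /= ?inE => xc; exists c; rewrite ?inE //.
  by rewrite -(card_uniqP uv); apply: eq_card => x; rewrite inE.
have len : size es < n.+1.
  rewrite ltnS; have : size v <= n by rewrite -[X in _ <= X]card_ord -(card_uniqP un) max_card.
  apply: leq_trans; rewrite szv (leq_trans _ (leq_addr _ _)) //.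
  by rewrite leq_pmulr // subn_gt0.
rewrite /longest_tight_path.
apply: (@leq_trans (\max_(l < n.+1 | (l == Ordinal len) && true) l)).
  by rewrite (big_pred1 (Ordinal len)) // => l; rewrite andbT.
apply/bigmax_leqP => l; rewrite andbT => /eqP->.
apply: leq_bigmax_cond.
apply/existsP; exists (tcast szv (in_tuple v)).
rewrite /is_tight_path val_tcast /= szv eqxx un /=.
apply/forallP => i; rewrite hw //; apply: esH.
by rewrite -mem_rev mem_nth // size_rev.
Qed.

End TightPath.

Local Open Scope ring_scope.

(** * The binomial measure and the status of one k-set *)

Section Binomial.
Variables (R : realType) (n k : nat) (p : R).
Local Notation mu := (binomial_hypergraph p).
Implicit Types (H : hypergraph n k) (K : {set 'I_n}).

Lemma sum_binomial_hypergraph : \sum_(H : hypergraph n k) mu H = 1.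
Proof.
transitivity (\prod_(K : subsets n k) (p + (1 - p))); last first.
  by rewrite big1 // => K _; rewrite addrC subrK.
by rewrite bigA_distr; apply: eq_bigl => H; rewrite inE.
Qed.

Lemma binomial_hypergraph_ge0 H : 0 <= p <= 1 -> 0 <= mu H.
Proof.
move=> /andP[p0 p1]; apply: prodr_ge0 => K _; case: ifP => // _.
by rewrite subr_ge0.
Qed.

Lemma mem_edges H (K : subsets n k) : (val K \in edges H) = (K \in H).
Proof. by rewrite /edges mem_imset //; apply: val_inj. Qed.

(** An event [Q] that ignores [K] is independent of the status of [K]: toggling [K] is a bijection
    between the two halves of [Q], and it preserves the weight [nu] from which the factor of [K] has
    been removed. *)
Lemma sum_binomial_reveal K (Q : pred (hypergraph n k)) b : #|K| = k ->
  (forall H H', (forall K', K' != K -> (K' \in edges H) = (K' \in edges H')) -> Q H = Q H') ->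
  \sum_(H | Q H && (b == (K \in edges H))) mu H
  = (if b then p else 1 - p) * \sum_(H | Q H) mu H.
Proof.
move=> cK hQ; have cK' : #|K| == k by apply/eqP.
pose K0 : subsets n k := Sub K cK'.
have eK H : (K \in edges H) = (K0 \in H) by rewrite -mem_edges SubK.
pose nu H := \prod_(K : subsets n k | K != K0) (if K \in H then p else 1 - p).
have muE H : mu H = (if K0 \in H then p else 1 - p) * nu H.
  by rewrite /binomial_hypergraph (bigD1 K0).
have part c : \sum_(H | Q H && (c == (K \in edges H))) mu H
    = (if c then p else 1 - p) * \sum_(H | Q H && (c == (K \in edges H))) nu H.
  by rewrite big_distrr /=; apply: eq_bigr => H /andP[_ /eqP->]; rewrite muE eK.
pose tog H : hypergraph n k := if K0 \in H then H :\ K0 else K0 |: H.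
have togK : involutive tog.
  move=> H; rewrite /tog; case h: (K0 \in H); first by rewrite setD11 setD1K.
  by rewrite setU11 setU1K // h.
have togE H (K' : subsets n k) : K' != K0 -> (K' \in tog H) = (K' \in H).
  by move=> nK; rewrite /tog; case: ifP; rewrite ?in_setD1 ?in_setU1 ?nK ?(negbTE nK).
have tog0 H : (K0 \in tog H) = (K0 \notin H).
  by rewrite /tog; case: ifP => h; rewrite ?setD11 ?setU11 ?h.
have nuE : \sum_(H | Q H && (true == (K \in edges H))) nu H =
    \sum_(H | Q H && (false == (K \in edges H))) nu H.
  rewrite (reindex_inj (inv_inj togK)) /=; apply: eq_big => H.
    rewrite !eK tog0 (hQ (tog H) H) //.
    move=> K' nK; case cK'': (#|K'| == k); last first.
        by rewrite /edges; apply/imsetP/imsetP => -[X _ eX]; move: (valP X); rewrite -eX cK''.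
      have -> : K' = val (Sub K' cK'' : subsets n k) by rewrite SubK.
      rewrite !mem_edges togE //.
  by move=> _; apply: eq_bigr => K' nK; rewrite togE.
have -> : \sum_(H | Q H) mu H = \sum_(H | Q H && (true == (K \in edges H))) nu H.
  rewrite (bigID (fun H => true == (K \in edges H))) /= part.
  rewrite [X in _ + X](eq_bigl (fun H => Q H && (false == (K \in edges H)))); last first.
    by move=> H; case: (K \in edges H).
  by rewrite part /= -nuE -mulrDl addrC subrK mul1r.
by rewrite part; case: b; rewrite // nuE.
Qed.

End Binomial.

(** * Supermartingales along the adaptive queries *)

Section Adaptive.
Variables (R : realType) (n k j a : nat) (ch : choice_rule n k j).
Variables (sj : {perm subsets n j}) (sk : {perm subsets n k}).
Hypothesis jE : j = (a + (k - j) * part_index k j)%N.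
Hypothesis a0 : (0 < a)%N.
Hypothesis leaq : (a <= k - j)%N.
Hypothesis ltjk : (j < k)%N.
Hypothesis chP : forall s (J : {set 'I_n}), #|J| = j ->
  extendable_partition k j a J (ch sj sk s J).
Variable p : R.
Hypothesis p01 : 0 <= p <= 1.
Local Notation mu := (binomial_hypergraph p).
Implicit Types (H : hypergraph n k).

(* The invariant excludes a second query of the same k-set, so that the next
   answer is independent of the log. *)
Lemma expectation_supermartingale (f : seq (answer n) -> R) m g :
  (forall l e K, p * f (rcons l (e, K, true)) + (1 - p) * f (rcons l (e, K, false)) <= f l) ->
  invariant k a sj g ->
  \sum_(H : hypergraph n k | consistent H (glog g)) mu H * f (glog (iter m (gstep a ch sj sk H) g))
  <= f (glog g) * \sum_(H : hypergraph n k | consistent H (glog g)) mu H.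
Proof.
move=> hf; elim: m g => [|m IH] g Ig.
  by rewrite /= -mulr_suml mulrC.
(* The first step is peeled off rather than the last: its answer splits the consistent hypergraphs
   into two classes, each of the form treated by the induction hypothesis. *)
under eq_bigr do rewrite iterSr.
have Iu b : invariant k a sj (gupd a ch sj sk b g) by apply: invariant_gupd.
case eq: (next_query sk (gst g)) => [K|]; last first.
  have := IH _ (Iu false); rewrite glog_gupd_None //.
  by rewrite /gstep /reply eq.
have [e eg] := glog_gupd_Some a ch sj eq.
have cK := query_card eq; have fr := next_query_fresh jE a0 ltjk Ig eq.
pose Q H := consistent H (glog g).
have QE b H : consistent H (glog (gupd a ch sj sk b g)) = Q H && (b == (K \in edges H)).
  by rewrite eg /consistent all_rcons /= andbC.
have hQ H H' : (forall K', K' != K -> (K' \in edges H) = (K' \in edges H')) -> Q H = Q H'.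
  move=> hH; apply: eq_in_all => x xl; rewrite hH //.
  by apply: contra fr => /eqP<-; apply: map_f.
rewrite (bigID (fun H => true == (K \in edges H))) /=.
have half b : \sum_(H | Q H && (b == (K \in edges H)))
      mu H * f (glog (iter m (gstep a ch sj sk H) (gstep a ch sj sk H g)))
    <= f (rcons (glog g) (e, K, b)) * ((if b then p else 1 - p) * \sum_(H | Q H) mu H).
  have := IH _ (Iu b); rewrite !(eq_bigl _ _ (QE b)) -(sum_binomial_reveal p b cK hQ) eg.
  apply: le_trans; rewrite le_eqVlt; apply/orP; left; apply/eqP.
  by apply: eq_bigr => H /andP[_ /eqP eb]; rewrite {2}/gstep /reply eq -eb.
rewrite [X in _ + X](eq_bigl (fun H => Q H && (false == (K \in edges H)))); last first.
  by move=> H; rewrite /Q; case: (K \in edges H).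
apply: le_trans (lerD (half true) (half false)) _ => /=.
rewrite !mulrA -mulrDl [_ * p]mulrC [_ * (1 - p)]mulrC.
by apply: ler_wpM2r => //; apply: sumr_ge0 => H _; apply: binomial_hypergraph_ge0.
Qed.

(** Each query multiplies the product by a factor of conditional mean at most 1, and queries after
    the first [t] leave it unchanged. *)
Lemma expectation_prod_leq1 (w : answer n -> R) t m :
  (forall x, 0 <= w x) ->
  (forall e K, p * w (e, K, true) + (1 - p) * w (e, K, false) <= 1) ->
  \sum_(H : hypergraph n k) mu H *
    \prod_(x <- take t (glog (iter m (gstep a ch sj sk H) (ginit n)))) w x <= 1.
Proof.
move=> w0 w1; pose f (l : seq (answer n)) := \prod_(x <- take t l) w x.
have hf : forall l e K, p * f (rcons l (e, K, true)) + (1 - p) * f (rcons l (e, K, false)) <= f l.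
  move=> l e K; rewrite /f -!cats1 !take_cat; case: ltnP => hl.
    by rewrite -mulrDl addrC subrK mul1r.
  rewrite [take t l]take_oversize //.
  case: (t - size l)%N => [|d] /=; first by rewrite cats0 -mulrDl addrC subrK mul1r.
  rewrite !big_cat !big_seq1 /= mulrCA [X in _ + X]mulrCA -mulrDr.
  by rewrite -[X in _ <= X]mulr1; apply: ler_wpM2l => //; apply: prodr_ge0.
apply: le_trans (expectation_supermartingale m hf (invariant_init k a sj)) _.
rewrite {1}/f big_nil mul1r le_eqVlt; apply/orP; left; apply/eqP.
exact: sum_binomial_hypergraph.
Qed.

End Adaptive.

(** * Exponential moments of a uniformly random order *)

Section RandomPerm.
Variables (R : realType) (T : finType) (A : {set T}).
Implicit Types (S J : {set T}) (s : {perm T}).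

Local Notation N := (#|T|%:R : R).
Local Notation hits s x := ((s x \in A)%:R : R).

Lemma sum_perm_swap S x y : x \notin S -> y \notin S ->
  \sum_(s : {perm T}) \prod_(z in x |: S) hits s z = \sum_(s : {perm T}) \prod_(z in y |: S) hits s z.
Proof.
move=> xS yS; rewrite (reindex_inj (mulgI (tperm x y))) /=; apply: eq_bigr => s _.
rewrite !big_setU1 //= permM tpermL; congr (_ * _); apply: eq_bigr => z zS.
rewrite permM tpermD //; [apply: contraNneq xS => ->|apply: contraNneq yS => ->] => //.
Qed.

(** Sampling without replacement: if all of [S] is mapped into [A], a further point is mapped there
    with probability (|A| - |S|) / (N - |S|) <= |A| / N. By symmetry [x] may be averaged over the
    complement of [S]. *)
Lemma sum_perm_step S x : x \notin S ->
  \sum_(s : {perm T}) \prod_(z in x |: S) hits s z <= #|A|%:R / N * \sum_(s : {perm T}) \prod_(z in S) hits s z.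
Proof.
move=> xS; have ltSN : (#|S| < #|T|)%N.
  by rewrite -(cardsT T) proper_card // properE subsetT; apply/subsetPn; exists x.
have N0 : 0 < N by rewrite ltr0n (leq_ltn_trans _ ltSN).
have NS : 0 < N - #|S|%:R by rewrite subr_gt0 ltr_nat.
have leAN : #|A|%:R <= N by rewrite ler_nat max_card.
suff key : (N - #|S|%:R) * \sum_(s : {perm T}) \prod_(z in x |: S) hits s z =
    (#|A|%:R - #|S|%:R) * \sum_(s : {perm T}) \prod_(z in S) hits s z.
  rewrite -(ler_pM2l NS) key mulrA; apply: ler_wpM2r.
    by apply: sumr_ge0 => s _; apply: prodr_ge0.
  rewrite mulrBl mulrCA divff ?gt_eqF // mulr1 lerB // ler_piMr //.
  by rewrite ler_pdivrMr // mul1r.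
transitivity (\sum_(y in ~: S) \sum_(s : {perm T}) \prod_(z in y |: S) hits s z).
  rewrite [RHS](eq_bigr (fun=> \sum_(s : {perm T}) \prod_(z in x |: S) hits s z)); last first.
    by move=> y; rewrite inE => yS; apply: sum_perm_swap.
  have cC : #|~: S| = (#|T| - #|S|)%N by rewrite -(cardsC S) addKn.
  by rewrite sumr_const cC -[RHS]mulr_natl natrB // ltnW.
rewrite exchange_big big_distrr /=; apply: eq_bigr => s _.
rewrite (eq_bigr (fun y => hits s y * \prod_(z in S) hits s z)); last first.
  by move=> y; rewrite inE => yS; rewrite big_setU1.
rewrite -big_distrl /=.
(* Unless all of [S] is mapped into [A], the product vanishes on both sides. *)
have [/forall_inP hS|] := boolP [forall z in S, s z \in A]; last first.
  by case/forall_inPn => z zS nz; rewrite [in X in _ * X = _](bigD1 z) //= [in RHS](bigD1 z) //= (negbTE nz) mul0r !mulr0.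
congr (_ * _).
have -> : \sum_(y in ~: S) hits s y = #|[set z | s z \in A] :\: S|%:R.
  rewrite -natr_sum; congr _%:R; rewrite -sum1_card big_mkcond [RHS]big_mkcond.
  by apply: eq_bigr => y _; rewrite !inE; case: (y \in S); case: (s y \in A).
have sS : S \subset [set z | s z \in A] by apply/subsetP => z /hS; rewrite inE.
have cA : #|[set z | s z \in A]| = #|A|.
  rewrite -(card_preimset A (@perm_inj _ s)).
  by apply: eq_card => z; rewrite !inE.
by rewrite cardsD (setIidPr sS) cA natrB // -cA subset_leq_card.
Qed.

Lemma sum_perm_prod S : \sum_(s : {perm T}) \prod_(z in S) hits s z <=
  #|{perm T}|%:R * (#|A|%:R / N) ^+ #|S|.
Proof.
move: {2}#|S| (leqnn #|S|) => m; elim: m S => [|m IH] S.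
  rewrite leqn0 cards_eq0 => /eqP->; rewrite cards0 mulr1.
  by under eq_bigr do rewrite big_set0; rewrite sumr_const.
have [->|[x xS]] := set_0Vmem S; first by move=> _; apply: IH; rewrite cards0.
rewrite -(setD1K xS) cardsU1 setD11 add1n ltnS => /IH le.
apply: le_trans (sum_perm_step _) _; first by rewrite setD11.
by rewrite exprS mulrCA ler_wpM2l // divr_ge0.
Qed.

(** The product equals 2 to the number of hits. Expanding it over the subsets of [S] gives terms
    that are at most their values for independent draws, and the latter sum up to a power again. *)
Lemma sum_perm_exp S : \sum_(s : {perm T}) \prod_(z in S) (1 + hits s z) <=
  #|{perm T}|%:R * (1 + #|A|%:R / N) ^+ #|S|.
Proof.
have expand (y : T -> R) : \prod_(z in S) (1 + y z) =
    \sum_(J : {set T} | J \subset S) \prod_(z in J) y z.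
  transitivity (\prod_z ((z \in S)%:R * y z + 1)).
    rewrite big_mkcond; apply: eq_bigr => z _.
    by case: (z \in S); rewrite ?mul1r ?mul0r ?add0r // addrC.
  rewrite bigA_distr [RHS]big_mkcond; apply: eq_big => [J|J _]; first by rewrite inE.
  case: ifPn => [/subsetP sJ|/subsetPn[z zJ zS]].
    rewrite [RHS]big_mkcond; apply: eq_bigr => z _.
    by case: ifP => // /sJ ->; rewrite mul1r.
  by rewrite (bigD1 z) //= zJ (negbTE zS) !mul0r.
under eq_bigr do rewrite expand.
rewrite exchange_big /= -prodr_const expand big_distrr /=.
by apply: ler_sum => J _; rewrite prodr_const; apply: sum_perm_prod.
Qed.

End RandomPerm.

(** * Probability and expectation over the outcomes *)

Section Expectation.
Variables (R : realType) (n k j : nat) (p : R).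
Hypothesis p01 : 0 <= p <= 1.
Implicit Types (w : outcome n k j) (E : outcome n k j -> Prop) (Z : outcome n k j -> R).

Local Notation weight w := (binomial_hypergraph p w.1.1
      / (#|{: {perm subsets n j}}| * #|{: {perm subsets n k}}|)%:R).

Lemma card_perm_gt0 (T : finType) : (0 < #|{: {perm T}}|)%N.
Proof. by apply/card_gt0P; exists 1%g. Qed.

Lemma outcome_weight_ge0 w : 0 <= weight w.
Proof. by rewrite divr_ge0 // binomial_hypergraph_ge0. Qed.

Definition expectation Z : R := \sum_w weight w * Z w.

Lemma sum_outcome Z : \sum_w Z w =
  \sum_(sj : {perm subsets n j}) \sum_(sk : {perm subsets n k})
    \sum_(H : hypergraph n k) Z (H, sj, sk).
Proof.
transitivity (\sum_(H : hypergraph n k) \sum_(sj : {perm subsets n j})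
    \sum_(sk : {perm subsets n k}) Z (H, sj, sk)).
  rewrite pair_bigA pair_bigA /=; apply: eq_bigr => -[[H sj] sk] _ //.
rewrite exchange_big /=; apply: eq_bigr => sj _.
by rewrite exchange_big.
Qed.

Lemma expectation_leq Z c :
  (forall sj sk, \sum_(H : hypergraph n k) binomial_hypergraph p H * Z (H, sj, sk) <= c) ->
  expectation Z <= c.
Proof.
move=> hZ; rewrite /expectation sum_outcome.
set d : R := (_ * _)%:R^-1.
have -> : c = \sum_(sj : {perm subsets n j}) \sum_(sk : {perm subsets n k}) d * c.
  rewrite !sumr_const -mulrnA -mulr_natl mulrA mulnC [_ * d]divff ?mul1r //.
  by rewrite pnatr_eq0 -lt0n muln_gt0 !card_perm_gt0.
apply: ler_sum => sj _; apply: ler_sum => sk _.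
apply: le_trans (ler_wpM2l _ (hZ sj sk)); last by rewrite invr_ge0.
by rewrite big_distrr /=; apply: ler_sum => H _; rewrite mulrAC mulrC.
Qed.

Lemma expectation_order_leq (Z : {perm subsets n j} -> R) c :
  \sum_(sj : {perm subsets n j}) Z sj <= #|{perm subsets n j}|%:R * c ->
  expectation (fun w => Z w.1.2) <= c.
Proof.
move=> hZ; rewrite /expectation sum_outcome /=.
set d : R := (_ * _)%:R^-1.
have -> : \sum_(sj : {perm subsets n j}) \sum_(sk : {perm subsets n k})
    \sum_(H : hypergraph n k) binomial_hypergraph p H * d * Z sj =
    d * #|{perm subsets n k}|%:R * \sum_(sj : {perm subsets n j}) Z sj.
  rewrite big_distrr /=; apply: eq_bigr => sj _.
  have h (sk : {perm subsets n k}) : \sum_(H : hypergraph n k) binomial_hypergraph p H * d * Z sj = d * Z sj.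
    by rewrite -2!mulr_suml sum_binomial_hypergraph mul1r.
  by rewrite (eq_bigr _ (fun sk _ => h sk)) sumr_const -mulrnAl -[d *+ _]mulr_natr.
apply: le_trans (ler_wpM2l _ hZ) _; first by rewrite mulr_ge0 // invr_ge0.
rewrite mulrA -[d * _ * _]mulrA -natrM mulnC mulVf ?mul1r //.
by rewrite pnatr_eq0 -lt0n muln_gt0 !card_perm_gt0.
Qed.

Lemma PrE E : Pr p E = expectation (fun w => `[< E w >]%:R).
Proof.
rewrite /Pr /expectation big_mkcond; apply: eq_bigr => w _.
by case: asboolP => _; rewrite ?mulr1 ?mulr0.
Qed.

Lemma ler_Pr E E' : (forall w, E w -> E' w) -> Pr p E <= Pr p E'.
Proof.
move=> sE; rewrite !PrE; apply: ler_sum => w _.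
apply: ler_wpM2l; first exact: outcome_weight_ge0.
by case: asboolP => // /sE/asboolP ->.
Qed.

Lemma Pr_markov E Z c : (forall w, 0 <= Z w) -> (forall w, E w -> 1 <= Z w) ->
  expectation Z <= c -> Pr p E <= c.
Proof.
move=> Z0 hE; apply: le_trans; rewrite PrE; apply: ler_sum => w _.
apply: ler_wpM2l; first exact: outcome_weight_ge0.
by case: asboolP => // /hE.
Qed.

Lemma Pr_true : Pr p (fun _ : outcome n k j => True) = 1 :> R.
Proof.
rewrite PrE (_ : (fun _ => _) = (fun w => (fun=> 1) w.1.2)); last first.
  by apply/funext => w; rewrite asboolT.
apply/le_anti/andP; split.
  by apply: (@expectation_order_leq (fun=> 1)); rewrite sumr_const mulr1.
(* The reverse inequality is the same upper bound, for the constant -1. *)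
have := @expectation_order_leq (fun=> -1) (-1) _.
rewrite sumr_const mulrN1 -mulNrn => /(_ (lexx _)).
rewrite /expectation; under eq_bigr do rewrite mulrN1.
by rewrite sumrN lerN2; under [X in _ -> _ <= X]eq_bigr do rewrite mulr1.
Qed.

Lemma Pr_leq1 E : Pr p E <= 1.
Proof. by rewrite -Pr_true; apply: ler_Pr. Qed.

Lemma Pr_or E E' : Pr p (fun w => E w \/ E' w) <= Pr p E + Pr p E'.
Proof.
rewrite !PrE /expectation -big_split /=; apply: ler_sum => w _; rewrite -mulrDr.
apply: ler_wpM2l; first exact: outcome_weight_ge0.
case: (asboolP (_ \/ _)) => [|_]; last by rewrite addr_ge0.
by case=> /asboolP ->; rewrite ?lerDl ?lerDr.
Qed.

Lemma Pr_exists (I : finType) (P : pred I) (F : I -> outcome n k j -> Prop) c :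
  (forall i, P i -> Pr p (F i) <= c) ->
  Pr p (fun w => exists2 i, P i & F i w) <= #|P|%:R * c.
Proof.
move=> hF; apply: (@le_trans _ _ (\sum_(i | P i) Pr p (F i))); last first.
  by rewrite mulr_natl -sumr_const; apply: ler_sum.
rewrite PrE (eq_bigr _ (fun i _ => PrE (F i))).
rewrite /expectation exchange_big /=; apply: ler_sum => w _; rewrite -big_distrr /=.
apply: ler_wpM2l; first exact: outcome_weight_ge0.
case: asboolP => [[i Pi /asboolP Fi]|_]; last by apply: sumr_ge0.
by rewrite (bigD1 i) //= Fi lerDl sumr_ge0.
Qed.

Lemma Pr_complement E E' c : (forall w, E w \/ E' w) -> Pr p E' <= c -> 1 - c <= Pr p E.
Proof.
move=> h hc; rewrite lerBlDr; apply: (@le_trans _ _ (Pr p E + Pr p E')).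
  by rewrite -Pr_true; apply: le_trans (Pr_or _ _); apply: ler_Pr => w _.
by rewrite lerD2l.
Qed.

End Expectation.

(** * Tail bounds for the answers and for the order *)

Section Tails.
Variables (R : realType) (n k j a : nat) (ch : choice_rule n k j).
Hypothesis jE : j = (a + (k - j) * part_index k j)%N.
Hypothesis a0 : (0 < a)%N.
Hypothesis leaq : (a <= k - j)%N.
Hypothesis ltjk : (j < k)%N.
Hypothesis chP : forall sj sk s (J : {set 'I_n}), #|J| = j ->
  extendable_partition k j a J (ch sj sk s J).
Variable p : R.
Hypothesis p01 : 0 <= p <= 1.
Implicit Types (w : outcome n k j) (tau : pred (answer n)).

Definition query_log (m : nat) w : seq (answer n) :=
  glog (iter m (gstep a ch w.1.2 w.2 w.1.1) (ginit n)).

(** The common form of the Chernoff bounds: Markov's inequality for a product of weights whose mean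
    is at most 1. *)
Lemma Pr_log_leq (E : outcome n k j -> Prop) (u : answer n -> R) (c : R) t m :
  (forall x, 0 <= u x) ->
  (forall e K, p * u (e, K, true) + (1 - p) * u (e, K, false) <= 1) ->
  (forall w, E w -> expR c <= \prod_(x <- take t (query_log m w)) u x) ->
  Pr p E <= expR (- c).
Proof.
move=> u0 u1 hE.
apply: (@Pr_markov _ _ _ _ _ p01 _
  (fun w => expR (- c) * \prod_(x <- take t (query_log m w)) u x)).
- by move=> w; rewrite mulr_ge0 ?expR_ge0 // prodr_ge0.
- by move=> w /hE; rewrite -[X in X <= _ -> _]mulr1 -ler_pdivlMl ?expR_gt0 // expRN.
- apply: expectation_leq => sj sk; under eq_bigr do rewrite mulrCA.
  rewrite -big_distrr /= -[X in _ <= X]mulr1; apply: ler_wpM2l; first exact: expR_ge0.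
  by apply: (expectation_prod_leq1 jE a0 leaq ltjk (chP sj sk) p01).
Qed.

Lemma expR_half_le2 : expR (1 / 2) <= 2 :> R.
Proof.
rewrite -[X in _ <= X]invrK -[expR _]invrK lef_pV2 ?posrE ?invr_gt0 ?expR_gt0 //.
by rewrite -expRN; apply: le_trans (expR_ge1Dx _); lra.
Qed.

Lemma prod_log_expR (tau : pred (answer n)) (x z : R) (l : seq (answer n)) :
  \prod_(u <- l) (if tau u then (if u.2 then expR x else 1) * expR z else 1) =
  expR (x * (count (fun u => u.2 && tau u) l)%:R + z * (count tau l)%:R).
Proof.
elim: l => [|u l IH]; first by rewrite big_nil !mulr0 addr0 expR0.
rewrite big_cons IH /= !natrD !mulrDr; case: (tau u) => /=; last first.
  by rewrite andbF /= !mulr0 !add0r mul1r.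
rewrite andbT; case: u.2; rewrite /= ?mulr1 ?mulr0 ?mul1r -!expRD; congr expR; ring.
Qed.

(** Take the weight exp(1/2) per hit and exp(-p) per query of type [tau]: a step has mean at most (1
    + p) exp(-p) <= 1, because exp(1/2) <= 2. The hypothesis on [tau] makes the type of a query
    known before its answer. *)
Lemma tail_upper tau b t m : (forall e K, tau (e, K, true) = tau (e, K, false)) ->
  Pr p (fun w =>
    2 * p * (count tau (take t (query_log m w)))%:R + b
      < (count (fun x => x.2 && tau x) (take t (query_log m w)))%:R)
  <= expR (- (b / 2)).
Proof.
move=> htau; have /andP[p0 p1] := p01.
apply: (@Pr_log_leq _ (fun u => if tau u then (if u.2 then expR (1 / 2) else 1) * expR (- p) else 1)
  (b / 2) t m) => [x|e K|w].
- by case: ifP => // _; rewrite mulr_ge0 ?expR_ge0 //; case: ifP => // _; rewrite expR_ge0.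
- rewrite htau /=; case: (tau _); last by rewrite !mulr1 addrC subrK.
  have h1 : expR (- p) * (1 + p) <= 1.
    by rewrite expRN ler_pdivrMl ?expR_gt0 // mulr1 expR_ge1Dx.
  have h2 : 0 <= expR (- p) * (p * (2 - expR (1 / 2))).
    by rewrite !mulr_ge0 ?expR_ge0 // subr_ge0 expR_half_le2.
  lra.
- move=> h; rewrite prod_log_expR // ler_expR; lra.
Qed.

Lemma expRN_quadratic (z : R) : 0 <= z -> expR (- z) <= 1 - z + z ^+ 2.
Proof.
move=> z0; have z1 : 0 < 1 + z by lra.
apply: (@le_trans _ _ (1 + z)^-1).
  by rewrite expRN lef_pV2 ?posrE ?expR_gt0 // expR_ge1Dx.
rewrite -[_^-1]mul1r ler_pdivrMr //.
have := exprn_ge0 3 z0; lra.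
Qed.

(** Take the weight exp(-z) per edge and exp(p (z - z^2)) per query; the mean is at most 1 because
    exp(-z) <= 1 - z + z^2. The condition on the size is there because a run may make fewer than [t]
    queries. The tilt [z] is left to be optimised. *)
Lemma tail_lower (z d : R) t m : 0 <= z -> Pr p (fun w =>
    size (take t (query_log m w)) = t /\
    (count (fun x => x.2) (take t (query_log m w)))%:R <= t%:R * p - d)
  <= expR (z ^+ 2 * (t%:R * p) - z * d).
Proof.
move=> z0; have /andP[p0 p1] := p01.
rewrite -(opprB (z * d) (z ^+ 2 * (t%:R * p))).
pose tau0 : pred (answer n) := fun _ => true.
apply: (@Pr_log_leq _ (fun u => if tau0 u then (if u.2 then expR (- z) else 1)
    * expR (p * (z - z ^+ 2)) else 1) _ t m) => [x|e K|w [sz hX]].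
- by rewrite mulr_ge0 ?expR_ge0 //; case: ifP => // _; rewrite expR_ge0.
- rewrite /= mul1r mulrA -mulrDl.
  have h1 : (1 - p * (z - z ^+ 2)) * expR (p * (z - z ^+ 2)) <= 1.
    rewrite -ler_pdivlMr ?expR_gt0 // mul1r -expRN.
    exact: (expR_ge1Dx (- (p * (z - z ^+ 2)))).
  apply: le_trans h1; apply: ler_wpM2r; first exact: expR_ge0.
  have := ler_wpM2l p0 (expRN_quadratic z0); lra.
- rewrite (prod_log_expR tau0) ler_expR (eq_count (a1 := tau0) (a2 := predT)) // count_predT sz.
  rewrite (eq_count (a2 := fun x => x.2)); last by move=> x /=; rewrite andbT.
  have := ler_wpM2l z0 hX; lra.
Qed.

(** With [al] the proportion of j-sets containing [I], 2 to the power of the count has mean at most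
    (1 + al)^m <= exp(m al), and 2 >= exp(1/2) turns this into an exponential moment. *)
Lemma tail_order (I : {set 'I_n}) (b : R) m : (m <= 'C(n, j))%N -> Pr p (fun w =>
    2 * (m%:R * (#|supersets j I|%:R / 'C(n, j)%:R)) + b
      < (count (fun J : {set 'I_n} => I \subset J) (take m (listing w.1.2)))%:R)
  <= expR (- (b / 2)).
Proof.
move=> lem; have cT : #|{: subsets n j}| = 'C(n, j).
  by rewrite card_sig -cardsE card_draws card_ord.
pose A : {set subsets n j} := [set x : subsets n j | I \subset val x].
have cA : #|A| = #|supersets j I|.
  rewrite -(card_imset _ val_inj); apply: eq_card => J; rewrite !inE.
  apply/imsetP/andP => [[x + ->]|[sIJ cJ]]; first by rewrite inE => ->; split=> //; exact: (valP x).
  by exists (Sub J cJ); rewrite ?inE SubK.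
pose S : {set subsets n j} := [set x in take m (enum {: subsets n j})].
have cS : #|S| = m.
  have /card_uniqP : uniq (take m (enum {: subsets n j})) by rewrite take_uniq // enum_uniq.
  by rewrite size_takel ?cardE -?cardE ?cT // => <-; apply: eq_card => x; rewrite inE.
pose al : R := #|supersets j I|%:R / 'C(n, j)%:R.
have al0 : 0 <= al by rewrite divr_ge0.
pose Z (sj : {perm subsets n j}) : R := expR (- (b / 2)) *
  (expR (- (m%:R * al)) * \prod_(x in S) (1 + (sj x \in A)%:R)).
apply: (@Pr_markov _ _ _ _ _ p01 _ (fun w => Z w.1.2)).
- move=> w; rewrite /Z !mulr_ge0 ?expR_ge0 // prodr_ge0 // => x _.
- move=> [[H sj] sk] /=; rewrite -/al /Z => h.
  have -> : \prod_(x in S) (1 + (sj x \in A)%:R) =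
      2 ^+ (count (fun J : {set 'I_n} => I \subset J) (take m (listing sj))) :> R.
    rewrite /listing -map_take count_map -big_enum /=.
    rewrite (perm_big (take m (enum {: subsets n j}))) /=; last first.
      by apply: uniq_perm; rewrite ?enum_uniq ?take_uniq ?enum_uniq // => x; rewrite mem_enum inE.
    elim: (take _ _) => [|x l IH]; first by rewrite big_nil.
    by rewrite big_cons IH /= inE exprD; case: (_ \subset _); rewrite ?addr0.
  set c := count _ _ in h *.
  apply: (@le_trans _ _ (expR (- (b / 2)) * (expR (- (m%:R * al)) * expR (c%:R * (1 / 2))))).
    rewrite -!expRD -[X in X <= _]expR0 ler_expR; lra.
  rewrite !ler_wpM2l ?expR_ge0 // expRM_natl lerXn2r ?nnegrE ?expR_ge0 //.
  exact: expR_half_le2.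
- apply: expectation_order_leq; rewrite /Z -!big_distrr /=.
  rewrite [X in _ <= X]mulrC; apply: ler_wpM2l; first exact: expR_ge0.
  apply: le_trans (ler_wpM2l (expR_ge0 _) (sum_perm_exp R A S)) _.
  rewrite mulrCA -[X in _ <= X]mulr1 ler_wpM2l // cT cA cS -/al.
  rewrite expRN ler_pdivrMl ?expR_gt0 // mulr1 expRM_natl lerXn2r ?nnegrE ?expR_ge0 //.
    by rewrite addr_ge0.
  exact: expR_ge1Dx.
Qed.

End Tails.

(** One index for all types in the union bound: all queries, jumps, and pivots of level l at index l
    + 2. The recursion reaches level r + 1, whence r + 4 indices. *)
Definition query_type n (I : {set 'I_n}) (i : nat) : pred (answer n) :=
  match i with 0%N => fun _ => true | 1%N => jump I | l.+2 => pivot I l end.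

(** * The good event and its probability *)

Section Good.
Variables (R : realType) (n k j a : nat) (ch : choice_rule n k j).
Hypothesis jE : j = (a + (k - j) * part_index k j)%N.
Hypothesis a0 : (0 < a)%N.
Hypothesis leaq : (a <= k - j)%N.
Hypothesis ltjk : (j < k)%N.
Hypothesis chP : forall sj sk s (J : {set 'I_n}), #|J| = j ->
  extendable_partition k j a J (ch sj sk s J).
Variable p : R.
Hypothesis p01 : 0 <= p <= 1.
Variables (T m : nat) (b y d : R).
Implicit Types (w : outcome n k j) (I : {set 'I_n}) (l : seq (answer n)).

Local Notation r := (part_index k j).
Local Notation qlog := (query_log a ch m).

Definition hits (tau : pred (answer n)) l : nat := count (fun x => x.2 && tau x) l.

(** The error in [good_lower] is wide enough for a union bound over all times. The error [d] is
    chosen for time [T] alone, where the failure probability may tend to 0 too slowly for such a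
    union bound. *)
Record good w : Prop := Good {
  good_order : forall I i, (#|I| <= j)%N -> (i <= 'C(n, j))%N ->
    (count (fun J : {set 'I_n} => I \subset J) (take i (listing w.1.2)))%:R
    <= 2 * (i%:R * (#|supersets j I|%:R / 'C(n, j)%:R)) + b;
  good_upper : forall I i t, (#|I| <= j)%N -> (i < r + 4)%N -> (t <= T)%N ->
    (hits (query_type I i) (take t (qlog w)))%:R
    <= 2 * p * (count (query_type I i) (take t (qlog w)))%:R + b;
  good_lower : forall t, (t <= T)%N -> size (take t (qlog w)) = t ->
    t%:R * p - Num.sqrt (t%:R * p * y) <= (count (fun x => x.2) (take t (qlog w)))%:R;
  good_final : size (take T (qlog w)) = T ->
    T%:R * p - d <= (count (fun x => x.2) (take T (qlog w)))%:R
}.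

(** z = s / (2 t p) minimises z^2 t p - z s, with value -s^2 / (4 t p) = -y / 4. If t p <= s, the
    event is void since a count is nonnegative; this also disposes of t p = 0. *)
Lemma Pr_sqrt_tail t : 0 <= y -> Pr p (fun w => size (take t (qlog w)) = t /\
    (count (fun x => x.2) (take t (qlog w)))%:R < t%:R * p - Num.sqrt (t%:R * p * y))
  <= expR (- (y / 4)).
Proof.
move=> y0; have /andP[p0 p1] := p01.
have tp0 : 0 <= t%:R * p by rewrite mulr_ge0.
set s := Num.sqrt _; have s0 : 0 <= s by apply: sqrtr_ge0.
have [h|h] := lerP (t%:R * p) s.
  apply: (Pr_markov p01 (Z := fun=> 0)) => // [w [_ hw]|].
    have := lt_le_trans hw (_ : _ <= 0); rewrite subr_le0 => /(_ h).
    by rewrite ltNge ler0n.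
  by rewrite /expectation; under eq_bigr do rewrite mulr0; rewrite sumr_const mul0rn expR_ge0.
have tp1 : 0 < t%:R * p by apply: le_lt_trans h.
have e : s ^+ 2 = t%:R * p * y by rewrite sqr_sqrtr // mulr_ge0.
apply: le_trans (ler_Pr p01 (E' := fun w => size (take t (qlog w)) = t /\
    (count (fun x => x.2) (take t (qlog w)))%:R <= t%:R * p - s) _) _.
  by move=> w [-> /ltW].
apply: le_trans (tail_lower jE a0 leaq ltjk chP p01 s t m
   (z := s / (2 * (t%:R * p))) _) _; first by rewrite divr_ge0 // mulr_ge0.
rewrite ler_expR le_eqVlt; apply/orP; left; apply/eqP.
rewrite expr_div_n [X in _ - X]mulrAC -expr2 e; move: tp1.
by set v := t%:R * p => v0; field; rewrite gt_eqF.
Qed.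

Lemma Pr_final_tail : 0 <= d -> 0 < T%:R * p -> Pr p (fun w => size (take T (qlog w)) = T /\
    (count (fun x => x.2) (take T (qlog w)))%:R < T%:R * p - d)
  <= expR (- (d ^+ 2 / (4 * (T%:R * p)))).
Proof.
move=> d0 tp1.
apply: le_trans (ler_Pr p01 (E' := fun w => size (take T (qlog w)) = T /\
    (count (fun x => x.2) (take T (qlog w)))%:R <= T%:R * p - d) _) _.
  by move=> w [-> /ltW].
apply: le_trans (tail_lower jE a0 leaq ltjk chP p01 d T m
   (z := d / (2 * (T%:R * p))) _) _; first by rewrite divr_ge0 // mulr_ge0 // ltW.
rewrite ler_expR le_eqVlt; apply/orP; left; apply/eqP; move: tp1.
by set v := T%:R * p => v0; field; rewrite gt_eqF.
Qed.

Lemma Pr_good : 0 <= y -> 0 <= d -> 0 < T%:R * p ->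
  1 - (#|[pred I : {set 'I_n} | (#|I| <= j)%N]|%:R *
        (('C(n, j)%:R + 1 + (r%:R + 4) * (T%:R + 1)) * expR (- (b / 2)))
       + (T%:R + 1) * expR (- (y / 4)) + expR (- (d ^+ 2 / (4 * (T%:R * p)))))
  <= Pr p good.
Proof.
move=> y0 d0 Tp0.
pose B1 w := exists2 I : {set 'I_n}, (#|I| <= j)%N & exists2 i : 'I_('C(n, j)).+1, true &
  2 * (i%:R * (#|supersets j I|%:R / 'C(n, j)%:R)) + b <
    (count (fun J : {set 'I_n} => I \subset J) (take i (listing w.1.2)))%:R.
pose B2 w := exists2 I : {set 'I_n}, (#|I| <= j)%N & exists2 i : 'I_(r + 4), true &
  exists2 t : 'I_T.+1, true &
    2 * p * (count (query_type I i) (take t (qlog w)))%:R + b <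
    (hits (query_type I i) (take t (qlog w)))%:R.
pose B3 w := exists2 t : 'I_T.+1, true & size (take t (qlog w)) = t /\
    (count (fun x => x.2) (take t (qlog w)))%:R < t%:R * p - Num.sqrt (t%:R * p * y).
pose B4 w := size (take T (qlog w)) = T /\
    (count (fun x => x.2) (take T (qlog w)))%:R < T%:R * p - d.
apply: (Pr_complement p01 (E' := fun w => (B1 w \/ B2 w) \/ B3 w \/ B4 w)) => [w|].
  have [hB|nB] := pselect ((B1 w \/ B2 w) \/ B3 w \/ B4 w); [by right|left].
  split.
  - move=> I i hI hi; rewrite leNgt; apply/negP => h; apply: nB; left; left.
    by exists I => //; exists (Ordinal (hi : i < 'C(n, j).+1)%N).
  - move=> I i t hI hi ht; rewrite leNgt; apply/negP => h; apply: nB; left; right.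
    by exists I => //; exists (Ordinal hi) => //; exists (Ordinal (ht : t < T.+1)%N).
  - move=> t ht sz; rewrite leNgt; apply/negP => h; apply: nB; right; left.
    by exists (Ordinal (ht : t < T.+1)%N).
  - by move=> sz; rewrite leNgt; apply/negP => h; apply: nB; right; right.
apply: le_trans (Pr_or p01 _ _) _; rewrite -addrA; apply: lerD.
  rewrite mulrDl mulrDr; apply: le_trans (Pr_or p01 _ _) _; apply: lerD.
    apply: (Pr_exists p01 (P := fun I : {set 'I_n} => (#|I| <= j)%N)) => I hI.
    have -> : 'C(n, j)%:R + 1 = #|'I_('C(n, j)).+1|%:R :> R by rewrite card_ord -addn1 natrD.
    apply: (Pr_exists p01 (P := predT)) => i _.
    have li : (i <= 'C(n, j))%N by rewrite -ltnS ltn_ord.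
    exact: (tail_order k p01 I b li).
  apply: (Pr_exists p01 (P := fun I : {set 'I_n} => (#|I| <= j)%N)) => I hI; rewrite -mulrA.
  have -> : r%:R + 4 = #|'I_(r + 4)|%:R :> R by rewrite card_ord natrD.
  apply: (Pr_exists p01 (P := predT)) => i _.
  have -> : T%:R + 1 = #|'I_T.+1|%:R :> R by rewrite card_ord -addn1 natrD.
  apply: (Pr_exists p01 (P := predT)) => t _.
  apply: (tail_upper jE a0 leaq ltjk chP p01) => e K.
  by case: (i : nat) => [|[|l]].
apply: le_trans (Pr_or p01 _ _) _; apply: lerD; last exact: Pr_final_tail.
have -> : T%:R + 1 = #|'I_T.+1|%:R :> R by rewrite card_ord -addn1 natrD.
by apply: (Pr_exists p01 (P := predT)) => t _; apply: Pr_sqrt_tail.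
Qed.

End Good.

(** * Deterministic analysis on the good event *)

Section Analysis.
Variables (R : realType) (n k j a : nat) (ch : choice_rule n k j).
Hypothesis jE : j = (a + (k - j) * part_index k j)%N.
Hypothesis a0 : (0 < a)%N.
Hypothesis leaq : (a <= k - j)%N.
Hypothesis ltjk : (j < k)%N.
Hypothesis j2 : (2 <= j)%N.
Hypothesis chP : forall sj sk s (J : {set 'I_n}), #|J| = j ->
  extendable_partition k j a J (ch sj sk s J).
Variable w : outcome n k j.
Variables (C : nat -> R) (beta eps delta p b d : R) (T mm : nat).
Local Notation q := (k - j)%N.
Local Notation r := (part_index k j).
Local Notation N := (n%:R).
Local Notation c := ('C(q, a)%:R).
Local Notation B := ('C(n - j, q)%:R).
Local Notation y := (N `^ beta).
Local Notation target := (target_length (n := n) k j eps delta).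
Local Notation inv := (invariant k a w.1.2).
Local Notation run m := (iter m (gstep a ch w.1.2 w.2 w.1.1) (ginit n)).
Implicit Types (g : gstate n) (I J S : {set 'I_n}).

(* A lower bound for the number of queries made from an explored j-set. *)
Definition min_queries : R := (1 + delta * eps / 2) / (c * p).

Hypothesis ltkn : (k < n)%N.
Hypothesis p_gt0 : 0 < p.
Hypothesis eps_gt0 : 0 < eps.
Hypothesis delta_gt0 : 0 < delta.
Hypothesis C_ge0 : forall i, (i <= j - 1)%N -> 0 <= C i.
Hypothesis C_mono : forall i i', (i <= i' <= j - 1)%N -> C i <= C i'.
Hypothesis T_ceil : T%:Z = Num.ceil (N ^+ (q + 1) / eps).
Hypothesis T_gt0 : (0 < T)%N.
Hypothesis b_ge0 : 0 <= b.
(** The first summand bounds the k-sets blocked by the path, the second those blocked by explored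
    j-sets. *)
Hypothesis blocked_few : (1 - delta) * eps * N / (N - j%:R) * B
  + 2 ^+ j * (C (j - 1) * T%:R / N ^+ j + y * N ^+ (q - 1)) <= B - min_queries.

Definition degree_bound (t : nat) (i : nat) : R := C i * t%:R / N ^+ (q + i) + y.

Lemma n_gt0 : 0 < N :> R.
Proof. by rewrite ltr0n (leq_ltn_trans _ ltkn). Qed.

Lemma n_ge1 : 1 <= N :> R.
Proof. by rewrite ler1n -(ltr0n R) n_gt0. Qed.

Lemma y_ge0 : 0 <= y.
Proof. exact: powR_ge0. Qed.

Lemma c_gt0 : 0 < c :> R.
Proof. by rewrite ltr0n bin_gt0. Qed.

Lemma min_queries_gt0 : 0 < min_queries.
Proof.
rewrite divr_gt0 ?mulr_gt0 ?c_gt0 // ltr_wpDr // divr_ge0 // mulr_ge0 // ltW //.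
Qed.

(** The main terms do not depend on [S]: a degree of order t / n^(q+|S|) times n^(q-(|I|-|S|)) is t
    / n^|I|. The additive term is largest for |I| - |S| = 1, and 2^|I| counts the subsets [S]. *)
Lemma sum_degrees_leq I (f : {set 'I_n} -> nat) (t : nat) (C' : R) :
  0 <= C' ->
  (forall S, S \proper I -> (f S)%:R <= C' * t%:R / N ^+ (q + #|S|) + y) ->
  (\sum_(S : {set 'I_n} | S \proper I) f S *
     ((#|I| - #|S| <= q) * n ^ (q - (#|I| - #|S|))))%N%:R
  <= 2 ^+ #|I| * (C' * t%:R / N ^+ #|I| + y * N ^+ (q - 1)).
Proof.
move=> C'0 hf; set v := C' * t%:R / _ + _.
have v0 : 0 <= v.
  by rewrite addr_ge0 ?mulr_ge0 ?invr_ge0 ?exprn_ge0 ?y_ge0 // ltW // n_gt0.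
apply: (@le_trans _ _ (\sum_(S in powerset I) v)); last first.
  by rewrite sumr_const card_powerset -[_ *+ _]mulr_natl natrX.
rewrite natr_sum big_mkcond [X in _ <= X]big_mkcond; apply: ler_sum => S _.
case: ifPn => [prS|_]; last by case: ifP.
rewrite inE (proper_sub prS).
have ltS := proper_card prS.
case: leqP => hq; last by rewrite mul0n muln0.
rewrite mul1n natrM natrX.
apply: le_trans (ler_wpM2r _ (hf S prS)) _; first by rewrite exprn_ge0 // ltW // n_gt0.
rewrite mulrDl; apply: lerD; last first.
  by rewrite ler_wpM2l ?y_ge0 // ler_weXn2l ?n_ge1 // leq_sub2l // subn_gt0.
rewrite le_eqVlt; apply/orP; left; apply/eqP.
have e : (q + #|S| = q - (#|I| - #|S|) + #|I|)%N.
  by rewrite -{1}(subnK hq) -addnA subnK // ltnW.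
rewrite e exprD; field; rewrite !expf_neq0 // gt_eqF ?n_gt0 //.
Qed.

Lemma explore_lower g J Cs st : inv g -> stack (gst g) = (J, Cs) :: st ->
  next_query w.2 (gst g) = None ->
  (path_length (gst g))%:R < target -> (size (glog g) <= T)%N ->
  (forall S, (#|S| <= j - 1)%N -> #|[set J' in explored (gst g) | S \subset J']|%:R
     <= degree_bound (size (glog g)) #|S|) ->
  min_queries <= (count (fun x => x.1.1.1 == J) (glog g))%:R.
Proof.
move=> Ig eS hN hl hT hdeg.
have cJ := ext_card jE (stack_ext Ig eS).
have ltjn := ltn_trans ltjk ltkn.
have Nj : 0 < N - j%:R :> R by rewrite subr_gt0 ltr_nat.
have := explore_count jE a0 ltjk Ig eS hN.
rewrite -(ler_nat R) !natrD => h1.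
have h2 : (\sum_(S : {set 'I_n} | S \proper J) #|[set J' in explored (gst g) | S \subset J']| *
     ((#|J| - #|S| <= q) * n ^ (q - (#|J| - #|S|))))%N%:R
  <= 2 ^+ #|J| * (C (j - 1) * T%:R / N ^+ #|J| + y * N ^+ (q - 1)).
  apply: sum_degrees_leq; first exact: C_ge0.
  move=> S prS; have := proper_card prS; rewrite cJ => ltS.
  have leS : (#|S| <= j - 1)%N by rewrite subn1 -ltnS prednK // ltnW.
  apply: le_trans (hdeg S leS) _; rewrite lerD2r ler_wpM2r //.
  by rewrite ler_pM ?C_ge0 ?ler_nat // C_mono // leS leqnn.
(* Both factors k - j in the denominator of the target are spent here: one on the k - j vertices per
   edge, the other on the ratio of 'C(n-j-1, k-j-1) to 'C(n-j, k-j), which is (k - j) / (n - j). *)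
have h3 : (q * path_length (gst g) * 'C(n - j.+1, k - j.+1))%N%:R
    <= (1 - delta) * eps * N / (N - j%:R) * B.
  have q0 : 0 < q%:R :> R by rewrite ltr0n subn_gt0.
  have e : (N - j%:R) * 'C(n - j.+1, k - j.+1)%:R = q%:R * B :> R.
    rewrite -natrB ?(ltnW ltjn) // -!natrM; congr _%:R.
    have := mul_bin_diag (n - j) (k - j.+1).
    by rewrite -subnS subnSK.
  have {}e : 'C(n - j.+1, k - j.+1)%:R = q%:R * B / (N - j%:R) :> R.
    by rewrite -e mulrC mulKf // gt_eqF.
  rewrite !natrM e.
  have -> : (1 - delta) * eps * N / (N - j%:R) * B =
      q%:R * target * (q%:R * B / (N - j%:R)).
    by rewrite /target_length; field; rewrite !gt_eqF.
  rewrite ler_wpM2r //; first by rewrite divr_ge0 ?mulr_ge0 // ltW.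
  by rewrite ler_wpM2l // ltW.
rewrite cJ in h1 h2; move: blocked_few h1 h2 h3; lra.
Qed.

Hypothesis pcB : p * (c * B) <= 2.
Hypothesis starts_slack : forall t : nat, c * Num.sqrt (t%:R * p * y) + 1
  < 2 * q`!%:R * Num.sqrt (t%:R * y / N ^+ q) + y / 2.
Hypothesis discovered_slack : forall t : nat,
  c * Num.sqrt (t%:R * p * y) + 1 + c * (2 * p * t%:R + b) < C 0 * t%:R / N ^+ q + y.
Hypothesis degree_slack : forall t i : nat, (0 < i <= j - 1)%N ->
  5 ^+ r.+1 * (2 * ((C 0 * t%:R / N ^+ q + y) * (N ^+ (j - i) / 'C(n, j)%:R)) + b
    + c * (2 * p * (2 ^+ i * (C (i - 1) * t%:R / N ^+ i + y * N ^+ (q - 1))) + b) + c * b)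
  < degree_bound t i.
Hypothesis T_lt : T%:R < 'C(n, j)%:R * min_queries.
Hypothesis final_slack : c * target + 1 + T%:R / min_queries < c * (T%:R * p - d).
Hypothesis mmE : mm = (T + 2 * #|{set 'I_n}| + 1)%N.
Hypothesis Gw : good a ch p T mm b y d w.

Lemma run_invariant m : inv (run m).
Proof. exact: (invariant_iter jE a0 leaq ltjk (chP w.1.2 w.2)). Qed.

Lemma glog_run m : (m <= mm)%N ->
  glog (run m) = take (size (glog (run m))) (query_log a ch mm w).
Proof. by move=> /(glog_prefix a ch w.1.2 w.2 w.1.1). Qed.

Lemma size_glog_run m m' : (m <= m')%N ->
  (size (glog (run m)) <= size (glog (run m')))%N.
Proof.
move=> /subnK <-; elim: (m' - m)%N => [|i IH]; first by rewrite add0n.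
apply: leq_trans IH _; rewrite addSn iterS.
by case/andP: (size_glog_gupd a ch w.1.2 w.2 (reply w.2 w.1.1 (run (i + m))) (run (i + m))).
Qed.

Definition explored_enough g : Prop := forall J, J \in explored (gst g) ->
  min_queries <= (count (fun x => x.1.1.1 == J) (glog g))%:R.

Lemma explored_time g : explored_enough g ->
  #|explored (gst g)|%:R * min_queries <= (size (glog g))%:R.
Proof.
move=> h; rewrite mulr_natl -sumr_const.
apply: (@le_trans _ _ (\sum_(J in explored (gst g)) count (fun x => x.1.1.1 == J) (glog g))%N%:R).
  by rewrite natr_sum; apply: ler_sum.
by rewrite ler_nat sum_count_leq.
Qed.

(** The [+ 1] is the latest start: the bound without it is proved just before a new start, and the
    right side only grows with time. *)
Definition few_starts g : Prop :=
  #|new_starts (gst g)|%:R <= c * Num.sqrt ((size (glog g))%:R * p * y) + 1.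

Lemma starts_at_new_start m (g := run m) : (m <= mm)%N -> (size (glog g) <= T)%N ->
  explored_enough g -> stack (gst g) = [::] ->
  #|new_starts (gst g)|%:R <= c * Num.sqrt ((size (glog g))%:R * p * y).
Proof.
move=> lem leT /explored_time hE eS.
have Ig := run_invariant m; rewrite -/g in Ig.
have eg := glog_run lem; rewrite -/g in eg; set t := size (glog g) in leT eg hE *.
have szt : size (take t (query_log a ch mm w)) = t by rewrite -eg.
have := good_lower Gw leT szt; rewrite -eg => hX.
have a0' : #|active (gst g)| = 0%N.
  by apply/eqP; rewrite cards_eq0; apply/eqP/setP => J; rewrite !inE eS.
have := card_discovered Ig; rewrite a0' add0n (inv_size Ig) => hD.
have c0 := c_gt0; move: hE; rewrite -hD natrD natrM /min_queries.
set Rs := #|_|%:R; set X := (count _ _)%:R in hX * => hE.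
have cp0 : 0 < c * p by rewrite mulr_gt0.
have h0 : 0 <= Rs + c * X by rewrite addr_ge0 ?mulr_ge0 ?ler0n.
have : Rs + c * X <= t%:R * (c * p).
  rewrite -ler_pdivrMr //; apply: le_trans hE; rewrite mulrA ler_pM2r ?invr_gt0 //.
  by rewrite ler_peMr // lerDl divr_ge0 // mulr_ge0 // ltW.
have := ler_wpM2l (ltW c0) hX; lra.
Qed.

Definition degrees_bounded g : Prop := forall I, (#|I| <= j - 1)%N ->
  (degree (gst g) I)%:R < degree_bound (size (glog g)) #|I|.

Definition explored_bounded g : Prop := forall I, (#|I| <= j - 1)%N ->
  #|[set J in explored (gst g) | I \subset J]|%:R < degree_bound (size (glog g)) #|I|.

Lemma explored_boundedW g : degrees_bounded g -> explored_bounded g.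
Proof.
move=> h I /h; apply: le_lt_trans; rewrite ler_nat; apply: subset_leq_card.
by apply/subsetP => J; rewrite !inE => /andP[-> ->]; rewrite orbT.
Qed.

(* Right after a new start no bound on the degrees of the discovered j-sets is
   available, but then the next step is a query. *)
Definition degrees_or_fresh g : Prop :=
  degrees_bounded g \/
  exists J Cs, [/\ stack (gst g) = [:: (J, Cs)],
    forall x, x \in glog g -> x.1.1.1 != J & explored_bounded g].

Definition is_snapshot m : Prop := forall m', (m' < m)%N ->
  (size (glog (run m')) < size (glog (run m)))%N.

Definition stops m : Prop := stopping_condition k j C beta eps delta (gst (run m)).

(** What persists at every step before the stop, including the steps between snapshots, at which the
    stopping conditions are not tested. *)
Record running g : Prop := Running {
  run_explored : explored_enough g;
  run_starts : few_starts g;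
  run_path : (path_length (gst g))%:R < target;
  run_time : (size (glog g) < T)%N;
  run_degrees : degrees_or_fresh g
}.

Lemma not_stops m : ~ stops m -> (size (glog (run m)) <= T)%N ->
  [/\ (path_length (gst (run m)))%:R < target, (size (glog (run m)) < T)%N
    & degrees_bounded (run m)].
Proof.
have Ig := run_invariant m; have et := timeE Ig.
move=> hs leT; split.
- by rewrite ltNge; apply/negP => h; apply: hs; apply: Or41.
- rewrite ltn_neqAle leT andbT; apply/eqP => h; apply: hs; apply: Or42.
  by rewrite /time_condition et h T_ceil.
- move=> I hI; rewrite ltNge; apply/negP => h; apply: hs; apply: Or44.
  by exists I; rewrite // et.
Qed.

Lemma snapshot_query m K : next_query w.2 (gst (run m)) = Some K -> is_snapshot m.+1.
Proof.
move=> eq m'; rewrite ltnS => /size_glog_run h; apply: leq_ltn_trans h _.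
have [e eg] := glog_gupd_Some a ch w.1.2 eq.
by rewrite iterS /gstep eg size_rcons.
Qed.

Lemma gupd_query_same g K bb : next_query w.2 (gst g) = Some K ->
  explored (gst (gupd a ch w.1.2 w.2 bb g)) = explored (gst g) /\
  new_starts (gst (gupd a ch w.1.2 w.2 bb g)) = new_starts (gst g).
Proof.
rewrite /next_query /gupd; case: stack => [//|[J Cs] st] ->.
by case: bb.
Qed.

Lemma query_bounds m K : running (run m) -> next_query w.2 (gst (run m)) = Some K ->
  [/\ explored_enough (run m.+1), few_starts (run m.+1) & (size (glog (run m.+1)) <= T)%N].
Proof.
move=> Rg eq; have [e eg] := glog_gupd_Some a ch w.1.2 eq.
have [e1 e2] := gupd_query_same (reply w.2 w.1.1 (run m)) eq.
rewrite /explored_enough /few_starts iterS {1 2}/gstep e1 /gstep e2 eg size_rcons.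
split; last exact: run_time Rg.
- move=> J /(run_explored Rg) h; apply: le_trans h _.
  by rewrite ler_nat -cats1 count_cat leq_addr.
- apply: le_trans (run_starts Rg) _; rewrite lerD2r ler_wpM2l ?ler0n //.
  by rewrite ler_wsqrtr // !ler_wpM2r ?y_ge0 ?ltW // ltr_nat.
Qed.

(** After a query, the degree and path bounds come from the failure of the stopping conditions at
    the new snapshot. A new start only loses the degree bound for the new j-set. An exploration
    leaves the discovered j-sets unchanged, and the degrees of the explored ones force the required
    number of queries from [J]. *)
Lemma running_step m : (m < mm)%N -> running (run m) ->
  (is_snapshot m.+1 -> ~ stops m.+1) -> 0 < target -> running (run m.+1).
Proof.
move=> ltm Rg hs tg0; have Ig := run_invariant m; have Ig' := run_invariant m.+1.
case eq: (next_query w.2 (gst (run m))) => [K|].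
  have [h1 h2 h3] := query_bounds Rg eq.
  have [h4 h5 h6] := not_stops (hs (snapshot_query eq)) h3.
  by split=> //; left.
have el : glog (run m.+1) = glog (run m) by rewrite iterS /gstep glog_gupd_None.
have leT := ltnW (run_time Rg).
move: Ig' el; rewrite iterS /gstep /gupd; set g := run m in Rg Ig eq leT *.
move: eq; rewrite /next_query; case eS: (stack (gst g)) => [|[J Cs] st].
  move=> _; case ef: first_in => [J|] Ig' _; last by [].
  have [nJ _ _] := first_inP ef.
  have hdeg : degrees_bounded g.
    by case: (run_degrees Rg) => // -[J' [Cs' [eS']]]; rewrite eS in eS'.
  split=> //=.
  - exact: run_explored Rg.
  - rewrite /few_starts /=; apply: le_trans (_ : (#|new_starts (gst g)| + 1)%:R <= _).
      by rewrite ler_nat cardsU1 addnC leq_add2l; case: (_ \notin _).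
    by rewrite natrD lerD2r; apply: starts_at_new_start (ltnW ltm) leT (run_explored Rg) eS.
  - exact: run_time Rg.
  - right; exists J; exists (ch w.1.2 w.2 (gst g) J); split=> //=.
      move=> x xl; have [xh _ _] := inv_log Ig xl; apply: contra nJ => /eqP<-.
      by rewrite (inv_disc Ig) inE map_f.
    exact: explored_boundedW hdeg.
move=> ef; rewrite ef => Ig' el.
have eqN : next_query w.2 (gst g) = None by rewrite /next_query eS.
have hexp : explored_bounded g.
  by case: (run_degrees Rg) => [/explored_boundedW|[? [? []]]].
have hJ : min_queries <= (count (fun x => x.1.1.1 == J) (glog g))%:R.
  apply: explore_lower Ig eS eqN (run_path Rg) leT _ => S hS.
  by rewrite ltW // hexp.
(* A fresh start has no queries yet, so it cannot be the j-set that is explored here. *)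
have hdeg : degrees_bounded g.
  case: (run_degrees Rg) => // -[J' [Cs' [eS' nJ' _]]].
  move: eS'; rewrite eS => -[eJ _ _]; rewrite -eJ in nJ'.
  move: hJ; rewrite (_ : count _ _ = 0%N) ?leNgt ?min_queries_gt0 //.
  by apply/eqP; rewrite eqn0Ngt -has_count; apply/hasPn => x /nJ'.
have hd' : degrees_bounded (GState (if (head set0 (batches (gst g)) \subset J |: explored (gst g))
           && (0 < path_length (gst g))%N then
          State st (J |: explored (gst g)) (new_starts (gst g)) (path_start (gst g))
                (behead (path_edges (gst g))) (behead (batches (gst g))) (queries (gst g))
        else
          State st (J |: explored (gst g)) (new_starts (gst g)) (path_start (gst g))
                (path_edges (gst g)) (batches (gst g)) (queries (gst g))) (ghist g) (glog g)).
  by move=> I hI; rewrite (degreeE _ Ig') /= -(degreeE _ Ig); apply: hdeg.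
split=> //.
- rewrite /explored_enough /=; move=> J'; case: ifP => _ /=;
  by rewrite !inE => /predU1P[->//|/(run_explored Rg)].
- by rewrite /few_starts /=; case: ifP => _ /=; apply: run_starts Rg.
- apply: le_lt_trans (run_path Rg); rewrite ler_nat; case: ifP => _ //=.
  by rewrite /path_length /= size_behead leq_pred.
- exact: run_time Rg.
- by left.
Qed.

Lemma size_ghist_leq g : inv g -> (size (ghist g) <= 'C(n, j))%N.
Proof.
move=> Ig; rewrite -(size_map fst) -(card_uniqP (inv_uniq Ig)).
rewrite -[X in (_ <= 'C(X, _))%N](card_ord n) -card_draws; apply: subset_leq_card.
apply/subsetP => J /mapP[e eh ->]; rewrite inE; apply/eqP.
exact: (inv_entry_card jE Ig eh).
Qed.

(** All new starts lie in the initial segment of the order whose length is the number of discovered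
    j-sets; in such a segment the sets containing [I] have about their overall proportion. *)
Lemma starts_containing_leq g I : inv g -> (#|I| <= j)%N ->
  #|[set J in new_starts (gst g) | I \subset J]|%:R <=
  2 * ((size (ghist g))%:R * (N ^+ (j - #|I|) / 'C(n, j)%:R)) + b.
Proof.
move=> Ig hI; have := good_order Gw hI (size_ghist_leq Ig).
set m := size (ghist g) => h.
apply: (@le_trans _ _ (count (fun J : {set 'I_n} => I \subset J) (take m (listing w.1.2)))%:R).
  rewrite ler_nat -size_filter; apply: leq_trans (card_size _).
  apply: subset_leq_card; apply/subsetP => J; rewrite inE mem_filter => /andP[Js ->] /=.
  have [Jh Ji] := inv_starts Ig Js.
  rewrite in_take // mem_listing; move/mapP: Jh => [e eh ->].
  by rewrite (inv_entry_card jE Ig eh).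
apply: le_trans h _; rewrite lerD2r ler_wpM2l // ler_wpM2l // ler_wpM2r ?invr_ge0 //.
rewrite -natrX ler_nat; apply: leq_trans (card_supersets_leq _ _) _.
by rewrite hI mul1n.
Qed.

Lemma hits_leq m (g := run m) I i : (m <= mm)%N -> (size (glog g) <= T)%N ->
  (#|I| <= j)%N -> (i < r + 4)%N ->
  (hits (query_type I i) (glog g))%:R <= 2 * p * (count (query_type I i) (glog g))%:R + b.
Proof.
move=> lem leT hI hi; have := good_upper Gw hI hi leT.
by rewrite -(glog_run lem).
Qed.

(** A j-set containing [I] stems from a new start, from a jump to [I], or from a j-set that already
    contains [I]. The first kind is controlled by the random order, the second by the degrees of
    smaller sets, the third by the recursion over levels. *)
Lemma degrees_bounded_at m (g := run m) : (m <= mm)%N -> (size (glog g) <= T)%N ->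
  few_starts g -> degrees_bounded g.
Proof.
move=> lem leT hst I; have Ig : inv g := run_invariant m.
have c0 := c_gt0; have N0 := n_gt0; have y0 := y_ge0.
move: {2}(#|I|) (leqnn #|I|) => i; elim: i I => [|i IH] I.
  rewrite leqn0 cards_eq0 => /eqP-> _; rewrite cards0.
  rewrite (degree0 Ig) (inv_size Ig) natrD natrM.
  have h1 : (count (fun x => x.2) (glog g))%:R <= 2 * p * (size (glog g))%:R + b.
    have h := @hits_leq m set0 0 lem leT; rewrite cards0 addnC in h.
    have := h isT isT; rewrite /= count_predT; apply: le_trans.
    by rewrite ler_nat leq_eqVlt; apply/orP; left; apply/eqP/eq_count => x; rewrite andbT.
  have := ler_wpM2l (ltW c0) h1; move: hst (discovered_slack (size (glog g))).
  rewrite /few_starts /degree_bound addn0; lra.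
rewrite leq_eqVlt => /predU1P[cI hI|]; last by rewrite ltnS; apply: IH.
have hIj : (#|I| <= j)%N by rewrite (leq_trans hI) // leq_subr.
have I0 : I != set0 by rewrite -card_gt0 cI.
pose A : R := 2 * ((C 0 * (size (glog g))%:R / N ^+ q + y) * (N ^+ (j - #|I|) / 'C(n, j)%:R)) + b
  + c * (2 * p * (2 ^+ #|I| * (C (#|I| - 1) * (size (glog g))%:R / N ^+ #|I| + y * N ^+ (q - 1))) + b).
have hS : #|[set J in new_starts (gst g) | I \subset J]|%:R <=
    2 * ((C 0 * (size (glog g))%:R / N ^+ q + y) * (N ^+ (j - #|I|) / 'C(n, j)%:R)) + b.
  apply: le_trans (starts_containing_leq Ig hIj) _.
  rewrite lerD2r ler_wpM2l // ler_wpM2r //.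
  have := IH set0; rewrite cards0 => /(_ isT isT).
  by rewrite (degree0 Ig) /degree_bound addn0 => /ltW.
have hJ : (count (jump I) (glog g))%:R <=
    2 ^+ #|I| * (C (#|I| - 1) * (size (glog g))%:R / N ^+ #|I| + y * N ^+ (q - 1)).
  apply: le_trans (_ : _ <= (\sum_(S : {set 'I_n} | S \proper I) degree (gst g) S *
     ((#|I| - #|S| <= q) * n ^ (q - (#|I| - #|S|))))%N%:R) _.
    by rewrite ler_nat; apply: (count_jump_leq jE ltjk _ Ig).
  apply: sum_degrees_leq; first by rewrite C_ge0 // (leq_trans _ hI) // leq_subr.
  move=> S /proper_card ltS.
  have leS : (#|S| <= #|I| - 1)%N by rewrite subn1 -ltnS prednK // cI.
  have leS' : (#|S| <= j - 1)%N by rewrite (leq_trans (ltnW ltS)).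
  have := IH S; rewrite -ltnS -cI => /(_ ltS leS') /ltW h; apply: le_trans h _.
  rewrite lerD2r ler_wpM2r ?invr_ge0 ?exprn_ge0 ?(ltW N0) // ler_wpM2r //.
  by rewrite C_mono // leS (leq_trans (leq_subr _ _)).
have hA : #|[set J in new_starts (gst g) | I \subset J]|%:R
    + c * (hits (jump I) (glog g))%:R <= A.
  apply: lerD hS _; rewrite ler_wpM2l ?(ltW c0) //.
  have h1 : (1 < r + 4)%N by rewrite addnC.
  apply: le_trans (hits_leq lem leT hIj h1) _; rewrite lerD2r ler_wpM2l //.
  by rewrite mulr_ge0 // ltW.
have cb0 : 0 <= c * b by rewrite mulr_ge0 // ltW.
have A0 : 0 <= A by apply: le_trans hA; rewrite addr_ge0 // mulr_ge0 // ltW.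
(* Levels are descended from r + 1, where the count is 0, to 0, where it is the degree. *)
have key l : (l <= r.+1)%N ->
    (count (deeper I (r.+1 - l)) (ghist g))%:R <= 5 ^+ l * (A + c * b).
  elim: l => [_|l IHl hl].
    by rewrite subn0 (deeper_end I Ig) expr0 mul1r addr_ge0.
  have hlr : (r.+1 - l.+1 <= r)%N by rewrite subSS leq_subr.
  have := IHl (ltnW hl); rewrite -[(r.+1 - l)%N]prednK ?subn_gt0 // -subnS.
  set v := (r.+1 - l.+1)%N in hlr * => hv.
  have := inv_level Ig I v; rewrite -(ler_nat R) natrD natrM natrD mulrDr addrA.
  move=> h; apply: le_trans h _; apply: le_trans (lerD hA (lexx _)) _.
  have hi : (v.+3 < r + 4)%N by rewrite addnC !ltnS.
  have hp : (count (fun x => x.2 && pivot I v.+1 x) (glog g))%:R <=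
      2 * p * (count (pivot I v.+1) (glog g))%:R + b := hits_leq lem leT hIj hi.
  have hc : (count (pivot I v.+1) (glog g))%:R <= (count (deeper I v.+1) (ghist g))%:R * B :> R.
    by rewrite -natrM ler_nat (count_pivot_leq jE ltjk _ _ Ig).
  set M := (count (deeper I v.+1) (ghist g))%:R in hv hc.
  have M0 : 0 <= M by rewrite ler0n.
  have h2 := ler_wpM2l (ltW c0) hp.
  have cp0 : 0 <= c * p by rewrite mulr_ge0 // ltW.
  have h3 := ler_wpM2l cp0 hc.
  have h4 := ler_wpM2r M0 pcB.
  have h5 : A + c * b <= 5 ^+ l * (A + c * b).
    by apply: ler_peMl; [exact: addr_ge0|rewrite exprn_ege1 // ler1n].
  (* A level costs a factor 5 = 1 + 4: 1 for [A + c * b] itself, and 4 because 2 p c B <= 4. *)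
  rewrite exprS; lra.
have := degree_slack (size (glog g)) _; rewrite cI => /(_ i.+1); rewrite -cI.
rewrite hI /= cI ltn0Sn => /(_ isT); rewrite -cI; apply: le_lt_trans.
rewrite -(deeper0 Ig I0); have := key r.+1 (leqnn _); rewrite subnn => h; apply: le_trans h _.
by rewrite ler_wpM2l // exprn_ge0.
Qed.

Lemma stops_path m : (m <= mm)%N -> (size (glog (run m)) <= T)%N ->
  explored_enough (run m) -> few_starts (run m) -> stops m ->
  path_condition k j eps delta (gst (run m)).
Proof.
move=> lem leT hE hst hs; have Ig := run_invariant m; have et := timeE Ig.
have c0 := c_gt0.
have hd := degrees_bounded_at lem leT hst.
case: hs => [//|ht|hns|[I hI]]; last first.
- by rewrite et leNgt => /negP[]; apply: hd.
- move: hns; rewrite /starts_condition et leNgt => /negP[].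
  by apply: le_lt_trans hst (starts_slack _).
rewrite /path_condition leNgt; apply/negP => hl.
have szT : size (glog (run m)) = T.
  by move: ht; rewrite /time_condition et -T_ceil => -[].
have hX : T%:R * p - d <= (count (fun x => x.2) (glog (run m)))%:R.
  have eg := glog_run lem; rewrite szT in eg.
  by rewrite eg; apply: (good_final Gw); rewrite -eg szT.
have hexp := explored_time hE; rewrite szT in hexp.
have hexp' : #|explored (gst (run m))|%:R <= T%:R / min_queries.
  by rewrite ler_pdivlMr ?min_queries_gt0.
have := card_active_leq jE Ig; rewrite -(ler_nat R) natrD natrM => hact.
have := card_discovered Ig; rewrite (inv_size Ig) => /(congr1 (fun i => i%:R : R)).
rewrite !natrD natrM => hD.
have hns : 0 <= #|new_starts (gst (run m))|%:R :> R by rewrite ler0n.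
have h1 := ler_wpM2l (ltW c0) hX.
have := ler_wpM2l (ltW c0) (ltW hl) => h2.
move: final_slack hexp' hact hD hns h1 h2; lra.
Qed.

Lemma running_init : 0 < target -> ~ stops 0 -> running (run 0).
Proof.
move=> tg0 hs; have [h1 h2 h3] := not_stops hs (leq0n _).
split=> //=.
- by move=> J; rewrite inE.
- by rewrite /few_starts /= cards0 addr_ge0 // mulr_ge0 // sqrtr_ge0.
- by left.
Qed.

(** A termination measure: each running step queries, explores or starts. With fewer than [T]
    queries it stays below [mm]. *)
Definition progress g : nat :=
  size (glog g) + #|explored (gst g)| + #|new_starts (gst g)|.

Lemma progress_step m : (m < mm)%N -> running (run m) -> (progress (run m) < progress (run m.+1))%N.
Proof.
move=> ltm Rg; have Ig := run_invariant m.
case eq: (next_query w.2 (gst (run m))) => [K|].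
  have [e eg] := glog_gupd_Some a ch w.1.2 eq.
  have [e1 e2] := gupd_query_same (reply w.2 w.1.1 (run m)) eq.
  by rewrite /progress iterS {2 3}/gstep e1 e2 /gstep eg size_rcons.
move: eq; rewrite /next_query iterS /gstep /gupd; set g := run m in Rg Ig *.
case eS: (stack (gst g)) => [|[J Cs] st].
  have a0' : active (gst g) = set0 by apply/setP => J; rewrite !inE eS.
  move=> _; case ef: first_in => [J|].
    rewrite /progress /= ltn_add2l cardsU1; have [nJ _ _] := first_inP ef.
    rewrite (contra _ nJ) ?add1n // => Js; rewrite (inv_disc Ig) inE.
    by case: (inv_starts Ig Js).
  (* No neutral j-set is left, so all j-sets are explored; this would have taken more than [T]
     queries. *)
  exfalso; have hE := explored_time (run_explored Rg).
  have hC : ('C(n, j) <= #|explored (gst g)|)%N.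
    rewrite -[X in ('C(X, _) <= _)%N](card_ord n) -card_draws; apply: subset_leq_card.
    apply/subsetP => J; rewrite inE => /eqP cJ.
    have := first_in_None ef cJ; rewrite negbK.
    by rewrite /discovered a0' set0U.
  have h1 : 'C(n, j)%:R * min_queries <= #|explored (gst g)|%:R * min_queries.
    by rewrite ler_wpM2r ?(ltW min_queries_gt0) // ler_nat.
  have h2 : (size (glog g))%:R < T%:R :> R by rewrite ltr_nat (run_time Rg).
  by move: T_lt h1 h2 hE; rewrite -/g; lra.
move=> ->; have nJE : J \notin explored (gst g).
  have Ja : J \in active (gst g) by rewrite -[J]/((J, Cs).1) mem_active // eS mem_head.
  by rewrite (disjointFr (inv_disj Ig)).
by rewrite /progress /=; case: ifP => _ /=; rewrite ltn_add2r ltn_add2l cardsU1 nJE add1n ltnS.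
Qed.

(** At the first stopping snapshot all earlier steps are running, so only the path condition can
    apply. Without such a snapshot the run would make [mm] running steps, and [progress] would
    exceed its bound. *)
Lemma exists_stop : 0 < target -> exists m, [/\ (m <= mm)%N, is_snapshot m,
   path_condition k j eps delta (gst (run m)), stops m &
   forall m', (m' < m)%N -> is_snapshot m' -> ~ stops m'].
Proof.
move=> tg0.
have [[m [lem [sm hm]]]|nex] := pselect (exists m, (m <= mm)%N /\ is_snapshot m /\ stops m).
  have ex : exists m, (m <= mm)%N && `[< is_snapshot m /\ stops m >].
    by exists m; rewrite lem; apply/asboolP.
  case: (ex_minnP ex) => {}m /andP[{}lem /asboolP[{}sm {}hm]] hmin.
  have before m' : (m' < m)%N -> is_snapshot m' -> ~ stops m'.
    move=> ltm' sm' hs; have := hmin m'; rewrite (leq_trans (ltnW ltm')) //=.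
    rewrite asboolT // => /(_ isT); by rewrite leqNgt ltm'.
  have runs m' : (m' < m)%N -> running (run m').
    elim: m' => [ltm'|m' IH ltm'].
      by apply: running_init => //; apply: before.
    apply: running_step => //; [exact: leq_trans (ltnW ltm') lem|exact/IH/ltnW|].
    exact: before.
  exists m; split=> //; case: m lem sm hm {hmin before} runs => [|m] lem sm hm runs.
    apply: stops_path hm => //.
    - by move=> J; rewrite inE.
    - by rewrite /few_starts /= cards0 addr_ge0 // mulr_ge0 // sqrtr_ge0.
  have Rg := runs m (ltnSn m).
  case eq: (next_query w.2 (gst (run m))) => [K|].
    by have [h1 h2 h3] := query_bounds Rg eq; apply: stops_path.
  by have := sm m (ltnSn m); rewrite iterS /gstep glog_gupd_None // ltnn.
exfalso.
have runs m : (m <= mm)%N -> running (run m).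
  elim: m => [_|m IH lem].
    by apply: running_init => // hs; apply: nex; exists 0%N.
  apply: running_step => //; first exact/IH/ltnW.
  by move=> sm hs; apply: nex; exists m.+1.
have prog m : (m <= mm)%N -> (m <= progress (run m))%N.
  elim: m => // m IH lem; apply: leq_ltn_trans (IH (ltnW lem)) _.
  exact: progress_step lem (runs _ (ltnW lem)).
have := prog mm (leqnn _); rewrite leqNgt => /negP; apply.
rewrite {2}mmE addn1 ltnS mul2n -addnn /progress addnA.
by rewrite !leq_add ?max_card // ltnW // (run_time (runs _ _)).
Qed.

End Analysis.

(** * From steps of the run to the stopping time and the longest path *)

Section Events.
Variables (R : realType) (n k j a : nat) (ch : choice_rule n k j).
Hypothesis jE : j = (a + (k - j) * part_index k j)%N.
Hypothesis a0 : (0 < a)%N.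
Hypothesis leaq : (a <= k - j)%N.
Hypothesis ltjk : (j < k)%N.
Hypothesis chP : forall sj sk s (J : {set 'I_n}), #|J| = j ->
  extendable_partition k j a J (ch sj sk s J).
Variable w : outcome n k j.
Variables (C : nat -> R) (beta eps delta : R).
Hypothesis eps_gt0 : 0 < eps.
Hypothesis delta_le1 : delta <= 1.
Local Notation grun m := (iter m (gstep a ch w.1.2 w.2 w.1.1) (ginit n)).
Local Notation inv := (invariant k a w.1.2).
Local Notation target := (target_length (n := n) k j eps delta).

Lemma runE m : run a ch w m = gst (grun m).
Proof. by rewrite gst_iter. Qed.

Lemma grun_invariant m : inv (grun m).
Proof. exact: (invariant_iter jE a0 leaq ltjk (chP w.1.2 w.2)). Qed.

Lemma time_run m : time (run a ch w m) = size (glog (grun m)).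
Proof. by rewrite runE (timeE (grun_invariant m)). Qed.

Lemma time_runS m : (time (run a ch w m) <= time (run a ch w m.+1) <= (time (run a ch w m)).+1)%N.
Proof. by rewrite !time_run iterS; apply: size_glog_gupd. Qed.

Lemma time_run_mono m m' : (m <= m')%N -> (time (run a ch w m) <= time (run a ch w m'))%N.
Proof.
move=> /subnK <-; elim: (m' - m)%N => [|i IH]; first by rewrite add0n.
by apply: leq_trans IH _; rewrite addSn; case/andP: (time_runS (i + m)).
Qed.

Lemma path_length_gupd bb g : (path_length (gst (gupd a ch w.1.2 w.2 bb g)) <=
  path_length (gst g) + (next_query w.2 (gst g) : bool))%N.
Proof.
rewrite /gupd /next_query; case: stack => [|[J Cs] st]; first by case: first_in => //; rewrite addn0.
case: first_in => [K|] /=.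
  by case: bb; rewrite /path_length /= addn1.
by rewrite addn0; case: ifP => _ //; rewrite /path_length /= size_behead leq_pred.
Qed.

Lemma path_length_runS m : (path_length (run a ch w m.+1) <= (path_length (run a ch w m)).+1)%N.
Proof.
rewrite !runE iterS; apply: leq_trans (path_length_gupd _ _) _.
by case: (next_query w.2 (gst (grun m))) => [K|] /=; rewrite ?addn1 ?addn0.
Qed.

Lemma path_length_same_time m m' : (m <= m')%N ->
  time (run a ch w m) = time (run a ch w m') ->
  (path_length (run a ch w m') <= path_length (run a ch w m))%N.
Proof.
move=> /subnK <-; elim: (m' - m)%N => [|i IH] // et.
rewrite addSn in et *.
have e2 : time (run a ch w m) = time (run a ch w (i + m)).
  apply/eqP; rewrite eqn_leq time_run_mono ?leq_addl //= et.
  by case/andP: (time_runS (i + m)).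
apply: leq_trans (IH e2); rewrite !runE iterS; apply: leq_trans (path_length_gupd _ _) _.
case eq: (next_query w.2 (gst (grun (i + m)))) => [K|]; last by rewrite addn0.
move: et; rewrite e2 !time_run iterS /gstep; have [e eg] := glog_gupd_Some a ch w.1.2 eq.
by rewrite eg size_rcons => /n_Sn.
Qed.

Lemma target_ge0 : 0 <= target.
Proof. by rewrite mulr_ge0 ?subr_ge0 // divr_ge0 ?mulr_ge0 ?exprn_ge0 // ltW. Qed.

(** A query lengthens the path by at most one edge, and the steps between queries never lengthen it.
    At the previous snapshot the path was below the target, so at the stop its length is the target
    rounded up. *)
Lemma stops_at_iff :
  (exists t s, stops_at a ch C beta eps delta w t s /\ path_condition k j eps delta s) <->
  (exists t s, [/\ stops_at a ch C beta eps delta w t s,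
     (path_length s <= longest_tight_path j w.1.1)%N &
     (path_length s)%:Z = Num.ceil target]).
Proof.
split=> -[t [s]]; last first.
  move=> [hs _ hl]; exists t, s; split=> //; rewrite /path_condition.
  by have := ceil_ge target; rewrite -hl -pmulrn.
case=> hs hp; exists t, s; split=> //.
  case: hs => -[m [-> _ _]] _ _; rewrite runE.
  exact: (path_length_leq jE leaq ltjk (grun_invariant m) (consistent_iter _ _ _ _ _ _)).
have [[m [em et hm]] _ hbefore] := hs.
case: m em et hm => [|m] em et hm.
  have l0 : path_length s = 0%N by rewrite em.
  move: hp; rewrite /path_condition l0 => hp.
  have -> : target = 0 by apply/le_anti; rewrite target_ge0 hp.
  by rewrite ceil0.
have ltm : (time (run a ch w m) < t)%N := hm m (ltnSn m).
have etm : t = (time (run a ch w m)).+1.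
  apply/eqP; rewrite eqn_leq ltm andbT -et em.
  by case/andP: (time_runS m).
have ex : exists i, time (run a ch w i) == time (run a ch w m) by exists m.
(* [m1] is the step of the previous snapshot; up to step [m] no query intervenes. *)
case: (ex_minnP ex) => m1 /eqP e1 hmin.
have le1 : (m1 <= m)%N by apply: hmin.
have s1 : snapshot a ch w (time (run a ch w m)) (run a ch w m1).
  exists m1; split=> // m' ltm'; rewrite ltn_neqAle -e1 time_run_mono ?(ltnW ltm') // andbT.
  by apply/negP => h; have := hmin m'; rewrite -e1 h leqNgt ltm' => /(_ isT).
have nstop := hbefore _ _ ltm s1.
have hl : (path_length (run a ch w m))%:R < target.
  apply: (@le_lt_trans _ _ (path_length (run a ch w m1))%:R).
    by rewrite ler_nat; apply: path_length_same_time.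
  by rewrite ltNge; apply/negP => h; apply: nstop; apply: Or41.
apply/esym/ceil_def; rewrite intrB -!pmulrn hp andbT.
apply: le_lt_trans hl; rewrite lerBlDr natr1 ler_nat em.
exact: path_length_runS.
Qed.

Lemma stops_at_intro : (0 < target -> exists m, [/\ is_snapshot a ch w m,
     path_condition k j eps delta (gst (grun m)), stops a ch w C beta eps delta m &
     forall m', (m' < m)%N -> is_snapshot a ch w m' -> ~ stops a ch w C beta eps delta m']) ->
  exists t s, stops_at a ch C beta eps delta w t s /\ path_condition k j eps delta s.
Proof.
(* A target that is not positive is met by the empty path at time 0. *)
move=> h; have [tg0|tg0] := ltrP 0 target; last first.
  have hp : path_condition k j eps delta (init (n := n)) by [].
  exists 0%N, init; split=> //; split=> //; first by exists 0%N.
  exact: Or41.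
have [m [sm hp hs hb]] := h tg0.
exists (time (run a ch w m)), (run a ch w m); split; last by rewrite runE.
split.
- by exists m; split=> // m' /sm; rewrite !time_run.
- by rewrite runE.
- move=> t' s' ltt [m' [-> et' hm']]; rewrite runE; apply: hb.
    rewrite ltnNge; apply/negP => /time_run_mono; rewrite leqNgt et' => /negP; exact.
  by move=> m''; rewrite -!time_run et'; apply: hm'.
Qed.

End Events.

(** * Numerical estimates for large n *)

Lemma exp_sub_leq (s q n : nat) : (s <= n)%N ->
  (n ^ q <= (n - s) ^ q + q * s * n ^ q.-1)%N.
Proof.
move=> sn; elim: q => [|q IH] //.
rewrite expnS; apply: leq_trans (leq_mul (leqnn n) IH) _.
have h : ((n - s) ^ q <= n ^ q)%N by case: (q) => // q'; rewrite leq_exp2r // leq_subr.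
rewrite mulnDr /= -{1}(subnK sn) mulnDl -expnS -addnA leq_add2l.
rewrite mulSn mulnDl leq_add //; first by rewrite leq_mul2l h orbT.
case: q {IH h} => [|q]; first by rewrite !mul0n muln0.
by rewrite /= mulnCA -expnS.
Qed.

Lemma ffact_geq (s u q n : nat) : (u + q <= s)%N -> (s <= n)%N ->
  ((n - s) ^ q <= (n - u) ^_ q)%N.
Proof.
elim: q u => [|q IH] u; first by rewrite ffactn0.
rewrite addnS -addSn => hu sn; rewrite expnS ffactnS leq_mul ?leq_sub2l //.
  by rewrite (leq_trans _ hu) // addSn ltnW // ltnS leq_addr.
by rewrite -subnS IH.
Qed.

(* Bernoulli's inequality makes [(n - u)^_q >= n ^ q / 2] once [n >= 2 s q]. *)
Lemma bin_geq (s u q n : nat) : (u + q <= s)%N -> (0 < s)%N -> (2 * (s * q) <= n)%N -> (s <= n)%N ->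
  (n ^ q <= 2 * (q`! * 'C(n - u, q)))%N.
Proof.
move=> hu s0 hn sn; rewrite [(q`! * _)%N]mulnC bin_ffact.
apply: leq_trans (leq_mul (leqnn 2) (ffact_geq hu sn)).
have h := exp_sub_leq q sn; rewrite mul2n -addnn.
have h2 : (2 * (q * s * n ^ q.-1) <= n ^ q)%N.
  case: q hu hn {h} => [|q] hu hn; first by [].
  by rewrite /= expnS !mulnA leq_mul2r [(2 * q.+1 * s)%N]mulnAC -mulnA hn orbT.
lia.
Qed.

Section Numeric.
Variables (R : realType) (n k j a : nat).
Hypothesis jE : j = (a + (k - j) * part_index k j)%N.
Hypothesis a0 : (0 < a)%N.
Hypothesis leaq : (a <= k - j)%N.
Hypothesis ltjk : (j < k)%N.
Hypothesis j2 : (2 <= j)%N.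
Local Notation q := (k - j)%N.
Local Notation r := (part_index k j).
Local Notation N := (n%:R).
Local Notation c := ('C(q, a)%:R).
Local Notation B := ('C(n - j, q)%:R).
Local Notation Q := (q`!%:R).

(* The loss in passing from the degrees of (i - 1)-sets to those of i-sets. *)
Definition growth_factor : R := 5 ^+ r.+1 * (4 * j`!%:R + 8 * Q * 2 ^+ j).
(** [growth_factor] is required of C_i / C_{i-1}, [4 * (c + 2) * Q] of C_0 for the total number of
    discovered j-sets, and [16 * c + 8] of delta / eps at time T_0. *)
Definition threshold : R := growth_factor + 16 * c + 4 * (c + 2) * Q + 8.

Variables (C : nat -> R) (beta e dl : R).
Local Notation p := ((1 + e) * p0 R k j a n).
Local Notation y := (N `^ beta).
Local Notation b := (Num.sqrt y).
Local Notation target := (target_length (n := n) k j e dl).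
Let T := `|Num.ceil (N ^+ (q + 1) / e)|%N.
Let d := dl * e / 8 * (T%:R * p).

Hypothesis C0 : threshold <= C 0.
Hypothesis CS : forall i, (i.+1 <= j - 1)%N -> threshold * C i <= C i.+1.
Hypothesis e0 : 0 < e.
Hypothesis eM : threshold * e <= dl.
Hypothesis dl1 : dl <= 1.
Hypothesis N1 : (2 * (k * q) <= n)%N.
Hypothesis N2 : (2 * (j * j) <= n)%N.
Hypothesis N3 : (k < n)%N.
Hypothesis N4 : 4 * Q <= N :> R.
Hypothesis N5 : 4 * growth_factor <= N.
Hypothesis E1 : 3 * 2 ^+ (j + 2) * Q * C (j - 1) <= e ^+ 3 * N.
Hypothesis E2 : 6 * j%:R <= e ^+ 3 * N.
Hypothesis E3 : 16 * j`!%:R * Q < e ^+ 3 * N.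
Hypothesis E4 : (3 * 2 ^+ (j + 1) * Q) ^+ 3 <= e ^+ 3 * N.
Hypothesis b1 : 4 * c + 4 <= b.
Hypothesis b2 : 4 * (5 ^+ r.+1 * (1 + 2 * c)) <= b.
Hypothesis y3 : y ^+ 3 <= N.

Lemma q_gt0 : (0 < q)%N.
Proof. by rewrite subn_gt0. Qed.

Lemma c_ge1 : 1 <= c :> R.
Proof. by rewrite ler1n bin_gt0. Qed.

Lemma Q_ge1 : 1 <= Q :> R.
Proof. by rewrite ler1n fact_gt0. Qed.

Lemma c_leQ : c <= Q :> R.
Proof.
rewrite ler_nat -(bin_fact leaq) leq_pmulr // muln_gt0 !fact_gt0 //.
Qed.

Lemma growth_factor_ge0 : 0 <= growth_factor.
Proof. by rewrite mulr_ge0 ?exprn_ge0 // addr_ge0 ?mulr_ge0 ?exprn_ge0. Qed.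

Lemma N_gt0 : 0 < N :> R.
Proof. by rewrite ltr0n (leq_ltn_trans _ N3). Qed.

Lemma N_ge1 : 1 <= N :> R.
Proof. by rewrite ler1n (leq_ltn_trans _ N3). Qed.

Lemma pow_pred : N ^+ (q - 1) = N ^+ q / N :> R.
Proof.
by rewrite -[X in _ = N ^+ X / _](subnK q_gt0) addn1 exprSr mulfK // gt_eqF // N_gt0.
Qed.

Lemma threshold_ge8 : 8 <= threshold.
Proof.
rewrite /threshold; have := growth_factor_ge0; have := c_ge1; have := Q_ge1.
move=> h1 h2 h3; have : 0 <= (c + 2) * Q :> R by rewrite mulr_ge0 // addr_ge0.
lra.
Qed.

Lemma e_small : 8 * e <= dl.
Proof. by apply: le_trans eM; rewrite ler_wpM2r ?threshold_ge8 // ltW. Qed.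

Lemma e_le : e <= 1 / 8.
Proof. have := e_small; have := dl1; lra. Qed.

Lemma dl_gt0 : 0 < dl.
Proof. by have := e_small; move: e0; lra. Qed.

Lemma C_pos i : (i <= j - 1)%N -> threshold <= C i.
Proof.
elim: i => // i IH hi; have h := IH (ltnW hi); apply: le_trans (CS hi).
have t8 := threshold_ge8; have t1 : 1 <= C i by lra.
by rewrite -[X in X <= _]mulr1 ler_wpM2l //; lra.
Qed.

Lemma C_nonneg i : (i <= j - 1)%N -> 0 <= C i.
Proof. by move=> /C_pos; have := threshold_ge8; lra. Qed.

Lemma C_nondecreasing i i' : (i <= i' <= j - 1)%N -> C i <= C i'.
Proof.
case/andP => /subnK <-; elim: (i' - i)%N => [|l IH]; first by rewrite add0n.
rewrite addSn => h; apply: le_trans (IH (ltnW h)) _; apply: le_trans (CS h).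
have h1 := C_nonneg (ltnW h); have t8 := threshold_ge8.
by apply: ler_peMl => //; lra.
Qed.

Lemma B_geq : N ^+ q <= 2 * Q * B :> R.
Proof.
rewrite -natrX -!natrM ler_nat -mulnA; apply: (@bin_geq k) => //.
- by rewrite subnKC // ltnW.
- exact: leq_ltn_trans ltjk.
- exact: ltnW.
Qed.

Lemma B_leq : Q * B <= N ^+ q :> R.
Proof.
rewrite -natrX -natrM ler_nat mulnC bin_ffact.
elim: q (n - j)%N (leq_subr j n) => // i IH [|m] hm; first by rewrite ffact0n.
by rewrite ffactnS expnS leq_mul // IH //= ltnW.
Qed.

Lemma bin_nj_geq : N ^+ j <= 2 * j`!%:R * 'C(n, j)%:R :> R.
Proof.
rewrite -natrX -!natrM ler_nat -mulnA -[X in 'C(X, _)]subn0; apply: (@bin_geq j) => //.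
- exact: ltnW.
- exact: ltnW (ltn_trans ltjk N3).
Qed.

Lemma B_gt0 : 0 < B :> R.
Proof. by rewrite ltr0n bin_gt0 leq_sub2r // ltnW. Qed.

Lemma pE : p = (1 + e) / (c * B).
Proof. by rewrite /p0 natrM. Qed.

Lemma cpE : c * p = (1 + e) / B.
Proof. by rewrite pE; field; rewrite !gt_eqF ?B_gt0 // (lt_le_trans _ c_ge1). Qed.

Lemma p_gt0' : 0 < p.
Proof.
rewrite pE divr_gt0 ?mulr_gt0 ?B_gt0 // ?(lt_le_trans _ c_ge1) //.
by move: e0; lra.
Qed.

Lemma cp_leq : c * p <= 4 * Q / N ^+ q.
Proof.
rewrite cpE ler_pdivrMr ?B_gt0 // mulrAC ler_pdivlMr ?exprn_gt0 ?N_gt0 //.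
have := B_geq; have := e_le; have := e0; have := N_gt0; set NN := N ^+ q => n0 h0 h1 h2.
have NN0 : 0 <= NN by rewrite exprn_ge0 // ltW.
have : e * NN <= 1 / 8 * NN by rewrite ler_wpM2r.
lra.
Qed.

Lemma p_le1 : p <= 1.
Proof.
rewrite pE ler_pdivrMr ?mulr_gt0 ?B_gt0 ?(lt_le_trans _ c_ge1) // mul1r.
have h1 := B_geq; have h2 := e_le; have h3 := c_ge1; have h4 := Q_ge1.
have h5 : N <= N ^+ q :> R by rewrite -[X in X <= _]expr1 ler_weXn2l ?N_ge1 // q_gt0.
have h6 : 2 * Q * 2 <= 2 * Q * B :> R by apply: le_trans h1; apply: le_trans h5; move: N4; lra.
have h7 : 2 <= B :> R by move: h6; rewrite ler_pM2l //; lra.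
have : B <= c * B :> R by rewrite ler_peMl // ltW // B_gt0.
lra.
Qed.

Lemma p01 : 0 <= p <= 1.
Proof. by rewrite ltW ?p_gt0' //= p_le1. Qed.

Lemma eN_ge : e ^+ 3 * N <= e ^+ 2 * N /\ e ^+ 2 * N <= e * N.
Proof.
have h := e_le; have h0 := ltW e0; have n0 := ltW N_gt0.
have h2 : e ^+ 2 <= e by rewrite expr2 ler_piMl //; lra.
split; rewrite ler_wpM2r //.
by rewrite exprS ler_piMl ?exprn_ge0 //; lra.
Qed.

Lemma T_ge : N ^+ (q + 1) / e <= T%:R.
Proof.
rewrite /T natr_absz ger0_norm; first exact: ceil_ge.
rewrite ceil_ge0 (lt_le_trans (ltrN10 _)) // divr_ge0 ?exprn_ge0 ?ltW ?N_gt0 //.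
Qed.

Lemma T_ceil' : T%:Z = Num.ceil (N ^+ (q + 1) / e).
Proof.
rewrite /T gez0_abs // ceil_ge0 (lt_le_trans (ltrN10 _)) //.
by rewrite divr_ge0 ?exprn_ge0 ?ltW ?N_gt0.
Qed.

Lemma T_quot_ge1 : 1 <= N ^+ (q + 1) / e.
Proof.
rewrite ler_pdivlMr // mul1r; have := e_le => h; apply: (@le_trans _ _ 1); first lra.
by rewrite exprn_ege1 // N_ge1.
Qed.

Lemma T_le : T%:R <= 2 * (N ^+ (q + 1) / e).
Proof.
have h : T%:R - 1 < N ^+ (q + 1) / e.
  have /andP[h _] := ceil_itv (N ^+ (q + 1) / e).
  by move: h; rewrite intrB -T_ceil' -pmulrn.
have := T_quot_ge1; lra.
Qed.

Lemma T_gt0' : (0 < T)%N.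
Proof. by rewrite -(ltr0n R); apply: lt_le_trans T_ge; apply: lt_le_trans T_quot_ge1. Qed.

(** With K the constant in front of [y], cubing gives K^3 y^3 <= (e^3 N)^2 N = (e^2 N)^3. The bound
    y^3 <= N reflects beta <= 1/3. *)
Lemma y_leq : 3 * 2 ^+ (j + 1) * Q * y <= e ^+ 2 * N.
Proof.
set K : R := 3 * 2 ^+ (j + 1) * Q.
have K1 : 1 <= K.
  by rewrite -[X in X <= _]mulr1 ler_pM ?Q_ge1 // -[X in X <= _]mulr1 ler_pM ?exprn_ege1 ?ler1n.
have K0 : 0 <= K by exact: le_trans K1.
have y0 : 0 <= y by exact: powR_ge0.
have n0 := N_gt0; have e0' := ltW e0.
rewrite -(@ler_pXn2r _ 3%N) ?nnegrE ?mulr_ge0 ?exprn_ge0 ?(ltW n0) //.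
have h : K ^+ 3 <= (e ^+ 3 * N) ^+ 2.
  apply: (@le_trans _ _ ((K ^+ 3) ^+ 2)); first by rewrite expr2 ler_peMl ?exprn_ege1 ?exprn_ge0.
  by rewrite ler_pXn2r ?nnegrE ?mulr_ge0 ?exprn_ge0 // (ltW n0).
rewrite exprMn; apply: le_trans (ler_pM _ _ h y3) _; rewrite ?exprn_ge0 //.
by rewrite le_eqVlt; apply/orP; left; apply/eqP; ring.
Qed.

Local Notation mq := (min_queries k j a e dl p).

Lemma mqE : mq = B * (1 + dl * e / 2) / (1 + e).
Proof.
rewrite /min_queries cpE; field; rewrite ?gt_eqF ?B_gt0 //; have := e0; lra.
Qed.

(** To first order, [B - mq] is (1 - dl / 2) e B, against (1 - dl) e B for the path. Three errors,
    the shift from N to N - j and the two terms for explored j-sets, get e^2 B / 3 each; 8 e <= dl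
    absorbs them. *)
Lemma blocked_few' : (1 - dl) * e * N / (N - j%:R) * B
  + 2 ^+ j * (C (j - 1) * T%:R / N ^+ j + y * N ^+ (q - 1)) <= B - mq.
Proof.
have n0 := N_gt0; have e0' := e0; have B0 := B_gt0; have Q1 := Q_ge1.
have he := e_le; have hs := e_small; have [hN3 hN2] := eN_ge.
have Cj0 : 0 <= C (j - 1) by exact: C_nonneg.
have j1 : 1 <= j%:R :> R by rewrite ler1n ltnW.
have hN : 2 * (j%:R * j%:R) <= N :> R by rewrite -!natrM ler_nat.
have Nj : 0 < N - j%:R :> R.
  have : j%:R <= j%:R * j%:R :> R by rewrite ler_peMl.
  lra.
have h1 : (1 - dl) * e * N / (N - j%:R) * B <= (1 - dl) * e * B + e ^+ 2 / 3 * B.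
  rewrite -mulrDl ler_wpM2r ?(ltW B0) //.
  apply: (@le_trans _ _ ((1 - dl) * e * (1 + 2 * j%:R / N))).
    rewrite -mulrA ler_wpM2l ?mulr_ge0 ?subr_ge0 ?(ltW e0) //.
    rewrite ler_pdivrMr // mulrDl mul1r.
    have -> : 2 * j%:R / N * (N - j%:R) = 2 * j%:R - 2 * (j%:R * j%:R) / N :> R.
      by field; rewrite gt_eqF.
    have : 2 * (j%:R * j%:R) / N <= 1 :> R by rewrite ler_pdivrMr // mul1r.
    lra.
  have h6 : 2 * j%:R / N <= e / 3.
    rewrite ler_pdivrMr //; have := E2; lra.
  have h7 : (1 - dl) * e * (2 * j%:R / N) <= e * (e / 3).
    rewrite ler_pM ?mulr_ge0 ?subr_ge0 ?invr_ge0 ?(ltW e0) ?(ltW n0) //.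
    by rewrite ler_piMl ?(ltW e0) //; have := dl_gt0; lra.
  by rewrite mulrDr mulr1 lerD2l expr2; lra.
have h2 : 2 ^+ j * (C (j - 1) * T%:R / N ^+ j) <= e ^+ 2 / 3 * B.
  apply: (@le_trans _ _ (2 ^+ j * (C (j - 1) * (2 * (N ^+ (q + 1) / e)) / N ^+ j))).
    rewrite ler_wpM2l ?exprn_ge0 // ler_wpM2r ?invr_ge0 ?exprn_ge0 ?(ltW n0) //.
    by rewrite ler_wpM2l // T_le.
  apply: (@le_trans _ _ (2 ^+ (j + 1) * C (j - 1) / (e * N) * N ^+ q)).
    have -> : 2 ^+ j * (C (j - 1) * (2 * (N ^+ (q + 1) / e)) / N ^+ j) =
       2 ^+ (j + 1) * C (j - 1) / (e * N) * (N ^+ q * (N ^+ 2 / N ^+ j)).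
      rewrite !exprD !expr1; field; rewrite ?expf_neq0 ?gt_eqF //.
    rewrite ler_wpM2l ?mulr_ge0 ?invr_ge0 ?mulr_ge0 ?exprn_ge0 ?(ltW n0) ?(ltW e0) //.
    (* j >= 2 enters here, as N^2 / N^j <= 1. *)
    rewrite ler_piMr ?exprn_ge0 ?(ltW n0) // ler_pdivrMr ?exprn_gt0 // mul1r.
    by rewrite ler_weXn2l // N_ge1.
  apply: (@le_trans _ _ (2 ^+ (j + 1) * C (j - 1) / (e * N) * (2 * Q * B))).
    by rewrite ler_wpM2l ?B_geq // mulr_ge0 ?invr_ge0 ?mulr_ge0 ?exprn_ge0 ?(ltW n0) ?(ltW e0).
  rewrite mulrA ler_wpM2r ?(ltW B0) //.
  rewrite mulrAC ler_pdivrMr ?mulr_gt0 //.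
  have := E1; rewrite !exprD !exprS; set P := 2 ^+ j; lra.
have h3 : 2 ^+ j * (y * N ^+ (q - 1)) <= e ^+ 2 / 3 * B.
  have y0 : 0 <= y by exact: powR_ge0.
  rewrite pow_pred; apply: (@le_trans _ _ (2 ^+ j * (y * (2 * Q * B / N)))).
    rewrite ler_wpM2l ?exprn_ge0 // ler_wpM2l // ler_wpM2r ?B_geq // invr_ge0 ltW //.
  have -> : 2 ^+ j * (y * (2 * Q * B / N)) = (2 ^+ (j + 1) * Q * y) / N * B.
    by rewrite exprD expr1; field; rewrite gt_eqF.
  rewrite ler_wpM2r ?(ltW B0) // ler_pdivrMr //.
  by have := y_leq; lra.
have h4 : (1 - dl) * e * B + e ^+ 2 * B <= B - mq.
  rewrite mqE -mulrDl.
  have -> : B - B * (1 + dl * e / 2) / (1 + e) = (e - dl * e / 2) / (1 + e) * B.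
    by field; rewrite gt_eqF //; lra.
  rewrite ler_wpM2r ?(ltW B0) // ler_pdivlMr; last lra.
  have -> : e - dl * e / 2 = e * (1 - dl / 2) by ring.
  have -> : ((1 - dl) * e + e ^+ 2) * (1 + e) = e * ((1 - dl + e) * (1 + e)) by ring.
  rewrite ler_wpM2l ?(ltW e0) //.
  have de : 0 <= dl * e by rewrite mulr_ge0 ?(ltW e0) ?(ltW dl_gt0).
  have ee : e * e <= 1 / 8 * e by rewrite ler_wpM2r ?(ltW e0).
  lra.
rewrite mulrDr; move: h1 h2 h3 h4; lra.
Qed.

Lemma pcB' : p * (c * B) <= 2.
Proof.
rewrite pE mulfVK; first by have := e_le; lra.
by rewrite gt_eqF // mulr_gt0 ?B_gt0 // (lt_le_trans _ c_ge1).
Qed.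

Lemma b_sqr : b ^+ 2 = y.
Proof. by rewrite sqr_sqrtr // powR_ge0. Qed.

Lemma b_ge8 : 8 <= b.
Proof. by have := b1; have := c_ge1; lra. Qed.

Lemma b_small : 16 <= y /\ b <= y / 8.
Proof.
have h := b_ge8; have : 8 * b <= b * b by rewrite ler_wpM2r //; lra.
have := b_sqr; rewrite expr2; lra.
Qed.

Lemma starts_slack' (t : nat) : c * Num.sqrt (t%:R * p * y) + 1
  < 2 * Q * Num.sqrt (t%:R * y / N ^+ q) + y / 2.
Proof.
have c1 := c_ge1; have Q1 := Q_ge1; have y0 : 0 <= y by exact: powR_ge0.
have [y16 _] := b_small; apply: ler_ltD; last lra.
rewrite -{1}[c]ger0_norm // -sqrtr_sqr -sqrtrM ?sqr_ge0 //.
rewrite -[2 * Q]ger0_norm ?mulr_ge0 // -[`|2 * Q|]sqrtr_sqr -sqrtrM ?sqr_ge0 //.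
rewrite ler_sqrt; last by rewrite mulr_ge0 ?sqr_ge0 // !mulr_ge0 // invr_ge0 exprn_ge0.
have -> : c ^+ 2 * (t%:R * p * y) = t%:R * y * (c * (c * p)) by ring.
have -> : (2 * Q) ^+ 2 * (t%:R * y / N ^+ q) = t%:R * y * (Q * (4 * Q / N ^+ q)).
  by ring.
rewrite ler_wpM2l ?mulr_ge0 // ler_pM ?c_leQ ?cp_leq //.
by rewrite mulr_ge0 // ltW // p_gt0'.
Qed.

Lemma discovered_slack' (t : nat) :
  c * Num.sqrt (t%:R * p * y) + 1 + c * (2 * p * t%:R + b) < C 0 * t%:R / N ^+ q + y.
Proof.
have c1 := c_ge1; have Q1 := Q_ge1; have h8 := b_ge8; have hb := b1; have p0' := ltW p_gt0'.
have tp0 : 0 <= t%:R * p by rewrite mulr_ge0.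
rewrite sqrtrM // -[X in _ < _ + X]b_sqr; set x := Num.sqrt (t%:R * p).
have ex : x ^+ 2 = t%:R * p by rewrite sqr_sqrtr.
(* This is 0 <= (c x - b / 2)^2; the square root turns into a linear term in t and a quarter of
   y. *)
have h1 : c * (x * b) <= c * (c * p) * t%:R + b ^+ 2 / 4.
  have -> : c * (c * p) * t%:R = (c * x) ^+ 2 by rewrite exprMn ex; ring.
  by have := sqr_ge0 (c * x - b / 2); rewrite -subr_ge0 => h; rewrite -subr_ge0; move: h; lra.
have h2 : (c + 2) * (c * p) * t%:R <= C 0 * t%:R / N ^+ q.
  rewrite [X in _ <= X]mulrAC ler_wpM2r //.
  apply: (@le_trans _ _ ((c + 2) * (4 * Q / N ^+ q))).
    by rewrite ler_wpM2l ?cp_leq // addr_ge0.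
  rewrite mulrA ler_wpM2r ?invr_ge0 ?exprn_ge0 //.
  apply: le_trans C0; rewrite /threshold; have := growth_factor_ge0; lra.
have h3 : (4 * c + 4) * b <= b * b by rewrite ler_wpM2r //; lra.
have h4 : 8 * b <= b * b by rewrite ler_wpM2r //; lra.
rewrite expr2 in h1 *; move: h1 h2 h3 h4; lra.
Qed.

(** New starts and jumps both contribute multiples of x + y / N with x = C_{i-1} t / N^(q+i), and
    [growth_factor] collects their coefficients. The ratio C_i / C_{i-1} absorbs the part in x, the
    size of N the part in y / N, and y = b^2 the terms linear in b. *)
Lemma degree_slack' (t i : nat) : (0 < i <= j - 1)%N ->
  5 ^+ r.+1 * (2 * ((C 0 * t%:R / N ^+ q + y) * (N ^+ (j - i) / 'C(n, j)%:R)) + b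
    + c * (2 * p * (2 ^+ i * (C (i - 1) * t%:R / N ^+ i + y * N ^+ (q - 1))) + b) + c * b)
  < degree_bound n k j C beta t i.
Proof.
case/andP=> i0 hi; rewrite /degree_bound.
have n0 := N_gt0; have n1 := N_ge1; have y0 : 0 <= y by exact: powR_ge0.
have c1 := c_ge1; have Q1 := Q_ge1; have h8 := b_ge8.
have ij : (i <= j)%N by rewrite (leq_trans hi) // leq_subr.
have hi' : (i - 1 <= j - 1)%N by rewrite (leq_trans (leq_subr _ _)).
have Ci0 := C_nonneg hi'; have C00 := C_nonneg (leq0n (j - 1)).
have C0i : C 0 <= C (i - 1) by apply: C_nondecreasing.
have Ci : growth_factor * C (i - 1) <= C i.
  have ei : (i - 1).+1 = i by rewrite -addn1 subnK.
  rewrite -[X in _ <= C X]ei; apply: le_trans (CS _); last by rewrite ei.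
  rewrite ler_wpM2r // /threshold.
  have : 0 <= (c + 2) * Q :> R by rewrite mulr_ge0 // addr_ge0.
  lra.
have Nx m : 0 < N ^+ m :> R by rewrite exprn_gt0.
have x0 : 0 <= C (i - 1) * t%:R / N ^+ (q + i) by rewrite !mulr_ge0 // invr_ge0 ltW.
set x := C (i - 1) * t%:R / N ^+ (q + i) in x0.
have yN0 : 0 <= y / N by rewrite divr_ge0 // ltW.
have F0 : 0 <= 5 ^+ r.+1 :> R by exact: exprn_ge0.
have h1 : (C 0 * t%:R / N ^+ q + y) * (N ^+ (j - i) / 'C(n, j)%:R) <= 2 * j`!%:R * (x + y / N).
  have cn0 : 0 < 'C(n, j)%:R :> R.
    by rewrite ltr0n bin_gt0 ltnW // (ltn_trans ltjk N3).
  have h : N ^+ (j - i) / 'C(n, j)%:R <= 2 * j`!%:R / N ^+ i :> R.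
    rewrite ler_pdivrMr // mulrAC ler_pdivlMr // -exprD subnK //.
    exact: bin_nj_geq.
  apply: (@le_trans _ _ ((C (i - 1) * t%:R / N ^+ q + y) * (2 * j`!%:R / N ^+ i))).
    apply: ler_pM h.
    - by rewrite addr_ge0 // !mulr_ge0 // invr_ge0 ltW.
    - by rewrite divr_ge0 // ltW.
    - by rewrite lerD2r ler_wpM2r ?invr_ge0 ?(ltW (Nx _)) // ler_wpM2r.
  have -> : (C (i - 1) * t%:R / N ^+ q + y) * (2 * j`!%:R / N ^+ i) =
     2 * j`!%:R * (x + y / N ^+ i).
    by rewrite /x exprD; field; rewrite !gt_eqF.
  rewrite ler_wpM2l ?mulr_ge0 // lerD2l ler_wpM2l // lef_pV2 ?posrE //.
  by rewrite -[X in X <= _]expr1 ler_weXn2l.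
have h2 : c * (2 * p * (2 ^+ i * (C (i - 1) * t%:R / N ^+ i + y * N ^+ (q - 1)))) <=
     8 * Q * 2 ^+ j * (x + y / N).
  set v := C (i - 1) * t%:R / N ^+ i + y * N ^+ (q - 1).
  have v0 : 0 <= v by rewrite addr_ge0 // !mulr_ge0 // ?invr_ge0 ltW.
  have -> : c * (2 * p * (2 ^+ i * v)) = 2 * 2 ^+ i * (c * p) * v by ring.
  apply: (@le_trans _ _ (2 * 2 ^+ j * (4 * Q / N ^+ q) * v)).
    have cp0 : 0 <= c * p by rewrite mulr_ge0 // ltW // p_gt0'.
    rewrite ler_wpM2r //; apply: (ler_pM _ cp0 _ cp_leq).
      by rewrite mulr_ge0 ?exprn_ge0.
    by rewrite ler_wpM2l // ler_weXn2l // ler1n.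
  have ev : v = N ^+ q * (x + y / N).
    by rewrite /v /x pow_pred exprD; field; rewrite !gt_eqF.
  rewrite ev le_eqVlt; apply/orP; left; apply/eqP.
  by have := Nx q; set z := N ^+ q; set u := x + _ => z0; field; rewrite gt_eqF.
have h3 : growth_factor * (y / N) <= y / 4.
  rewrite mulrCA ler_wpM2l // ler_pdivrMr //; move: N5; lra.
have h4 : 5 ^+ r.+1 * ((1 + 2 * c) * b) <= y / 4.
  rewrite -[X in _ <= X / 4]b_sqr expr2 mulrA.
  have b0 : 0 <= b by exact: sqrtr_ge0.
  have := ler_wpM2r b0 b2; lra.
have h5 : growth_factor * x <= C i * t%:R / N ^+ (q + i).
  by rewrite /x !mulrA ler_wpM2r ?invr_ge0 ?(ltW (Nx _)) // ler_wpM2r.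
have [y16 _] := b_small.
have h6 : 5 ^+ r.+1 * (2 * ((C 0 * t%:R / N ^+ q + y) * (N ^+ (j - i) / 'C(n, j)%:R)) + b
    + c * (2 * p * (2 ^+ i * (C (i - 1) * t%:R / N ^+ i + y * N ^+ (q - 1))) + b) + c * b)
   <= growth_factor * (x + y / N) + 5 ^+ r.+1 * ((1 + 2 * c) * b).
  rewrite /growth_factor -[5 ^+ _ * _ * _]mulrA -mulrDr ler_wpM2l //.
  rewrite mulrDr; move: h1 h2; lra.
apply: le_lt_trans h6 _; rewrite mulrDr; move: h3 h4 h5; lra.
Qed.

(** [T] has order N^(q+1) / e and the right side N^(q+j), so j >= 2 and a large e N suffice. *)
Lemma T_lt' : T%:R < 'C(n, j)%:R * mq.
Proof.
have n0 := N_gt0; have n1 := N_ge1; have Q1 := Q_ge1; have B0 := B_gt0.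
have e0' := e0; have he := e_le; have [hN3 hN2] := eN_ge.
have J1 : 1 <= j`!%:R :> R by rewrite ler1n fact_gt0.
have hm : B / 2 <= mq.
  rewrite mqE -mulrA ler_wpM2l ?(ltW B0) // ler_pdivlMr; last lra.
  have : 0 <= dl * e by rewrite mulr_ge0 ?(ltW e0) ?(ltW dl_gt0).
  lra.
apply: (@lt_le_trans _ _ ('C(n, j)%:R * (B / 2))); last by rewrite ler_wpM2l.
apply: le_lt_trans T_le _.
apply: (@lt_le_trans _ _ (N ^+ j / (2 * j`!%:R) * (N ^+ q / (2 * Q) / 2))); last first.
  apply: ler_pM; rewrite ?divr_ge0 ?exprn_ge0 ?mulr_ge0 ?(ltW n0) //.
    by rewrite ler_pdivrMr ?mulr_gt0 ?bin_nj_geq 1?mulrC ?bin_nj_geq ?ltr0n ?fact_gt0.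
  rewrite ler_wpM2r // ler_pdivrMr 1?mulrC ?B_geq //; lra.
rewrite exprD expr1.
have -> : 2 * (N ^+ q * N / e) = N ^+ q * (2 * N / e) by ring.
have -> : N ^+ j / (2 * j`!%:R) * (N ^+ q / (2 * Q) / 2) =
   N ^+ q * (N ^+ j / (8 * j`!%:R * Q)) :> R.
  by field; rewrite ?gt_eqF //; lra.
rewrite ltr_pM2l ?exprn_gt0 // ltr_pdivlMr; last by rewrite !mulr_gt0 //; lra.
rewrite mulrAC ltr_pdivrMr //.
apply: (@lt_le_trans _ _ (N * (e * N))).
  have := @ltr_pM2l _ N n0 (16 * j`!%:R * Q) (e * N).
  have -> : 16 * j`!%:R * Q < e * N by move: E3; lra.
  lra.
rewrite mulrCA mulrC ler_wpM2r ?(ltW e0) // -expr2 ler_weXn2l //.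
Qed.

Lemma Tp_geq : N / e <= c * T%:R * p.
Proof.
have n0 := N_gt0; have n1 := N_ge1; have Q1 := Q_ge1; have B0 := B_gt0; have e0' := e0.
have -> : c * T%:R * p = T%:R * ((1 + e) / B) by rewrite -cpE; ring.
apply: (@le_trans _ _ (N ^+ (q + 1) / e * (1 / B))).
  have -> : N ^+ (q + 1) / e * (1 / B) = N / e * (N ^+ q / B).
    by rewrite exprD expr1; field; rewrite !gt_eqF.
  apply: ler_peMr; first by rewrite divr_ge0 // ltW.
  rewrite ler_pdivlMr // mul1r; apply: le_trans B_leq; apply: ler_peMl => //; exact: ltW.
apply: ler_pM T_ge _; rewrite ?divr_ge0 ?exprn_ge0 ?ltW //.
by rewrite ltr_pM2r ?invr_gt0 //; lra.
Qed.

(** Let x = dl e and Z = c T p >= N / e. At most Z (1 - x / 4) j-sets are explored, and of the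
    margin Z x / 4 the fluctuation [d] takes one half. The other half is at least dl N / 8 and
    exceeds c e N + 1, because dl >= (16 c + 8) e and e N >= 6. *)
Lemma final_slack' : c * target + 1 + T%:R / mq < c * (T%:R * p - d).
Proof.
have n0 := N_gt0; have n1 := N_ge1; have Q1 := Q_ge1; have B0 := B_gt0; have c1 := c_ge1.
have e0' := e0; have he := e_le; have hs := e_small; have [hN3 hN2] := eN_ge; have hd := dl1.
have d0 := dl_gt0; have p0' := p_gt0'.
set x := dl * e; set Z := c * T%:R * p.
have x0 : 0 <= x by rewrite mulr_ge0 ?ltW.
have x1 : x <= 1.
  by rewrite /x -[1]mulr1 ler_pM ?(ltW d0) ?(ltW e0) //; lra.
have hT : T%:R / mq <= Z * (1 - x / 4).
  have -> : T%:R / mq = Z / (1 + x / 2).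
    rewrite /min_queries /Z -/x; move: p0'; set pp := _ * p0 _ _ _ _ _ => p0'.
    by field; rewrite !gt_eqF //; lra.
  have Z0 : 0 <= Z by exact: (mulr_ge0 (mulr_ge0 (ler0n _ _) (ler0n _ _)) (ltW p0')).
  rewrite ler_wpM2l // -div1r ler_pdivrMr; last lra.
  have : x * x <= 1 * x by rewrite ler_wpM2r.
  lra.
have hZ : N / e <= Z := Tp_geq.
have hx : N * dl <= Z * x.
  have -> : N * dl = N / e * x by rewrite /x; field; rewrite gt_eqF.
  by rewrite ler_wpM2r.
have ht : target <= e * N.
  rewrite /target_length.
  have q1 : 1 <= q%:R ^+ 2 :> R by rewrite exprn_ege1 // ler1n q_gt0.
  apply: (@le_trans _ _ (1 * (e * N / 1))); last by rewrite mul1r divr1.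
  apply: ler_pM; rewrite ?subr_ge0 ?divr_ge0 ?mulr_ge0 ?(ltW n0) ?(ltW e0) //; first lra.
  rewrite ler_wpM2l ?mulr_ge0 ?(ltW n0) ?(ltW e0) // lef_pV2 ?posrE //; lra.
have hct := ler_wpM2l (le_trans (ltW ltr01) c1) ht.
have hM : (16 * c + 8) * e <= dl.
  apply: le_trans eM; rewrite ler_wpM2r ?(ltW e0) // /threshold.
  have := growth_factor_ge0; have : 0 <= (c + 2) * Q :> R by rewrite mulr_ge0 // addr_ge0.
  lra.
have hMN := ler_wpM2r (ltW n0) hM.
have j1 : 1 <= j%:R :> R by rewrite ler1n ltnW.
have eN1 : 6 <= e * N by move: E2; lra.
have ceN : 0 <= c * (e * N) by rewrite !mulr_ge0 // ?ltW.
have -> : c * (T%:R * p - d) = Z - Z * x / 8 by rewrite /d /Z /x; ring.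
move: hT hx hct hMN eN1 ceN; lra.
Qed.

Section Outcome.
Variable ch : choice_rule n k j.
Hypothesis chP : forall sj sk s (J : {set 'I_n}), #|J| = j ->
  extendable_partition k j a J (ch sj sk s J).
Let mm := (T + 2 * #|{set 'I_n}| + 1)%N.

Lemma good_stops (w : outcome n k j) : good a ch p T mm b y d w ->
  exists t s, stops_at a ch C beta e dl w t s /\ path_condition k j e dl s.
Proof.
move=> Gw; apply: (stops_at_intro jE a0 leaq ltjk chP) => tg0.
have [m [_ sm pm hm bm]] := exists_stop jE a0 leaq ltjk j2 chP N3 p_gt0' e0 dl_gt0
  C_nonneg C_nondecreasing T_ceil' T_gt0' (sqrtr_ge0 _) blocked_few' pcB' starts_slack'
  discovered_slack' degree_slack' T_lt' final_slack' erefl Gw tg0.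
by exists m; split.
Qed.

Definition error : R :=
  #|[pred I : {set 'I_n} | (#|I| <= j)%N]|%:R *
     (('C(n, j)%:R + 1 + (r%:R + 4) * (T%:R + 1)) * expR (- (b / 2)))
  + (T%:R + 1) * expR (- (y / 4)) + expR (- (d ^+ 2 / (4 * (T%:R * p)))).

Lemma Pr_stops : 1 - error <= Pr p (fun w : outcome n k j =>
  exists t s, stops_at a ch C beta e dl w t s /\ path_condition k j e dl s).
Proof.
have Tp0 : 0 < T%:R * p by rewrite mulr_gt0 ?p_gt0' // ltr0n T_gt0'.
apply: le_trans (Pr_good jE a0 leaq ltjk chP p01 mm b (powR_ge0 _ _) _ Tp0) _.
  by rewrite mulr_ge0 ?(ltW Tp0) // divr_ge0 // mulr_ge0 ?(ltW e0) ?(ltW dl_gt0).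
by apply: (ler_Pr p01) => w; apply: good_stops.
Qed.

End Outcome.

Lemma T_succ_leq : T%:R + 1 <= 3 * N ^+ (q + 2) :> R.
Proof.
have n0 := N_gt0; have e0' := e0; have [hN3 hN2] := eN_ge.
have N2' : 1 <= N ^+ (q + 2) :> R by rewrite exprn_ege1 // N_ge1.
have : N ^+ (q + 1) / e <= N ^+ (q + 2).
  rewrite !exprD expr1 expr2 ler_pdivrMr // -!mulrA ler_wpM2l ?exprn_ge0 ?(ltW n0) //.
  rewrite -[X in X <= _]mulr1 ler_wpM2l ?(ltW n0) // mulrC.
  have : 1 <= j%:R :> R by rewrite ler1n ltnW.
  by have := E2; lra.
have := T_le; lra.
Qed.

Lemma card_small_sets : #|[pred I : {set 'I_n} | (#|I| <= j)%N]|%:R <= j.+1%:R * N ^+ j :> R.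
Proof.
rewrite -natrX -natrM ler_nat -sum1_card.
rewrite (partition_big (fun I : {set 'I_n} => inord #|I| : 'I_j.+1) predT) //=.
rewrite -[X in (_ <= X * _)%N]card_ord -sum_nat_const leq_sum // => i _.
rewrite sum1_card; apply: (@leq_trans #|[set I : {set 'I_n} | #|I| == i]|).
  apply/subset_leq_card/subsetP => I; rewrite !inE => /andP[hI /eqP <-].
  by rewrite inordK.
rewrite card_draws card_ord; apply: leq_trans (bin_leq_exp _ _) _.
by apply: leq_pexp2l; [exact: leq_ltn_trans N3|rewrite -ltnS].
Qed.

Lemma expRN_leq (m : nat) (x : R) : (0 < m)%N -> 0 < x -> expR (- x) <= (m%:R / x) ^+ m.
Proof.
move=> m0 x0; have m0' : 0 < m%:R :> R by rewrite ltr0n.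
rewrite expRN -[m%:R / x]invrK exprVn lef_pV2 ?posrE ?expR_gt0 ?exprn_gt0 ?invr_gt0 ?divr_gt0 //.
rewrite invf_div -[X in expR X](@divfK _ m%:R _ x) ?gt_eqF // [_ / _ * _]mulrC expRM_natl.
rewrite ler_pXn2r ?nnegrE ?expR_ge0 ?divr_ge0 ?ltW //.
by apply: lt_le_trans (expR_ge1Dx _); rewrite ltrDr.
Qed.

Variable h : nat.
Hypothesis bh : N <= b ^+ h.
Local Notation h' := (h * (2 * j + q + 2)).+1.
(** Since N <= b^h, b^h' is at least b times the polynomial factor N^(2j+q+2) of the union bound;
    exp(-b/2) <= (2 h' / b)^h' then leaves a constant over b. *)
Definition error_rate : R := (j.+1%:R * (2 + 3 * (r%:R + 4)) + 3) * (2 * h'%:R) ^+ h'.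

(** For the last term of the error, dl >= 8 e and T p >= N / (c e) give d^2 / (4 T p) >= e^3 N / (4
    c), and exp(-x) <= 1 / x. The other terms are polynomially many failures of probability at most
    exp(-b/2). *)
Lemma error_leq : error <= error_rate / b + 4 * c / (e ^+ 3 * N).
Proof.
have n0 := N_gt0; have n1 := N_ge1; have b8 := b_ge8; have [y16 by8] := b_small.
have c1 := c_ge1; have p0' := p_gt0'; have e0' := e0; have d0 := dl_gt0.
have b0 : 0 < b by lra.
have Tp0 : 0 < T%:R * p by rewrite mulr_gt0 // ltr0n T_gt0'.
apply: lerD; last first.
  have hd : e ^+ 3 * N / (4 * c) <= d ^+ 2 / (4 * (T%:R * p)).
    have -> : d ^+ 2 / (4 * (T%:R * p)) = (dl * e) ^+ 2 * (T%:R * p) / 256.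
      by rewrite /d; move: Tp0; set z := T%:R * p => z0; field; rewrite gt_eqF.
    have h1 : (8 * e * e) ^+ 2 <= (dl * e) ^+ 2.
      by rewrite ler_pXn2r ?nnegrE ?mulr_ge0 ?ler_wpM2r ?e_small // ltW.
    have h2 : N / (e * c) <= T%:R * p.
      have -> : N / (e * c) = N / e / c by rewrite invfM mulrA.
    rewrite ler_pdivrMr; last lra.
    by have := Tp_geq; rewrite [c * _]mulrC mulrAC.
    apply: (@le_trans _ _ ((8 * e * e) ^+ 2 * (N / (e * c)) / 256)).
      rewrite le_eqVlt; apply/orP; left; apply/eqP; field; rewrite !gt_eqF //; lra.
    rewrite ler_wpM2r // ler_pM ?sqr_ge0 // divr_ge0 ?mulr_ge0 // ltW //; lra.
  have x0 : 0 < e ^+ 3 * N / (4 * c).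
    by rewrite divr_gt0 ?mulr_gt0 ?exprn_gt0 //; lra.
  apply: (@le_trans _ _ (expR (- (e ^+ 3 * N / (4 * c))))); first by rewrite ler_expR lerN2.
  by apply: le_trans (expRN_leq (ltn0Sn 0) x0) _; rewrite expr1 div1r invf_div.
have hy : expR (- (y / 4)) <= expR (- (b / 2)) by rewrite ler_expR lerN2; lra.
set E := expR (- (b / 2)) in hy *.
have En0 : 0 <= E by exact: expR_ge0.
have Np i : (i <= 2 * j + q + 2)%N -> N ^+ i <= N ^+ (2 * j + q + 2) :> R.
  by move=> hi; rewrite ler_weXn2l.
set W := N ^+ (2 * j + q + 2) in Np.
apply: (@le_trans _ _ ((j.+1%:R * (2 + 3 * (r%:R + 4)) + 3) * W * E)).
  set A := j.+1%:R * (2 + _); rewrite [(A + 3) * W]mulrDl [(A * W + _) * E]mulrDl {}/A.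
  apply: lerD; last first.
    apply: ler_pM hy; rewrite ?addr_ge0 ?expR_ge0 //.
    apply: le_trans T_succ_leq _; rewrite ler_wpM2l // Np // leq_add2r leq_addl //.
  rewrite mulrA ler_wpM2r //.
  have -> : j.+1%:R * (2 + 3 * (r%:R + 4)) * W =
    (j.+1%:R * N ^+ j) * ((2 + 3 * (r%:R + 4)) * N ^+ (j + q + 2)) :> R.
    by rewrite /W mul2n -addnn -!addnA exprD; ring.
  apply: (ler_pM (ler0n _ _) _ card_small_sets).
    by apply: addr_ge0; [exact: addr_ge0|apply: mulr_ge0; exact: addr_ge0].
  rewrite [(2 + _) * _]mulrDl [2 * _]mulrDl; apply: lerD; last first.
    rewrite mulrAC [X in X <= _]mulrC ler_wpM2r ?addr_ge0 //.
    by apply: le_trans T_succ_leq _; rewrite ler_wpM2l // ler_weXn2l // leq_add2r leq_addl.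
  apply: lerD; rewrite mul1r; last by rewrite exprn_ege1.
  apply: (@le_trans _ _ (N ^+ j)); last by rewrite ler_weXn2l // -addnA leq_addr.
  by rewrite -natrX ler_nat bin_leq_exp.
have hE : E <= (2 * h'%:R) ^+ h' / b ^+ h'.
  have := @expRN_leq h' (b / 2) (ltn0Sn _); rewrite -/E => /(_ _)/le_trans; apply.
    by rewrite divr_gt0.
  by rewrite -expr_div_n invf_div mulrCA mulrA.
have hW : W <= b ^+ (h * (2 * j + q + 2)).
  by rewrite exprM /W addn2 ler_pXn2r ?nnegrE ?exprn_ge0 // ltW.
rewrite /error_rate -!mulrA ler_wpM2l ?addr_ge0 ?mulr_ge0 ?addr_ge0 ?mulr_ge0 ?addr_ge0 //.
apply: le_trans (ler_pM _ En0 hW hE) _; first by rewrite exprn_ge0 // ltW.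
rewrite mulrCA ler_wpM2l ?exprn_ge0 // exprS invfM mulrCA divff ?mulr1 //.
by rewrite gt_eqF // exprn_gt0.
Qed.

End Numeric.

(** * Limits and the conclusion *)

Lemma natr_cvgy (R : realType) (A : R) : \forall n \near \oo%classic, A <= n%:R.
Proof. by move: A; apply/cvgryPge; exact: cvgr_idn. Qed.

Lemma powR_cvgy (R : realType) (beta : R) : 0 < beta ->
  forall A : R, \forall n \near \oo%classic, A <= Num.sqrt (n%:R `^ beta).
Proof.
move=> beta0 A; have [A0|A0] := lerP A 0.
  by near=> n; apply: le_trans A0 (sqrtr_ge0 _).
near=> n; have hn : (A ^+ 2) `^ beta^-1 <= n%:R by near: n; exact: natr_cvgy.
rewrite -[A](ger0_norm (ltW A0)) -sqrtr_sqr ler_sqrt ?powR_ge0 //.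
have -> : A ^+ 2 = ((A ^+ 2) `^ beta^-1) `^ beta.
  by rewrite -powRrM mulVf ?gt_eqF // powRr1 // sqr_ge0.
by apply: ge0_ler_powR; rewrite ?nnegrE ?powR_ge0 // ltW.
Unshelve. all: by end_near. Qed.

Lemma powR_cube_leq (R : realType) (beta : R) (n : nat) : 0 < beta -> 3 * beta <= 1 ->
  (0 < n)%N -> (n%:R `^ beta) ^+ 3 <= n%:R.
Proof.
move=> beta0 beta1 n0; rewrite -powR_mulrn ?powR_ge0 // -powRrM.
by rewrite -[X in _ <= X]powRr1 // ler_powR ?ler1n // mulrC.
Qed.

Lemma sqrt_powR_exp (R : realType) (beta : R) (n m : nat) : 0 < beta -> 1 <= beta * m%:R ->
  (0 < n)%N -> n%:R <= Num.sqrt (n%:R `^ beta) ^+ (2 * m).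
Proof.
move=> beta0 hm n0; rewrite exprM sqr_sqrtr ?powR_ge0 // -powR_mulrn ?powR_ge0 // -powRrM.
by rewrite -[X in X <= _]powRr1 // ler_powR ?ler1n.
Qed.

Theorem lemma30 (R : realType) (k j a : nat)
    (hj : (2 <= j <= k - 1)%N)
    (ha : (1 <= a <= k - j)%N)
    (hak : a = k %[mod k - j]) :
  exists2 M : R, 0 < M &
  forall (C : nat -> R) (beta : R) (eps delta p : nat -> R)
    (ch : forall n, choice_rule n k j),
    much_less M 1 (C 0%N) ->
    (forall i, (i.+1 <= j - 1)%N -> much_less M (C i) (C i.+1)) ->
    0 < beta -> much_less M beta 1 ->
    (forall n, 0 < eps n) ->
    (forall n, much_less M (eps n) 1) ->
    ((fun n : nat => eps n ^+ 3 * n%:R) @ \oo --> +oo)%classic ->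
    (forall n, much_less M (eps n) (delta n)) ->
    (forall n, delta n <= 1) ->
    (forall n, p n = (1 + eps n) * p0 R k j a n) ->
    (forall n sj sk s (J : {set 'I_n}), #|J| = j ->
       extendable_partition k j a J (ch n sj sk s J)) ->
    whp p (fun n w => exists t s,
      stops_at a (ch n) C beta (eps n) (delta n) w t s /\
      path_condition k j (eps n) (delta n) s)
    /\
    whp p (fun n w => exists t s,
      [/\ stops_at a (ch n) C beta (eps n) (delta n) w t s,
          (path_length s <= longest_tight_path j w.1.1)%N &
          (path_length s)%:Z =
            Num.ceil (target_length (n := n) k j (eps n) (delta n))]).
Proof.
have [j2 ltjk] : (2 <= j)%N /\ (j < k)%N by lia.
have [a0 leaq] := andP ha.
have jE : j = (a + (k - j) * part_index k j)%N.
  by apply: part_indexE => //; rewrite ltjk andbT ltnW.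
have t8 : 8 <= threshold R k j a by exact: (threshold_ge8 R leaq).
have t0 : 0 < threshold R k j a by lra.
(* The implied constant depends on k, j and a only, and a is determined by k and j. *)
exists (threshold R k j a) => // C beta eps delta p ch.
rewrite /much_less => hC0 hCS beta0 hbeta eps0 _ epsN hdelta delta1 pE chP.
have C0 : threshold R k j a <= C 0%N by move: hC0; rewrite ler_pdivlMr // mul1r.
have CS i : (i.+1 <= j - 1)%N -> threshold R k j a * C i <= C i.+1.
  by move=> /hCS; rewrite ler_pdivlMr // mulrC.
have eM n : threshold R k j a * eps n <= delta n.
  by have := hdelta n; rewrite ler_pdivlMr // mulrC.
have beta3 : 3 * beta <= 1.
  move: hbeta; rewrite div1r => h; have h8 : (threshold R k j a)^-1 <= 8^-1.
    by rewrite lef_pV2 ?posrE.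
  by lra.
(* This yields n <= b^(2h) for b^2 = n^beta, so that exp(-b/2) beats every power of n. *)
have [h hh] : exists h, 1 <= beta * h%:R.
  exists `|Num.ceil beta^-1|%N; rewrite mulrC -ler_pdivrMr // div1r natr_absz.
  by apply: le_trans (ceil_ge _) _; rewrite ler_int ler_norm.
have whp1 : whp p (fun n w => exists t s,
    stops_at a (ch n) C beta (eps n) (delta n) w t s /\
    path_condition k j (eps n) (delta n) s).
  apply/cvgrPdist_le => eta eta0.
  have Nge := @natr_cvgy R.
  have Ege : forall A, \forall n \near \oo%classic, A <= eps n ^+ 3 * n%:R by apply/cvgryPge.
  have bge := powR_cvgy beta0.
  near=> n.
  have N1 : (2 * (k * (k - j)) <= n)%N by rewrite -(ler_nat R); near: n.
  have N2 : (2 * (j * j) <= n)%N by rewrite -(ler_nat R); near: n.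
  have N3 : (k < n)%N by rewrite -(ler_nat R); near: n.
  have N4 : 4 * ((k - j)`!)%:R <= n%:R :> R by near: n.
  have N5 : 4 * growth_factor R k j <= n%:R by near: n.
  have E1 : 3 * 2 ^+ (j + 2) * ((k - j)`!)%:R * C (j - 1)%N <= eps n ^+ 3 * n%:R by near: n.
  have E2 : 6 * j%:R <= eps n ^+ 3 * n%:R by near: n.
  have E3 : 16 * (j`!)%:R * ((k - j)`!)%:R < eps n ^+ 3 * n%:R.
    by apply: (@lt_le_trans _ _ (16 * (j`!)%:R * ((k - j)`!)%:R + 1)); rewrite ?ltrDl //; near: n.
  have E4 : (3 * 2 ^+ (j + 1) * ((k - j)`!)%:R) ^+ 3 <= eps n ^+ 3 * n%:R by near: n.
  have b1 : 4 * 'C(k - j, a)%:R + 4 <= Num.sqrt (n%:R `^ beta) by near: n.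
  have b2 : 4 * (5 ^+ (part_index k j).+1 * (1 + 2 * 'C(k - j, a)%:R)) <=
    Num.sqrt (n%:R `^ beta) by near: n.
  have n0 : (0 < n)%N by exact: leq_ltn_trans N3.
  have y3 := powR_cube_leq beta0 beta3 n0.
  have bh := sqrt_powR_exp beta0 hh n0.
  have hPr := Pr_stops jE a0 leaq ltjk j2 C0 CS (eps0 n) (eM n) (delta1 n) N1 N2 N3 N4 N5
    E1 E2 E3 E4 b1 b2 y3 (chP n).
  have herr := error_leq leaq j2 (eps0 n) (eM n) (delta1 n) N3 E2 b1 bh.
  have p1 := p01 leaq ltjk (eps0 n) (eM n) (delta1 n) N1 N3 N4.
  have Pr1 := @Pr_leq1 R n k j _ p1 (fun w => exists t s,
      stops_at a (ch n) C beta (eps n) (delta n) w t s /\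
      path_condition k j (eps n) (delta n) s).
  rewrite pE ger0_norm ?subr_ge0 // lerBlDr -lerBlDl.
  have h1 : error_rate R k j (2 * h) / Num.sqrt (n%:R `^ beta) <= eta / 2.
    have b0 : 0 < Num.sqrt (n%:R `^ beta) by have := b_ge8 leaq b1; lra.
    rewrite ler_pdivrMr // [eta / 2 * _]mulrC -ler_pdivrMr ?divr_gt0 //; near: n; exact: bge.
  have h2 : 4 * 'C(k - j, a)%:R / (eps n ^+ 3 * n%:R) <= eta / 2.
    have x0 : 0 < eps n ^+ 3 * n%:R by rewrite mulr_gt0 ?exprn_gt0 ?ltr0n.
    rewrite ler_pdivrMr // [eta / 2 * _]mulrC -ler_pdivrMr ?divr_gt0 //; near: n; exact: Ege.
  apply: le_trans hPr; move: herr h1 h2; lra.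
split=> //; rewrite /whp; move: whp1; rewrite /whp.
(* The two events agree for every outcome. *)
have -> // : (fun n => Pr (p n) (fun w : outcome n k j => exists t s,
      stops_at a (ch n) C beta (eps n) (delta n) w t s /\
      path_condition k j (eps n) (delta n) s)) =
   (fun n => Pr (p n) (fun w : outcome n k j => exists t s,
      [/\ stops_at a (ch n) C beta (eps n) (delta n) w t s,
          (path_length s <= longest_tight_path j w.1.1)%N &
          (path_length s)%:Z =
            Num.ceil (target_length (n := n) k j (eps n) (delta n))])).
apply/funext => n; apply: eq_bigl => w; apply/asboolP/asboolP.
  by move/(stops_at_iff jE a0 leaq ltjk (chP n) w C beta (eps0 n) (delta1 n)).
by move/(stops_at_iff jE a0 leaq ltjk (chP n) w C beta (eps0 n) (delta1 n)).
Unshelve. all: by end_near. Qed.
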